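(* Consider the following decision problem (binary SNR URLLC admission, question Q2). An instance consists of a finite set of users $\mathcal{K}=\{1,\dots,K\}$, a finite set of resource blocks $\mathcal{R}=\{1,\dots,R\}$, a 0/1 matrix $\boldsymbol\delta=(\delta_r^k)_{k\in\mathcal{K},r\in\mathcal{R}}$, positive integers $d_k$ for $k\in\mathcal{K}$, and an integer $m$. The question is: does there exist a subset $\mathcal{M}\subseteq\mathcal{K}$ with $|\mathcal{M}|\ge m$ and a schedule $\mathbf{x}=(x_r^k)\in\{0,1\}^{K\times R}$ such that $\sum_{k\in\mathcal{K}}x_r^k\le 1$ for every $r\in\mathcal{R}$, $x_r^k\le\delta_r^k$ for all $(r,k)$, and $\sum_{r\in\mathcal{R}}x_r^k\ge d_k$ for every $k\in\mathcal{M}$? This decision problem is NP-complete.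
   Context: This is the binary SNR model of URLLC scheduling: $\delta_r^k=1$ means resource block $r$ is ''active'' (has sufficiently strong SNR) for user $k$, and user $k$'s reliability requirement is met if it is assigned at least $d_k$ active resource blocks in the frame. Each resource block can be assigned to at most one user. *)

(* Defs.v *)
From Stdlib Require Import BinNums BinNat BinPos.
From mathcomp Require Import all_boot all_order all_algebra.
Set Implicit Arguments. Unset Strict Implicit. Unset Printing Implicit Defensive.
Import GRing.Theory Num.Theory.

Definition language := seq bool -> Prop.

Definition sym := option bool.            (* None = blank *)
Inductive move := MoveL | MoveR | Stay.

Record tape := Tape { tleft : seq sym; thead : sym; tright : seq sym }.
(* tleft is stored reversed: its head is the cell just left of the head. *)

Record TM := {
  tm_state  : finType;
  tm_start  : tm_state;
  tm_halt   : pred tm_state;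
  tm_accept : pred tm_state;     (* accepting states (meaningful when halted) *)
  tm_delta  : tm_state -> sym -> tm_state * sym * move
}.

Definition move_tape (m : move) (t : tape) : tape :=
  match m with
  | Stay => t
  | MoveL => match tleft t with
             | [::] => Tape [::] None (thead t :: tright t)
             | a :: l => Tape l a (thead t :: tright t)
             end
  | MoveR => match tright t with
             | [::] => Tape (thead t :: tleft t) None [::]
             | a :: r => Tape (thead t :: tleft t) a r
             end
  end.

Definition config (M : TM) := (tm_state M * tape)%type.

Definition tm_step (M : TM) (c : config M) : config M :=
  let: (q, t) := c in
  if tm_halt q then c else
  let: (q', s, mv) := tm_delta q (thead t) in
  (q', move_tape mv (Tape (tleft t) s (tright t))).

Definition init_tape (w : seq bool) : tape :=
  match w with
  | [::] => Tape [::] None [::]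
  | b :: w' => Tape [::] (Some b) (map Some w')
  end.

Definition tm_run (M : TM) (n : nat) (w : seq bool) : config M :=
  iter n (@tm_step M) (tm_start M, init_tape w).

Fixpoint read_bits (s : seq sym) : seq bool :=
  match s with
  | Some b :: s' => b :: read_bits s'
  | _ => [::]
  end.
Definition tape_output (t : tape) : seq bool := read_bits (thead t :: tright t).

Definition decides_within (M : TM) (L : language) (bound : nat -> nat) : Prop :=
  forall w, let c := tm_run M (bound (size w)) w in
    tm_halt c.1 /\ (tm_accept c.1 <-> L w).

Definition computes_within (M : TM) (f : seq bool -> seq bool)
  (bound : nat -> nat) : Prop :=
  forall w, let c := tm_run M (bound (size w)) w in
    tm_halt c.1 /\ tape_output c.2 = f w.

Definition poly (c k : nat) (n : nat) : nat := c * n ^ k + c.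

Definition in_P (L : language) : Prop :=
  exists (M : TM) (c k : nat), decides_within M L (poly c k).

Definition poly_time_computable (f : seq bool -> seq bool) : Prop :=
  exists (M : TM) (c k : nat), computes_within M f (poly c k).

Definition self_delim (w : seq bool) : seq bool :=
  flatten (map (fun b => [:: true; b]) w) ++ [:: false; false].
Definition pair_enc (w y : seq bool) : seq bool := self_delim w ++ y.

Definition in_NP (L : language) : Prop :=
  exists (V : language) (c k : nat), in_P V /\
    forall w, L w <-> exists y, size y <= poly c k (size w) /\ V (pair_enc w y).

Definition poly_reducible (L1 L2 : language) : Prop :=
  exists f, poly_time_computable f /\ forall w, L1 w <-> L2 (f w).

Definition NP_hard (L : language) : Prop :=
  forall L', in_NP L' -> poly_reducible L' L.

Definition NP_complete (L : language) : Prop := in_NP L /\ NP_hard L.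

Fixpoint pos_bits (p : positive) : seq bool :=
  match p with
  | xH => [:: true]
  | xO p' => false :: pos_bits p'
  | xI p' => true :: pos_bits p'
  end.
(* little-endian binary representation *)
Definition nat_bits (n : nat) : seq bool :=
  match N.of_nat n with N0 => [::] | Npos p => pos_bits p end.
Definition enc_nat (n : nat) : seq bool := self_delim (nat_bits n).
Definition enc_int (z : int) : seq bool :=
  match z with
  | Posz n => true :: enc_nat n
  | Negz n => false :: enc_nat n.+1   (* Negz n = -(n+1) *)
  end.

Record urllc_instance := {
  nK : nat;                                  (* users 'I_nK *)
  nR : nat;                                  (* resource blocks 'I_nR *)
  delta : 'I_nK -> 'I_nR -> bool;            (* delta k r = delta_r^k *)
  dem : 'I_nK -> nat;
  thr : int
}.

Definition valid_instance (I : urllc_instance) : Prop :=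
  forall k, 0 < @dem I k.

Definition enc_instance (I : urllc_instance) : seq bool :=
  enc_nat (nK I) ++ enc_nat (nR I)
  ++ [seq @delta I k r | k <- enum 'I_(nK I), r <- enum 'I_(nR I)]
  ++ flatten [seq enc_nat (@dem I k) | k <- enum 'I_(nK I)]
  ++ enc_int (thr I).

Definition Q2_yes (I : urllc_instance) : Prop :=
  exists (Ms : {set 'I_(nK I)}) (x : 'I_(nK I) -> 'I_(nR I) -> bool),
    [/\ (thr I <= (#|Ms| : int))%R,
        (forall r, \sum_(k < nK I) (x k r : nat) <= 1),
        (forall k r, (x k r : nat) <= @delta I k r) &
        (forall k, k \in Ms -> @dem I k <= \sum_(r < nR I) (x k r : nat))].

Definition Q2_language : language :=
  fun w => exists I, [/\ valid_instance I, enc_instance I = w & Q2_yes I].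

(* Main.v *)
(**
Bounded-sum expressions over the naturals, which can also test the bits of the input,
denote functions computable in polynomial time: an expression is compiled to a register
machine whose registers are marks on a row of cells, each instruction is one pass over a
queue holding that row, and a Turing machine with alphabet {blank, 0, 1} simulates the
queue. A string is computable as soon as its length and its bits are given by such
expressions.

Membership in NP: the certificate lists an instance together with a schedule, in a format
from which every bit is directly accessible; the verifier re-encodes the instance, compares
the result with the word, and checks the schedule.

Hardness: the rows of a space-time tableau are laid end to end, so that neighbouring cells
are at distance 1 or W. Users are the pairs (position, triple of adjacent cell contents),
and two users conflict when they contradict each other. Every user asks for all of its
active blocks, so an admissible set of users is an independent set of the conflict graph,
and one of size N (the number of positions) is an accepting tableau.
*)
Require Import Defs.
From Stdlib Require Import BinNat FunctionalExtensionality.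
From mathcomp Require Import all_boot all_order all_algebra zify.
Import Defs.
Set Implicit Arguments. Unset Strict Implicit. Unset Printing Implicit Defensive.

(** * Turing machines simulating queue machines *)

(** Two size constraints shape the proof. The range of a sum is itself given by an expression, so
    all values stay polynomial in the length of the word and running times come for free; but then
    neither [2 ^ i] for a variable [i], nor a number written in binary in the word, can be a value.
    Binary digits are therefore found by searching among the powers of two below a small number, and
    in the verifier the demands, the threshold and, without users, the number of blocks remain bit
    arrays that are only re-encoded or compared with small numbers. The tape alphabet has no spare
    marker: blanks are the only delimiters, the queue drifts rightwards over the tape, and its
    larger alphabet is coded in bits. The language asks for some instance encoding to the word, so
    hardness needs the encoding to be injective. Laying rows end to end makes the end of a row
    adjacent to the start of the next. This is harmless because the rows are wide enough for the
    head never to visit their first or last cell. *)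

Definition upd T (F : nat -> T) i x j := if j == i then x else F j.

(** The two-way tape is seen as a row of cells indexed from 0 with the head at [h]. The last clause
    puts only blanks left of cell 0, so left moves are tracked only from a positive [h]. *)
Definition tape_rep (t : tape) (F : nat -> sym) (h : nat) :=
  [/\ thead t = F h, forall j, nth None (tright t) j = F (h + j).+1 &
      forall j, nth None (tleft t) j = if j < h then F (h - j.+1) else None].

Definition hmove mv h := match mv with MoveL => h.-1 | MoveR => h.+1 | Stay => h end.

Lemma tape_rep_move t F h s mv : tape_rep t F h -> (mv = MoveL -> 0 < h) ->
  tape_rep (move_tape mv (Tape (tleft t) s (tright t))) (upd F h s) (hmove mv h).
Proof.
case: t => l a r [/= Ha Hr Hl]; case: mv => /= Hh.
- have {}Hh := Hh erefl; have Hl0 := Hl 0; split => /=.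
  + by case: l Hl Hl0 => [|x l] Hl /=; rewrite /upd Hh subn1; case: eqP => //; lia.
  + by case: l Hl Hl0 => [|x l] Hl Hl0 [|j] /=; rewrite /upd ?Hr;
      case: eqP => // *; try lia; congr F; lia.
  + move=> j; transitivity (nth None l j.+1); first by case: (l) => //=; rewrite nth_nil.
    rewrite Hl (_ : (j < h.-1) = (j.+1 < h)); last by lia.
    case: ltnP => // Hj; rewrite /upd; case: eqP => ?; first by lia.
    by congr F; lia.
- have Hr0 := Hr 0; split => /=.
  + by case: r Hr Hr0 => [|x r] Hr /= ->; rewrite /upd addn0; case: eqP => //; lia.
  + move=> j; have := Hr j.+1.
    by case: r Hr Hr0 => [|x r] Hr Hr0 /=; rewrite ?nth_nil /upd => ->;
      case: eqP => ?; try lia; congr F; lia.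
  + move=> j.
    by case: r Hr Hr0 => [|x r] Hr Hr0 /=; case: j => [|j] /=; rewrite ?Hl /upd ?subn1 ?eqxx //;
      rewrite ltnS; case: ifP => // ?; case: eqP => ?; try lia; congr F; lia.
- split=> [|j|j] /=; rewrite /upd ?eqxx ?Hr ?Hl //; first by case: eqP => //; lia.
  by case: ifP => // ?; case: eqP => //; lia.
Qed.

Section AbstractRun.
Variable M : TM.

Definition crep (c : config M) q F h := c.1 = q /\ tape_rep c.2 F h.

Lemma crep_ext c q F F' h : F =1 F' -> crep c q F h -> crep c q F' h.
Proof.
move=> E [H0 [H1 H2 H3]]; split=> //; split=> [|j|j]; rewrite -?E ?H2 ?H3 //.
Qed.

Lemma crep_step c q F h q' s mv : crep c q F h -> ~~ tm_halt q ->
  tm_delta q (F h) = (q', s, mv) -> (mv = MoveL -> 0 < h) ->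
  crep (tm_step c) q' (upd F h s) (hmove mv h).
Proof.
case: c => q0 t [/= -> Ht] /negbTE Hq Hd Hm; rewrite /tm_step Hq.
have [Hh _ _] := Ht; rewrite Hh Hd; split=> //=; exact: tape_rep_move.
Qed.

(** The number of steps [u] is chosen before the configuration, hence depends on the represented row
    alone; [t] only bounds it, so budgets can be rounded up when runs are chained. *)
Definition reaches t q F h q' F' h' := exists2 u, u <= t &
  forall c, crep c q F h -> crep (iter u (@tm_step M) c) q' F' h'.

Lemma reaches_refl t q F F' h : F =1 F' -> reaches t q F h q F' h.
Proof. by move=> E; exists 0 => // c; apply: crep_ext. Qed.

Lemma reaches_trans t1 t2 t q F h q1 F1 h1 q2 F2 h2 :
  reaches t1 q F h q1 F1 h1 -> reaches t2 q1 F1 h1 q2 F2 h2 -> t1 + t2 <= t ->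
  reaches t q F h q2 F2 h2.
Proof.
move=> [u1 l1 H1] [u2 l2 H2] lt; exists (u2 + u1); first by lia.
by move=> c /H1 /H2; rewrite -iterD.
Qed.

Lemma reaches_step q F F' h q' s mv h' : ~~ tm_halt q ->
  tm_delta q (F h) = (q', s, mv) -> (mv = MoveL -> 0 < h) ->
  upd F h s =1 F' -> hmove mv h = h' -> reaches 1 q F h q' F' h'.
Proof.
move=> H1 H2 H3 E <-; exists 1 => // c H.
exact: crep_ext E (crep_step H H1 H2 H3).
Qed.

Lemma upd_id (F : nat -> sym) h : upd F h (F h) =1 F.
Proof. by move=> j; rewrite /upd; case: eqP => // ->. Qed.

Lemma go_right q F h k : ~~ tm_halt q ->
  (forall b, tm_delta q (Some b) = (q, Some b, MoveR)) ->
  (forall i, h <= i < h + k -> isSome (F i)) -> reaches k q F h q F (h + k).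
Proof.
move=> Hq Hd; elim: k h => [|k IH] h HF; first by rewrite addn0; apply: reaches_refl.
have: isSome (F h) by apply: HF; lia.
case E: (F h) => [b|//] _.
apply: (@reaches_trans 1 k _ _ _ _ q F h.+1); last by [].
- apply: (@reaches_step _ _ _ _ _ (F h) MoveR) => //; last exact: upd_id.
  by rewrite E Hd.
- by rewrite -addSnnS; apply: IH => i Hi; apply: HF; lia.
Qed.

Lemma go_left q F h k : ~~ tm_halt q ->
  (forall b, tm_delta q (Some b) = (q, Some b, MoveL)) -> k <= h ->
  (forall i, h - k < i <= h -> isSome (F i)) -> reaches k q F h q F (h - k).
Proof.
move=> Hq Hd; elim: k h => [|k IH] h Hk HF; first by rewrite subn0; apply: reaches_refl.
have: isSome (F h) by apply: HF; lia.
case E: (F h) => [b|//] _.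
apply: (@reaches_trans 1 k _ _ _ _ q F h.-1); last by [].
- apply: (@reaches_step _ _ _ _ _ (F h) MoveL) => //; [by rewrite E Hd|lia|exact: upd_id].
- have -> : h - k.+1 = h.-1 - k by lia.
  by apply: IH => [|i Hi]; [lia|apply: HF; lia].
Qed.

End AbstractRun.

Lemma nth_queue p q i : nth None (nseq p None ++ map Some q) i =
  if p <= i < p + size q then Some (nth false q (i - p)) else None.
Proof.
rewrite nth_cat size_nseq nth_nseq; case: ltnP => H1.
  by [].
case: ltnP => H2 /=; first by rewrite (nth_map false) //; lia.
by rewrite nth_default // size_map; lia.
Qed.

Lemma nth_queue2 p y x i : nth None (nseq p None ++ map Some y ++ None :: map Some x) i =
  if p <= i < p + size y then Some (nth false y (i - p)) else
  if p + size y < i < p + size y + 1 + size x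
  then Some (nth false x (i - (p + size y + 1))) else None.
Proof.
rewrite nth_cat size_nseq nth_nseq; case: ltnP => H1.
  by rewrite /= ifF //; lia.
rewrite nth_cat size_map; case: ltnP => H2.
  by rewrite (nth_map false) //; case: ifP => //; lia.
case: ifP => [|_]; first by lia.
case E: (i - p - size y) => [|j] /=; first by case: ifP => //; lia.
case: ltnP => /= H3.
  case: ltnP => /= H4.
    rewrite (nth_map false); last by lia.
    by congr (Some (nth _ _ _)); lia.
  by rewrite nth_default // size_map; lia.
by lia.
Qed.

(* A machine working on a queue of bits: each step pops one bit and appends
   finitely many. [tpre f (Some b)] (resp. [tpre f None]) is the list appended when
   bit [b] of the raw input (resp. its end) is met, [f] telling whether it is the
   first symbol. *)
Record tagm := Tagm {
  tS : finType;
  tdelta : tS -> bool -> tS * seq bool;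
  tinit : tS;
  thalt : pred tS;
  tacc : pred tS;
  tpre : bool -> option bool -> seq bool;
  tmax : nat;
  tdeltaP : forall s b, size (tdelta s b).2 <= tmax;
  tpreP : forall f a, size (tpre f a) <= tmax }.

Definition tstep (T : tagm) (c : tS T * seq bool) :=
  if thalt c.1 then c else
  if c.2 is b :: q then ((tdelta c.1 b).1, q ++ (tdelta c.1 b).2) else c.

Section TagTM.
Variable T : tagm.

(** Control ([inl] while raw input is being consumed, with the first-symbol flag), bits still to be
    appended, and phase. Bounding the pending bits by [tmax T] keeps the state set finite. *)
Definition tst := ((bool + tS T) * (tmax T).-bseq bool * 'I_5)%type.
Definition tmk ctl l i : tst := (ctl, insub_bseq (tmax T) l, inord i).

(* Phases: 0 read the front of the queue (or start appending), 1 cross the raw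
   input rightwards, 2 cross the queue rightwards and write, 3 and 4 go back. While
   the raw input is being consumed a single blank separates it from the queue. *)
Definition tm_tag_delta (q : tst) (a : sym) : tst * sym * Defs.move :=
  let: (ctl, l, ph) := q in
  match nat_of_ord ph with
  | 0 => match bseqval l, ctl, a with
         | [::], inl f, Some b => (tmk (inl false) (tpre T f (Some b)) 0, None, MoveR)
         | [::], inl f, None => (tmk (inr (tinit T)) (tpre T f None) 0, None, MoveR)
         | [::], inr s, Some b => (tmk (inr (tdelta s b).1) (tdelta s b).2 0, None, MoveR)
         | [::], inr s, None => (q, a, Stay)
         | _, _, _ => (tmk ctl (bseqval l) (if ctl is inl _ then 1 else 2), a, Stay)
         end
  | 1 => if a is Some _ then (q, a, MoveR) else (tmk ctl (bseqval l) 2, a, MoveR)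
  | 2 => if a is Some _ then (q, a, MoveR) else
         (tmk ctl (behead (bseqval l)) (if ctl is inl _ then 3 else 4),
          Some (head false (bseqval l)), MoveL)
  | 3 => if a is Some _ then (q, a, MoveL) else (tmk ctl (bseqval l) 4, a, MoveL)
  | _ => if a is Some _ then (q, a, MoveL) else (tmk ctl (bseqval l) 0, a, MoveR)
  end.

(** Halting waits until nothing is pending and the head is back at the front, so that the output
    read from the head on is the whole queue. *)
Definition tag_halt : pred tst := fun q =>
  let: (ctl, l, ph) := q in
  if ctl is inr s then [&& thalt s, bseqval l == [::] & nat_of_ord ph == 0] else false.
Definition tag_acc : pred tst := fun q =>
  if q.1.1 is inr s then tacc s else false.

Definition tagTM : TM :=
  {| tm_state := tst : finType; tm_start := tmk (inl true) [::] 0; tm_halt := tag_halt;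
     tm_accept := tag_acc; tm_delta := tm_tag_delta |}.

Lemma tmkl (l : seq bool) : size l <= tmax T -> bseqval (insub_bseq (tmax T) l) = l.
Proof. by move=> H; rewrite -[LHS]/(val _) /insub_bseq insubdK. Qed.

Lemma tmk_halt0 ctl l i : size l <= tmax T -> l != [::] -> ~~ tag_halt (tmk ctl l i).
Proof. by move=> H1 H2; case: ctl => //= s; rewrite tmkl // (negbTE H2) andbF. Qed.

Lemma tmk_halt1 ctl l i : 0 < i < 5 -> ~~ tag_halt (tmk ctl l i).
Proof.
by case: ctl => //= s; case: i => // i Hi; rewrite inordK // !andbF.
Qed.

Arguments tm_tag_delta : simpl never.
Arguments tmk : simpl never.

Let rch := @reaches tagTM.

Lemma deltaE ctl l i a : i < 5 -> size l <= tmax T ->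
  tm_tag_delta (tmk ctl l i) a =
  match i with
  | 0 => match l, ctl, a with
         | [::], inl f, Some b => (tmk (inl false) (tpre T f (Some b)) 0, None, MoveR)
         | [::], inl f, None => (tmk (inr (tinit T)) (tpre T f None) 0, None, MoveR)
         | [::], inr s, Some b => (tmk (inr (tdelta s b).1) (tdelta s b).2 0, None, MoveR)
         | [::], inr s, None => (tmk ctl l i, a, Stay)
         | _, _, _ => (tmk ctl l (if ctl is inl _ then 1 else 2), a, Stay)
         end
  | 1 => if a is Some _ then (tmk ctl l i, a, MoveR) else (tmk ctl l 2, a, MoveR)
  | 2 => if a is Some _ then (tmk ctl l i, a, MoveR) else
         (tmk ctl (behead l) (if ctl is inl _ then 3 else 4),
          Some (head false l), MoveL)
  | 3 => if a is Some _ then (tmk ctl l i, a, MoveL) else (tmk ctl l 4, a, MoveL)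
  | _ => if a is Some _ then (tmk ctl l i, a, MoveL) else (tmk ctl l 0, a, MoveR)
  end.
Proof. by move=> Hi Hl; rewrite /tm_tag_delta /tmk inordK // tmkl. Qed.

(** An append is a round trip: cross the queue, write on the first blank, return to the blank on the
    left, step back onto the front. [0 < p] provides that left blank. *)
Lemma push_normal s b l p q : 0 < p -> size (b :: l) <= tmax T ->
  rch (2 * size q + 3)
    (tmk (inr s) (b :: l) 0) (nth None (nseq p None ++ map Some q)) p
    (tmk (inr s) l 0) (nth None (nseq p None ++ map Some (rcons q b))) p.
Proof.
move=> Hp Hl; set F := nth None _; set F' := nth None _.
have Hl' : size l <= tmax T by move: Hl => /=; lia.
have e : 2 * size q + 3 = 1 + (size q + (1 + (size q + 1))) by lia.
rewrite e.
apply: reaches_trans (leqnn _).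
  apply: (@reaches_step tagTM _ F F p (tmk (inr s) (b :: l) 2) (F p) Stay) => //.
  - exact: tmk_halt0.
  - by rewrite /= deltaE.
  - exact: upd_id.
apply: reaches_trans (leqnn _).
  apply: go_right => [|c|i Hi]; [exact: tmk_halt1|by rewrite /= deltaE|].
  by rewrite /F nth_queue Hi.
have EF : F (p + size q) = None by rewrite /F nth_queue; case: ifP => //; lia.
apply: reaches_trans (leqnn _).
  apply: (@reaches_step tagTM _ F F' (p + size q) (tmk (inr s) l 4) (Some b) MoveL).
  - exact: tmk_halt1.
  - by rewrite EF /= deltaE.
  - by lia.
  - move=> i; rewrite /upd /F /F' !nth_queue size_rcons.
    case: eqP => [->|Hi].
      by rewrite leq_addr addnS ltnS leqnn /= addKn nth_rcons ltnn eqxx.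
    case: ifP => H1; first by rewrite ifT ?nth_rcons ?ifT //; lia.
    by rewrite ifF //; lia.
  - by [].
apply: reaches_trans (leqnn _).
  apply: (@go_left _ _ _ _ (size q)) => [|c||i Hi].
  - exact: tmk_halt1.
  - by rewrite /= deltaE.
  - by rewrite /=; lia.
  - by rewrite /F' nth_queue size_rcons ifT //; move: Hi => /=; lia.
apply: (@reaches_step tagTM _ F' F' _ (tmk (inr s) l 0) None MoveR).
- exact: tmk_halt1.
- by rewrite /F' nth_queue ifF /= ?deltaE //; lia.
- by [].
- move=> i; rewrite /upd; case: eqP => // ->.
  by rewrite /F' nth_queue ifF //=; lia.
- by move=> /=; lia.
Qed.

(** Raw input and queue are each crossed once in each direction. The separating blank is met both
    ways, so each direction takes two phases. *)
Lemma push_pre f b l p y x : 0 < p -> size (b :: l) <= tmax T ->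
  rch (2 * (size y + size x) + 5)
    (tmk (inl f) (b :: l) 0) (nth None (nseq p None ++ map Some y ++ None :: map Some x)) p
    (tmk (inl f) l 0)
    (nth None (nseq p None ++ map Some y ++ None :: map Some (rcons x b))) p.
Proof.
move=> Hp Hl; set F := nth None _; set F' := nth None _.
have Hl' : size l <= tmax T by move: Hl => /=; lia.
have -> : 2 * (size y + size x) + 5 =
  1 + (size y + (1 + (size x + (1 + (size x + (1 + (size y + 1))))))) by lia.
apply: reaches_trans (leqnn _).
  apply: (@reaches_step tagTM _ F F p (tmk (inl f) (b :: l) 1) (F p) Stay) => //.
  - by rewrite /= deltaE.
  - exact: upd_id.
apply: reaches_trans (leqnn _).
  apply: go_right => [|c|i Hi]; [exact: tmk_halt1|by rewrite /= deltaE|].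
  by rewrite /F nth_queue2 Hi.
have EF : F (p + size y) = None.
  by rewrite /F nth_queue2 ifF ?ifF //; lia.
apply: reaches_trans (leqnn _).
  apply: (@reaches_step tagTM _ F F _ (tmk (inl f) (b :: l) 2) (F (p + size y)) MoveR) => //.
  - by rewrite EF /= deltaE.
  - exact: upd_id.
apply: reaches_trans (leqnn _).
  apply: (@go_right _ _ _ _ (size x)) => [|c|i Hi]; [exact: tmk_halt1|by rewrite /= deltaE|].
  by rewrite /F nth_queue2 ifF ?ifT //; move: Hi => /=; lia.
have EF2 : F ((p + size y).+1 + size x) = None.
  by rewrite /F nth_queue2 ifF ?ifF //; lia.
apply: reaches_trans (leqnn _).
  apply: (@reaches_step tagTM _ F F' _ (tmk (inl f) l 3) (Some b) MoveL).
  - exact: tmk_halt1.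
  - by rewrite EF2 /= deltaE.
  - by rewrite /=; lia.
  - move=> i; rewrite /upd /F /F' !nth_queue2 size_rcons.
    case: eqP => [->|Hi].
      rewrite ifF ?ifT ?nth_rcons; try by rewrite /=; lia.
      by rewrite ifF ?ifT //=; lia.
    case: ifP => // H1.
    case: ifP => H2; first by rewrite ifT ?nth_rcons ?ifT //; lia.
    by rewrite ifF //; move: Hi H1 H2 => /=; lia.
  - by [].
apply: reaches_trans (leqnn _).
  apply: (@go_left _ _ _ _ (size x)) => [|c||i Hi].
  - exact: tmk_halt1.
  - by rewrite /= deltaE.
  - by rewrite /=; lia.
  - by rewrite /F' nth_queue2 size_rcons ifF ?ifT //; move: Hi => /=; lia.
have EF3 : F' (p + size y) = None.
  by rewrite /F' nth_queue2 ifF ?ifF //; lia.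
rewrite (_ : hmove _ _ - _ = p + size y); last by rewrite /=; lia.
apply: reaches_trans (leqnn _).
  apply: (@reaches_step tagTM _ F' F' _ (tmk (inl f) l 4) (F' (p + size y)) MoveL) => //.
  - by rewrite EF3 /= deltaE.
  - by rewrite /=; lia.
  - exact: upd_id.
apply: reaches_trans (leqnn _).
  apply: (@go_left _ _ _ _ (size y)) => [|c||i Hi].
  - exact: tmk_halt1.
  - by rewrite /= deltaE.
  - by rewrite /=; lia.
  - by rewrite /F' nth_queue2 ifT //; move: Hi => /=; lia.
have EF4 : F' (hmove MoveL (p + size y) - size y) = None.
  by rewrite /F' nth_queue2 ifF ?ifF //=; lia.
apply: (@reaches_step tagTM _ F' F' _ (tmk (inl f) l 0) None MoveR).
- exact: tmk_halt1.
- by rewrite EF4 /= deltaE.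
- by [].
- by move=> i; rewrite /upd; case: eqP => // ->.
- by move=> /=; lia.
Qed.

Lemma push_normal_seq s l p q m : 0 < p -> size l <= tmax T -> size q + size l <= m ->
  rch (size l * (2 * m + 3))
    (tmk (inr s) l 0) (nth None (nseq p None ++ map Some q)) p
    (tmk (inr s) [::] 0) (nth None (nseq p None ++ map Some (q ++ l))) p.
Proof.
move=> Hp; elim: l q => [|b l IH] q Hl Hm; first by rewrite cats0; apply: reaches_refl.
apply: reaches_trans.
- exact: push_normal.
- rewrite -cat_rcons; apply: IH => //; first by move: Hl => /=; lia.
  by rewrite size_rcons; move: Hm => /=; lia.
- by move: Hm => /=; nia.
Qed.

Lemma push_pre_seq f l p y x m : 0 < p -> size l <= tmax T ->
  size y + size x + size l <= m ->
  rch (size l * (2 * m + 5))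
    (tmk (inl f) l 0) (nth None (nseq p None ++ map Some y ++ None :: map Some x)) p
    (tmk (inl f) [::] 0)
    (nth None (nseq p None ++ map Some y ++ None :: map Some (x ++ l))) p.
Proof.
move=> Hp; elim: l x => [|b l IH] x Hl Hm; first by rewrite cats0; apply: reaches_refl.
apply: reaches_trans.
- exact: push_pre.
- rewrite -(cat_rcons b x l); apply: IH => //; first by move: Hl => /=; lia.
  by rewrite size_rcons; move: Hm => /=; lia.
- by move: Hm => /=; nia.
Qed.

Lemma tag_step_TM s b q p m : 0 < p -> ~~ thalt s -> size q + tmax T <= m ->
  rch (tmax T * (2 * m + 3) + 1)
    (tmk (inr s) [::] 0) (nth None (nseq p None ++ map Some (b :: q))) p
    (tmk (inr (tdelta s b).1) [::] 0)
    (nth None (nseq p.+1 None ++ map Some (q ++ (tdelta s b).2))) p.+1.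
Proof.
move=> Hp Hs Hm; have Hd := tdeltaP s b.
apply: reaches_trans.
- apply: (@reaches_step tagTM _ _ (nth None (nseq p.+1 None ++ map Some q)) _
     (tmk (inr (tdelta s b).1) (tdelta s b).2 0) None MoveR).
  + by rewrite /= (negbTE Hs).
  + by rewrite nth_queue ifT ?subnn /= ?deltaE //=; lia.
  + by [].
  + move=> i; rewrite /upd !nth_queue; case: eqP => [->|/= Hi].
      by rewrite ifF //; lia.
    case: ifP => H1.
      by rewrite ifT; [have -> : i - p = (i - p.+1).+1 by lia|lia].
    by rewrite ifF //; lia.
  + by [].
- by apply: (@push_normal_seq _ _ _ _ m) => //; lia.
- by rewrite addnC leq_add2r leq_mul2r Hd orbT.
Qed.

(** A step adds at most [tmax T] bits, so [m] bounds the queue throughout and all steps share one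
    cost. A halted or starved machine stays put, so [k] may exceed the number of effective steps. *)
Lemma tag_run_TM k c m p : 0 < p -> size c.2 + k * tmax T + tmax T <= m ->
  exists2 p', 0 < p' & rch (k * (tmax T * (2 * m + 3) + 1))
    (tmk (inr c.1) [::] 0) (nth None (nseq p None ++ map Some c.2)) p
    (tmk (inr (iter k (@tstep T) c).1) [::] 0)
    (nth None (nseq p' None ++ map Some (iter k (@tstep T) c).2)) p'.
Proof.
elim: k c p => [|k IH] c p Hp Hm; first by exists p => //; apply: reaches_refl.
rewrite iterSr /tstep.
have Hc : tstep c = c \/ exists s b q, c = (s, b :: q) /\ ~~ thalt s.
  rewrite /tstep; case: ifP => H1; first by left.
  case: c Hm H1 => s [|b q] /= *; first by left.
  by right; exists s, b, q; split=> //; apply/negbT.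
case: Hc => [E|[s [b [q [E Hs]]]]].
- rewrite -/(tstep c) E.
  have [|p' Hp' H] := IH c p Hp; first by lia.
  exists p' => //; apply: reaches_trans H _; first exact: (@reaches_refl _ 0).
  by rewrite mulSn leq_addl.
- have := tdeltaP s b.
  rewrite E /= (negbTE Hs); move: Hm; rewrite E /= => Hm Hd.
  have [|p' Hp' H] := IH ((tdelta s b).1, q ++ (tdelta s b).2) p.+1 isT.
    by rewrite /= size_cat; lia.
  exists p' => //; apply: reaches_trans H _.
  + by apply: (@tag_step_TM _ _ _ _ m) => //; lia.
  + by rewrite mulSn.
Qed.

Fixpoint pre_out f (w : seq bool) : seq bool :=
  if w is b :: w' then tpre T f (Some b) ++ pre_out false w' else tpre T f None.

Lemma size_pre_out f w : size (pre_out f w) <= (size w).+1 * tmax T.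
Proof.
elim: w f => [|b w IH] f /=; first by rewrite mul1n tpreP.
by rewrite size_cat mulSn leq_add ?tpreP.
Qed.

(** Once the raw input is exhausted, the blank read at the front is the separator itself, and one
    step to the right of it lies the queue. *)
Lemma pre_TM f y x p m : 0 < p -> size y + size x + (size y).+1 * tmax T <= m ->
  exists2 p', 0 < p' & rch ((size y).+1 * (tmax T * (2 * m + 5) + 1))
    (tmk (inl f) [::] 0) (nth None (nseq p None ++ map Some y ++ None :: map Some x)) p
    (tmk (inr (tinit T)) [::] 0) (nth None (nseq p' None ++ map Some (x ++ pre_out f y))) p'.
Proof.
elim: y f x p => [|b y IH] f x p Hp Hm /=.
- have Hd := tpreP T f None.
  exists p.+1 => //; apply: reaches_trans.
  + apply: (@reaches_step tagTM _ _ (nth None (nseq p.+1 None ++ map Some x)) _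
      (tmk (inr (tinit T)) (tpre T f None) 0) None MoveR).
    * by [].
    * by rewrite (nth_queue2 p [::] x) ifF ?ifF /= ?deltaE //; lia.
    * by [].
    * move=> i; rewrite /upd (nth_queue2 p [::] x) !nth_queue /= addn0.
      case: eqP => [->|/= Hi]; first by rewrite ifF //; lia.
      rewrite ifF; last by lia.
      have -> : (p < i < p + 1 + size x) = (p < i < p.+1 + size x) by lia.
      by rewrite addn1.
    * by [].
  + by apply: (@push_normal_seq _ _ _ _ m) => //; move: Hm => /=; lia.
  + by move: Hm => /=; nia.
- have Hd := tpreP T f (Some b).
  have [||p' Hp' H] := IH false (x ++ tpre T f (Some b)) p.+1; first by [].
    by rewrite size_cat; move: Hm => /=; lia.
  exists p' => //; rewrite -catA in H; apply: reaches_trans H _.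
  + apply: reaches_trans (leqnn _).
    * apply: (@reaches_step tagTM _ _
        (nth None (nseq p.+1 None ++ map Some y ++ None :: map Some x)) _
        (tmk (inl false) (tpre T f (Some b)) 0) None MoveR).
      - by [].
      - by rewrite (nth_queue2 p (b :: y) x) ifT ?subnn /= ?deltaE //=; lia.
      - by [].
      - move=> i; rewrite /upd (nth_queue2 p (b :: y) x) nth_queue2 /= !addnS !addSn.
        case: eqP => [->|/= Hi]; first by rewrite ifF ?ifF //; lia.
        have -> : (p <= i < (p + size y).+1) = (p < i < (p + size y).+1) by lia.
        case: ifP => // H1; have -> // : i - p = (i - p.+1).+1 by lia.
      - by [].
    * by apply: (@push_pre_seq _ _ _ _ _ m) => //; move: Hm => /=; lia.
  + by move: Hm => /=; nia.
Qed.

(** The input is placed from cell 1 on: cell 0 is the blank at which leftward crossings turn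
    around. *)
Lemma init_crep w : crep (M := tagTM) (tmk (inl true) [::] 0, init_tape w)
  (tmk (inl true) [::] 0) (nth None (nseq 1 None ++ map Some w ++ None :: map Some [::])) 1.
Proof.
split=> //; rewrite (_ : nth _ _ = nth None (None :: map Some w ++ [:: None])) //.
case: w => [|b w]; split=> [|j|j] //=; rewrite ?nth_nil ?if_same //.
rewrite add0n nth_cat size_map; case: ltnP => // H.
by rewrite nth_default ?size_map //; case: (j - size w) => // i; case: i.
Qed.

Lemma read_bits_rep F h q rest : (forall j, nth None rest j = F (h + j)) ->
  (forall j, F (h + j) = if j < size q then Some (nth false q j) else None) ->
  read_bits rest = q.
Proof.
elim: q rest h => [|b q IH] rest h H1 H2; move: (H1 0) (H2 0); rewrite ?addn0.
- by case: rest H1 => // a r _ /= -> ->.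
- case: rest H1 => [|a r] H1 /= <- // ->; congr cons; apply: (IH _ h.+1) => j.
  + by rewrite addSnnS -H1.
  + by rewrite addSnnS H2.
Qed.

Lemma iter_tm_halt (M : TM) n (c : config M) : tm_halt c.1 -> iter n (@tm_step M) c = c.
Proof. by move=> H; elim: n => //= n ->; case: c H => q t /= H; rewrite H. Qed.

Lemma tagTM_run w k s out : 
  iter k (@tstep T) (tinit T, pre_out true w) = (s, out) -> thalt s ->
  let m := size w + (size w).+1 * tmax T + k * tmax T + tmax T in
  forall n, ((size w).+1 + k) * (tmax T * (2 * m + 5) + 1) <= n ->
  let c := tm_run tagTM n w in
  [/\ tm_halt c.1, tape_output c.2 = out & tm_accept c.1 = tacc s].
Proof.
move=> Hk Hs m n Hn.
have [|p1 Hp1 H1] := @pre_TM true w [::] 1 m isT; first by rewrite /m /=; lia.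
have Hsz := size_pre_out true w.
have [|p2 Hp2 H2] := @tag_run_TM k (tinit T, pre_out true w) m p1 Hp1.
  by rewrite /m /=; lia.
have [u Hu H3] : rch n (tmk (inl true) [::] 0)
    (nth None (nseq 1 None ++ map Some w ++ None :: map Some [::])) 1
    (tmk (inr s) [::] 0) (nth None (nseq p2 None ++ map Some out)) p2.
  rewrite Hk in H2; apply: reaches_trans H1 H2 _.
  apply: leq_trans Hn; rewrite mulnDl leq_add2l leq_mul2l; apply/orP; right; lia.
have [] := H3 _ (init_crep w).
rewrite -/(tm_run tagTM u w); move=> Eq [Hh Hr Hl] c.
have Hhalt : tm_halt (tm_run tagTM u w).1 by rewrite Eq /= Hs tmkl ?inordK.
have Ec : c = tm_run tagTM u w.
  rewrite /c -(subnK Hu) /tm_run iterD iter_tm_halt //.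
rewrite Ec; split=> //; last by rewrite Eq.
apply: (@read_bits_rep (nth None (nseq p2 None ++ map Some out)) p2) => [[|j]|j].
- by rewrite addn0.
- by rewrite /= Hr addnS.
- by rewrite nth_queue leq_addr ltn_add2l addKn.
Qed.

End TagTM.

(** * Register machines on a queue *)

Inductive op :=
  | SetZ of nat | Copy of nat & nat | Inc of nat | TLe of nat & nat
  | TInp of nat & bool | Jmp | Emit of bool.

(** The second component is a jump target, followed exactly when [op_test] holds, which never
    happens for the operations that write. *)
Definition code := seq (op * nat).
Definition inp (w : seq bool) i : option bool := nth None (map Some w) i.

Definition op_env o (s : nat -> nat) : nat -> nat :=
  match o with
  | SetZ x => upd s x 0
  | Copy x y => upd s x (s y)
  | Inc x => upd s x (s x).+1
  | _ => s
  end.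
Definition op_out o : seq bool := if o is Emit b then [:: b] else [::].
Definition op_test w (s : nat -> nat) o :=
  match o with
  | TLe x y => s x <= s y
  | TInp x b => inp w (s x) == Some b
  | Jmp => true
  | _ => false
  end.
Definition op_regs o :=
  match o with
  | SetZ x | Inc x | TInp x _ => [:: x]
  | Copy x y | TLe x y => [:: x; y]
  | _ => [::]
  end.

Definition rconf := (nat * (nat -> nat) * seq bool)%type.
Definition instr (C : code) pc := nth (Jmp, 0) C pc.
Definition cstep w (C : code) (c : rconf) : rconf :=
  let: (pc, s, out) := c in
  if pc < size C then
    (if op_test w s (instr C pc).1 then (instr C pc).2 else pc.+1,
     op_env (instr C pc).1 s, out ++ op_out (instr C pc).1)
  else c.

Lemma mkseq_cons (T : Type) (f : nat -> T) n :
  mkseq f n.+1 = f 0 :: mkseq (fun i => f i.+1) n.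
Proof. by rewrite /mkseq /= (iotaDl 1 0) -map_comp. Qed.

Section CodeTM.
Variable C : code.

Let m := foldr maxn 0 (flatten [seq op_regs i.1 | i <- C]).
Local Notation R := 'I_m.+1.
Let sz := size C.

Definition marks (s : nat -> nat) j : {ffun R -> bool} := [ffun r : R => s r == j].

(* One symbol per cell: its input bit and the set of registers whose value is its
   index. After the cells come the output bits, then an end marker. *)
Definition Sg := ((option bool * {ffun R -> bool}) + option bool)%type.

Definition setm (k : {ffun R -> bool}) x b : {ffun R -> bool} :=
  [ffun r => if r == inord x then b else k r].

(** The carry [p] is the whole memory of a pass. For [SetZ] it is true on cell 0 only, for [Inc] on
    the cell after the old mark; for [TLe] and [TInp] it is [None] up to the first relevant mark and
    then holds the answer. Its closed form is [pst]. *)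
Definition tr o (p a : option bool) (k : {ffun R -> bool}) :=
  match o with
  | SetZ x => (Some false, setm k x (p == Some true))
  | Copy x y => (p, setm k x (k (inord y)))
  | Inc x => (Some (k (inord x)), setm k x (p == Some true))
  | TLe x y => (if p is None then
      (if k (inord x) || k (inord y) then Some (k (inord x)) else None) else p, k)
  | TInp x b => (if k (inord x) then Some (a == Some b) else p, k)
  | _ => (p, k)
  end.

Definition pinit o : option bool :=
  match o with SetZ _ | Jmp => Some true | Inc _ => Some false | _ => None end.
Definition otest o (p : option bool) :=
  match o with TLe _ _ | TInp _ _ | Jmp => p == Some true | _ => false end.
(** A mark pushed off the end of the row by [Inc] gets a new cell, whose input bit is [None] because
    the row already covers the word. *)
Definition flush o (p : option bool) : seq Sg :=
  if o is Inc x then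
    if p == Some true then [:: inl (None, [ffun r : R => r == inord x])] else [::]
  else [::].
Definition pflush o (p : option bool) := if o is Inc _ then Some false else p.

(** Left: program counter and carry. Right: the final sweep, which erases the cells, turns output
    symbols into raw bits and remembers the first of them; then the halting state holding that bit
    as answer. *)
Definition QS := (('I_sz.+1 * option bool) + (option bool + bool))%type.
Definition mkst pc : QS :=
  if pc < sz then inl (inord pc, pinit (instr C pc).1) else inr (inl None).

(** The queue holds bits only, so a symbol is coded in unary by its rank; the simulating state only
    has to count ones until the closing zero. *)
Definition scode (x : Sg) : seq bool := nseq (enum_rank x) true ++ [:: false].
Definition codes (l : seq Sg) : seq bool := flatten (map scode l).

Definition qdelta (q : QS) (x : Sg) : QS * seq bool :=
  match q with
  | inl (pc, p) =>
    let o := (instr C pc).1 in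
    match x with
    | inl (a, k) => (inl (pc, (tr o p a k).1), codes [:: inl (a, (tr o p a k).2)])
    | inr (Some b) => (inl (pc, pflush o p), codes (flush o p ++ [:: inr (Some b)]))
    | inr None => (mkst (if otest o p then (instr C pc).2 else pc.+1),
        codes (flush o p ++ map (fun b => inr (Some b)) (op_out o) ++ [:: inr None]))
    end
  | inr (inl acc) =>
    match x with
    | inl _ => (q, [::])
    | inr (Some b) => (inr (inl (Some (odflt b acc))), [:: b])
    | inr None => (inr (inr (odflt false acc)), [::])
    end
  | _ => (q, [::])
  end.

Definition qhalt (q : QS) := if q is inr (inr _) then true else false.

Let g := #|{: Sg}|.
Definition bst := (QS * 'I_g.+1)%type.
Definition bdelta (q : bst) (b : bool) : bst * seq bool :=
  if b then ((q.1, inord q.2.+1), [::]) else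
  let r := qdelta q.1 (nth (inr None) (enum {: Sg}) q.2) in ((r.1, ord0), r.2).
(** Registers start at 0, so all marks sit on the first cell, the one flagged by [f]. The end of the
    input yields one extra cell and the end marker. *)
Definition bpre f (a : option bool) : seq bool :=
  codes (inl (a, [ffun => f]) :: if a is None then [:: inr None] else [::]).

Lemma g_gt0 : 0 < g.
Proof. by apply/card_gt0P; exists (inr None). Qed.

Lemma size_scode x : size (scode x) <= g.
Proof. by rewrite size_cat size_nseq addn1. Qed.

Lemma size_codes l : size (codes l) <= size l * g.
Proof.
elim: l => //= x l IH; rewrite size_cat mulSn; apply: leq_add IH; exact: size_scode.
Qed.

(** The factor 3 covers a flushed cell, an emitted bit and the end marker. *)
Lemma bdeltaP s b : size (bdelta s b).2 <= 3 * g.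
Proof.
have H0 := g_gt0; case: s => q i; rewrite /bdelta; case: b => //=.
case: q => [[pc p]|[acc|acc]] //=; last first.
  by case: (nth _ _ _) => [//|[b|]] //=; lia.
case: (nth _ _ _) => [[a k]|[b|]]; apply: leq_trans (size_codes _) _;
  rewrite leq_mul2r; apply/orP; right => //; rewrite ?size_cat /= /flush;
  by case: (instr C pc).1 => //= *; case: (_ == _).
Qed.

Lemma bpreP f a : size (bpre f a) <= 3 * g.
Proof.
by apply: leq_trans (size_codes _) _; rewrite leq_mul2r; apply/orP; right; case: a.
Qed.

Definition code_tagm : tagm := {|
  tS := bst : finType; tdelta := bdelta; tinit := (mkst 0, ord0);
  thalt := fun s => qhalt s.1; tacc := fun s => if s.1 is inr (inr a) then a else false;
  tpre := bpre; tmax := 3 * g; tdeltaP := bdeltaP; tpreP := bpreP |}.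

Local Notation bconf := (bst * seq bool)%type.
Definition treach k (c c' : bconf) :=
  exists2 u, u <= k & iter u (@tstep code_tagm) c = c'.

Lemma treach_trans k1 k2 k c1 c2 c3 : treach k1 c1 c2 -> treach k2 c2 c3 ->
  k1 + k2 <= k -> treach k c1 c3.
Proof.
by move=> [u1 H1 <-] [u2 H2 <-] H; exists (u2 + u1); [lia|rewrite iterD].
Qed.

Lemma treach_refl k c : treach k c c.
Proof. by exists 0. Qed.

Lemma tstep_running (q : QS) (c : 'I_g.+1) b l : ~~ qhalt q ->
  @tstep code_tagm ((q, c), b :: l) = ((bdelta (q, c) b).1, l ++ (bdelta (q, c) b).2).
Proof. by move=> /negbTE H; rewrite /tstep [thalt _]H. Qed.

Lemma sym_step q x l : ~~ qhalt q ->
  treach g ((q, ord0), scode x ++ l) (((qdelta q x).1, ord0), l ++ (qdelta q x).2).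
Proof.
move=> Hq; exists (size (scode x)); first exact: size_scode.
have H : forall i (c : 'I_g.+1), c + i = enum_rank x ->
    iter i.+1 (@tstep code_tagm) ((q, c), (nseq i true ++ [:: false]) ++ l) =
    (((qdelta q x).1, ord0), l ++ (qdelta q x).2).
  elim=> [|i IH] c Hc.
    rewrite [iter _ _ _]tstep_running // /bdelta /= -[nat_of_ord c]addn0 Hc.
    by rewrite -[nth _ _ _](enum_val_nth (inr None) (enum_rank x)) enum_rankK.
  rewrite iterSr [tstep _]tstep_running // cats0; apply: IH.
  rewrite inordK ?addSnnS //.
  have H : enum_rank x < g := ltn_ord _.
  by rewrite ltnS; apply: leq_trans H; rewrite -Hc ltnS leq_addr.
by rewrite /scode size_cat size_nseq addn1; apply: H.
Qed.

Definition pst o w s j : option bool :=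
  match o with
  | SetZ _ => Some (j == 0)
  | Copy _ _ | Emit _ => None
  | Inc x => Some ((s x).+1 == j)
  | TLe x y => if minn (s x) (s y) < j then Some (s x <= s y) else None
  | TInp x b => if s x < j then Some (inp w (s x) == Some b) else None
  | Jmp => Some true
  end.

Lemma eq_inord_reg (r : R) x : x <= m -> (r == inord x) = (r == x :> nat).
Proof. by move=> H; rewrite -val_eqE /= inordK. Qed.

Lemma tr_ok o w s j : {in op_regs o, forall x, x <= m} ->
  tr o (pst o w s j) (inp w j) (marks s j) = (pst o w s j.+1, marks (op_env o s) j).
Proof.
have Hm x : x <= m -> marks s j (inord x) = (s x == j).
  by move=> Hx; rewrite ffunE inordK.
case: o => [x|x y|x|x y|x b||b] H //=.
- have Hx : x <= m by apply: H; rewrite inE.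
  congr pair; apply/ffunP => r; rewrite !ffunE eq_inord_reg // /upd.
  by case: eqP => // _; case: j {Hm}.
- have Hx : x <= m by apply: H; rewrite inE eqxx.
  have Hy : y <= m by apply: H; rewrite !inE eqxx orbT.
  congr pair; apply/ffunP => r; rewrite !ffunE eq_inord_reg // /upd inordK //.
  by case: eqP.
- have Hx : x <= m by apply: H; rewrite inE.
  rewrite Hm // eqSS; congr pair; apply/ffunP => r.
  rewrite !ffunE eq_inord_reg // /upd; case: eqP => // _.
  by case: (_ == j).
- have Hx : x <= m by apply: H; rewrite inE eqxx.
  have Hy : y <= m by apply: H; rewrite !inE eqxx orbT.
  rewrite !Hm //; congr pair; rewrite ltnS.
  case: (ltnP (minn (s x) (s y)) j) => H1; first by rewrite ifT // ltnW.
  case: (eqVneq (s x) j) => [Ex|Nx] /=; first by rewrite ifT; [congr Some|]; lia.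
  case: eqP => [Ey|Ny]; first by rewrite ifT; [congr Some|]; lia.
  by rewrite ifF //; lia.
- have Hx : x <= m by apply: H; rewrite inE.
  rewrite Hm //; congr pair; rewrite ltnS; case: eqP => [->|N].
    by rewrite leqnn.
  by have -> : (s x <= j) = (s x < j) by lia.
Qed.

Definition cells w s B : seq Sg := mkseq (fun j => inl (inp w j, marks s j)) B.
Definition queue_of w s out B : seq bool :=
  codes (cells w s B ++ map (fun b => inr (Some b)) out ++ [:: inr None]).

Lemma codes_cat l1 l2 : codes (l1 ++ l2) = codes l1 ++ codes l2.
Proof. by rewrite /codes map_cat flatten_cat. Qed.

Lemma cells_run (pc : 'I_sz.+1) w s B l :
  {in op_regs (instr C pc).1, forall x, x <= m} ->
  let o := (instr C pc).1 in
  treach (B * g) ((inl (pc, pst o w s 0), ord0), codes (cells w s B) ++ l)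
    ((inl (pc, pst o w s B), ord0), l ++ codes (cells w (op_env o s) B)).
Proof.
move=> Hreg o; elim: B l => [|B IH] l; first by rewrite cats0; apply: treach_refl.
rewrite /cells !mkseqS -!cats1 !codes_cat -catA.
apply: treach_trans; first exact: IH.
  have := @sym_step (inl (pc, pst o w s B)) (inl (inp w B, marks s B))
    (l ++ codes (cells w (op_env o s) B)) isT.
  rewrite /= (tr_ok _ _ _ Hreg) /= [codes [:: inl (inp w B, marks s B)]]/codes /= cats0 -!catA.
  by move=> H; exact: H.
by rewrite mulSn addnC.
Qed.

Local Notation outs l := (map (fun b => inr (Some b) : Sg) l).

Lemma tail_run (pc : 'I_sz.+1) p out l :
  let o := (instr C pc).1 in
  treach ((size out).+1 * g)
    ((inl (pc, p), ord0), codes (outs out ++ [:: inr None]) ++ l)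
    ((mkst (if otest o p then (instr C pc).2 else pc.+1), ord0),
      l ++ codes (flush o p ++ outs (out ++ op_out o) ++ [:: inr None])).
Proof.
move=> o; elim: out p l => [|b out IH] p l.
  have := @sym_step (inl (pc, p)) (inr None) l isT.
  by rewrite mul1n /= /codes /= cats0.
apply: treach_trans.
- have := @sym_step (inl (pc, p)) (inr (Some b)) (codes (outs out ++ [:: inr None]) ++ l) isT.
  by rewrite /= catA; move=> H; exact: H.
- have := IH (pflush o p) (l ++ codes (flush o p ++ [:: inr (Some b)])).
  have -> : flush o (pflush o p) = [::] by case: (o).
  have -> : otest o (pflush o p) = otest o p by case: (o).
  rewrite -/o -!catA -!codes_cat /= -catA /=; move=> H; exact: H.
- by rewrite mulSn.
Qed.

(** The row grows, by one cell, only when the register standing on its last cell is incremented; so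
    every register stays on the row. *)
Lemma pass_run pc w s out B : pc < sz -> size w <= B -> (forall x, x <= m -> s x < B) ->
  let o := (instr C pc).1 in
  exists B', [/\ B <= B' <= B.+1, forall x, x <= m -> op_env o s x < B' &
    treach ((B + (size out).+1) * g) ((mkst pc, ord0), queue_of w s out B)
      ((mkst (if op_test w s o then (instr C pc).2 else pc.+1), ord0),
        queue_of w (op_env o s) (out ++ op_out o) B')].
Proof.
move=> Hpc Hw Hs o.
have Hreg : {in op_regs o, forall x, x <= m}.
  move=> x Hx; rewrite /m.
  have: x \in flatten [seq op_regs i.1 | i <- C].
    apply/flattenP; exists (nth [::] [seq op_regs i.1 | i <- C] pc).
      by rewrite mem_nth // size_map.
    by rewrite (nth_map (Jmp, 0)).
  elim: (flatten _) => //= y l IH; rewrite inE leq_max.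
  by case/orP => [/eqP->|/IH->]; rewrite ?leqnn ?orbT.
pose B' := B + (if o is Inc x then (s x).+1 == B else false).
have Ho : (instr C (@inord sz pc)).1 = o by rewrite inordK // ltnS ltnW.
(* The flushed cell carries the mark of the incremented register alone, since all other registers
   are below [B]. *)
have Hc : cells w (op_env o s) B' = cells w (op_env o s) B ++ flush o (pst o w s B).
  rewrite /B'; case: (o) Hreg => [x|x y|x|x y|x b||b] Hreg; rewrite ?addn0 ?cats0 //=.
  case: eqP => E; rewrite ?addn0 ?cats0 //=.
  rewrite addn1 /cells mkseqS cats1; congr rcons; congr (inl (_, _)).
    by rewrite /inp nth_default // size_map.
  apply/ffunP=> r; rewrite !ffunE /upd eq_inord_reg; last by apply: Hreg; rewrite inE.
  case: (eqVneq (r : nat) x) => [_|_]; first by rewrite E eqxx.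
  by apply/eqP => Er; have := Hs r; rewrite Er -ltnS ltn_ord ltnn => /(_ isT).
exists B'; split.
- by rewrite /B'; case: (o) => //= *; try case: eqP; rewrite ?addn0 ?addn1 ?leqnn ?leqnSn.
- move=> x Hx; have Hsx := Hs x Hx; rewrite /B'.
  case: (o) Hreg => [y|y z|y|y z|y b||b] Hreg /=; rewrite ?addn0 // /upd; case: eqP => // E.
  + by lia.
  + by apply: Hs; apply: Hreg; rewrite !inE eqxx orbT.
  + by subst y; case: eqP => /=; lia.
  + by lia.
rewrite {1}/mkst Hpc /queue_of codes_cat mulnDl.
have E0 : pinit o = pst o w s 0 by case: (o).
have Et : otest o (pst o w s B) = op_test w s o.
  have Eb (b : bool) : (Some b == Some true) = b by case: b.
  case: (o) Hreg => [x|x y|x|x y|x b||b] Hreg //=; rewrite ifT ?Eb //.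
    by rewrite gtn_min Hs //; apply: Hreg; rewrite inE eqxx.
  by apply: Hs; apply: Hreg; rewrite inE.
apply: treach_trans (leqnn _).
- have := @cells_run (inord pc) w s B (codes (outs out ++ [:: inr None])).
  by cbv zeta; rewrite Ho -E0; apply.
- have := @tail_run (inord pc) (pst o w s B) out (codes (cells w (op_env o s) B)).
  cbv zeta; rewrite Ho Et inordK; last by rewrite ltnS ltnW.
  by rewrite Hc -catA [codes (cells _ _ _ ++ _)]codes_cat.
Qed.

(** After [t] instructions there are at most [t] more cells and [t] more output bits, so one bound
    on the queue serves all passes. *)
Lemma passes_run w t c B : size w <= B -> (forall x, x <= m -> c.1.2 x < B) ->
  let c' := iter t (cstep w C) c in
  exists B', [/\ B <= B' <= B + t, size c'.2 <= size c.2 + t &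
    treach (t * ((B + size c.2 + t + t).+1 * g))
      ((mkst c.1.1, ord0), queue_of w c.1.2 c.2 B)
      ((mkst c'.1.1, ord0), queue_of w c'.1.2 c'.2 B')].
Proof.
elim: t c B => [|t IH] c B Hw Hs.
  by exists B; split=> //=; rewrite ?addn0 ?leqnn //; apply: treach_refl.
rewrite iterSr; case: c Hs => [[pc s] out] /= Hs.
case: (ltnP pc (size C)) => Hpc; last first.
  have [B' [H1 H2 H3]] := IH (pc, s, out) B Hw Hs.
  exists B'; split; [lia|by move: H2 => /=; lia|].
  apply: treach_trans (treach_refl 0 _) H3 _ => /=.
  by apply: leq_mul; rewrite ?leqnSn // leq_mul2r; apply/orP; right; lia.
have [B1 [H1 H2 H3]] := pass_run out Hpc Hw Hs.
have Ho : size (op_out (instr C pc).1) <= 1 by case: (instr C pc).1.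
set c1 := (_, _, _); have [||B' [H4 H5 H6]] := IH c1 B1; [lia|exact: H2|].
exists B'; split; [lia|by move: H5; rewrite /= size_cat; lia|].
apply: treach_trans H3 H6 _.
rewrite [t.+1 * _]mulSn; apply: leq_add; first by rewrite leq_mul2r; apply/orP; right; lia.
by rewrite leq_mul2l leq_mul2r /= size_cat; apply/orP; right; apply/orP; right; lia.
Qed.

Lemma final_run w s out B :
  treach ((B + (size out).+1) * g) ((inr (inl None), ord0), queue_of w s out B)
    ((inr (inr (head false out)), ord0), out).
Proof.
rewrite /queue_of codes_cat mulnDl.
have H1 l : treach (B * g) ((inr (inl None), ord0), codes (cells w s B) ++ l)
                           ((inr (inl None), ord0), l).
  elim: B l => [|B IH] l; first exact: treach_refl.
  rewrite /cells mkseqS -cats1 codes_cat -catA.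
  apply: treach_trans; first exact: IH.
    have := @sym_step (inr (inl None)) (inl (inp w B, marks s B)) l isT.
    by rewrite /= cats0 [codes [:: _]]cats0; move=> H; exact: H.
  by rewrite mulSn addnC.
apply: treach_trans (leqnn _); first exact: H1.
have H2 acc o l : treach ((size o).+1 * g)
    ((inr (inl acc), ord0), codes (outs o ++ [:: inr None]) ++ l)
    ((inr (inr (odflt (head false o) acc)), ord0), l ++ o).
  elim: o acc l => [|b o IH] acc l.
    have := @sym_step (inr (inl acc)) (inr None) l isT.
    by rewrite mul1n /= /codes /= !cats0.
  apply: treach_trans; first by rewrite /= {1}/codes /= -catA; exact: sym_step.
    by have := IH (Some (odflt b acc)) (l ++ [:: b]); rewrite /= -!catA; move=> H; exact: H.
  by rewrite mulSn.
by have := H2 None out [::]; rewrite cats0.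
Qed.

Lemma pre_outE w : pre_out code_tagm true w = queue_of w (fun=> 0) [::] (size w).+1.
Proof.
have H f v : pre_out code_tagm f v =
    codes (mkseq (fun j => inl (inp v j, [ffun => f && (j == 0)])) (size v).+1 ++ [:: inr None]).
  elim: v f => [|b v IH] f.
    rewrite /= /bpre; congr (codes [:: inl (_, _); _]).
    by apply/ffunP => r; rewrite !ffunE andbT.
  transitivity (bpre f (Some b) ++ pre_out code_tagm false v); first by [].
  rewrite IH /bpre -codes_cat.
  rewrite cat1s [size _]/= [in RHS]mkseq_cons [in RHS]cat_cons; congr codes; congr cons; last congr cat.
    by congr (inl (_, _)); apply/ffunP => r; rewrite !ffunE andbT.
  by apply: eq_map => j; congr (inl (_, _)); apply/ffunP => r; rewrite !ffunE andbF.
rewrite H /queue_of; congr codes; congr (_ ++ _); apply: eq_map => j.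
by congr (inl (_, _)); apply/ffunP => r; rewrite !ffunE eq_sym.
Qed.

End CodeTM.

(** There are [t] passes and a final sweep; each meets at most [n.+1 + t] cells, [t] output bits and
    an end marker, every symbol taking at most [g] bits. [sim_time] is then the bound of [tagTM_run]
    with [tmax] equal to [3 * g]. *)
Definition sim_bits g n t := t.+1 * ((n + t + t + t).+2 * g).
Definition sim_time g n t :=
  (n.+1 + sim_bits g n t) *
  (3 * g * (2 * (n + n.+1 * (3 * g) + sim_bits g n t * (3 * g) + 3 * g) + 5) + 1).

(** Acceptance is tied to the first output bit, so one construction yields both transducers and
    deciders. *)
Theorem code_TM (C : code) : exists (M : TM) (g : nat), forall w t pc s out,
  iter t (cstep w C) (0, fun=> 0, [::]) = (pc, s, out) -> size C <= pc ->
  forall n, sim_time g (size w) t <= n -> let c := tm_run M n w in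
  [/\ tm_halt c.1, tape_output c.2 = out & tm_accept c.1 = head false out].
Proof.
exists (tagTM (code_tagm C)), #|{: Sg C}| => w t pc s out Ht Hpc n Hn.
have [||B [H1 H2 H3]] := @passes_run C w t (0, fun=> 0, [::]) (size w).+1; [by []|by []|].
rewrite Ht /= -pre_outE addn0 add0n in H1 H2 H3.
have Em : mkst C pc = inr (inl None) by rewrite /mkst ltnNge Hpc.
rewrite Em in H3.
have [u Hu Eu] := treach_trans H3 (final_run C w s out B) (leqnn _).
have Hk : u <= sim_bits #|{: Sg C}| (size w) t.
  apply: leq_trans Hu _; rewrite /sim_bits [t.+1 * _]mulSn addnC; apply: leq_add.
    by rewrite leq_mul2r; apply/orP; right; lia.
  by rewrite leq_mul2l leq_mul2r; apply/orP; right; apply/orP; right; lia.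
apply: (tagTM_run Eu) => //; apply: leq_trans Hn.
rewrite /sim_time /=; apply: leq_mul; first by lia.
rewrite leq_add2r leq_mul2l; apply/orP; right; rewrite leq_add2r leq_mul2l /=.
by rewrite leq_add2r leq_add2l leq_mul2r Hk orbT.
Qed.

(** * Compilation of arithmetic expressions *)

(** [ESum] is the only loop and its range is fixed on entry. Arithmetic and bounded quantifiers are
    derived from it and [EIfLt], so only these need compiling. *)
Inductive expr :=
  | EVar of nat | EZero | ESize | ESucc of expr | EInp of bool & expr
  | EIfLt of expr & expr & expr & expr | ESum of expr & expr.

Definition scons (x : nat) (v : nat -> nat) i := if i is j.+1 then v j else x.

(* Variables are de Bruijn indices; the second argument of [ESum] binds one. *)
Fixpoint eval w e v : nat :=
  match e with
  | EVar i => v i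
  | EZero => 0
  | ESize => size w
  | ESucc e => (eval w e v).+1
  | EInp b e => inp w (eval w e v) == Some b
  | EIfLt a b c d => if eval w a v < eval w b v then eval w c v else eval w d v
  | ESum n s => \sum_(0 <= i < eval w n v) eval w s (scons i v)
  end.

Fixpoint cost w e v : nat :=
  match e with
  | EVar _ | EZero => 1
  | ESize => 4 * size w + 4
  | ESucc e => (cost w e v).+1
  | EInp _ e => cost w e v + 3
  | EIfLt a b c d => cost w a v + cost w b v + cost w c v + cost w d v + 2
  | ESum n s => cost w n v + 4 +
      \sum_(0 <= i < eval w n v) (cost w s (scons i v) + 4 * eval w s (scons i v) + 5)
  end.

(* [m i] is the register holding variable [i]; the value goes to register [d], and
   only registers from [d] on are written. *)
Fixpoint compile (m : nat -> nat) d ofs e : code :=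
  match e with
  | EVar i => [:: (Copy d (m i), 0)]
  | EZero => [:: (SetZ d, 0)]
  | ESize => [:: (SetZ d, 0); (TInp d true, 4 + ofs); (TInp d false, 4 + ofs);
                 (Jmp, 6 + ofs); (Inc d, 0); (Jmp, 1 + ofs)]
  | ESucc e => compile m d ofs e ++ [:: (Inc d, 0)]
  | EInp b e =>
    let c := compile m d ofs e in let a := ofs + size c in
    c ++ [:: (TInp d b, 3 + a); (SetZ d, 0); (Jmp, 5 + a); (SetZ d, 0); (Inc d, 0)]
  | EIfLt e1 e2 e3 e4 =>
    let c1 := compile m d ofs e1 in
    let c2 := compile m d.+1 (ofs + size c1) e2 in
    let a := ofs + size c1 + size c2 in
    let c3 := compile m d a.+1 e3 in
    let b := a.+1 + size c3 in
    let c4 := compile m d b.+1 e4 in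
    c1 ++ c2 ++ (TLe d.+1 d, b.+1) :: c3 ++ (Jmp, b.+1 + size c4) :: c4
  | ESum e1 e2 =>
    let c1 := compile m d ofs e1 in
    let a := ofs + size c1 in
    let c2 := compile (scons (d + 2) m) (d + 3) (3 + a) e2 in
    let b := 3 + a + size c2 in
    c1 ++ [:: (SetZ (d + 1), 0); (SetZ (d + 2), 0); (TLe d (d + 2), 7 + b)] ++ c2 ++
    [:: (SetZ (d + 4), 0); (TLe (d + 3) (d + 4), 5 + b); (Inc (d + 1), 0);
        (Inc (d + 4), 0); (Jmp, 1 + b); (Inc (d + 2), 0); (Jmp, 2 + a); (Copy d (d + 1), 0)]
  end.

(** Jump targets are absolute, so a fragment is only meaningful at the offset it was compiled
    for. *)
Definition subcode (C : code) ofs c := exists pre post, C = pre ++ c ++ post /\ size pre = ofs.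

Lemma subcode_catl C ofs c1 c2 : subcode C ofs (c1 ++ c2) -> subcode C ofs c1.
Proof. by case=> p [q [-> <-]]; exists p, (c2 ++ q); rewrite !catA. Qed.

Lemma subcode_catr C ofs c1 c2 : subcode C ofs (c1 ++ c2) -> subcode C (ofs + size c1) c2.
Proof. by case=> p [q [-> <-]]; exists (p ++ c1), q; rewrite size_cat !catA. Qed.

Lemma subcode_behead C ofs i c : subcode C ofs (i :: c) -> subcode C ofs.+1 c.
Proof. by rewrite -cat1s => /subcode_catr; rewrite addn1. Qed.

Section Reach.
Variables (w : seq bool) (C : code).

Definition creach k (c c' : rconf) := exists2 u, u <= k & iter u (cstep w C) c = c'.

Lemma creach_trans k1 k2 k c1 c2 c3 : creach k1 c1 c2 -> creach k2 c2 c3 ->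
  k1 + k2 <= k -> creach k c1 c3.
Proof.
by move=> [u1 H1 <-] [u2 H2 <-] H; exists (u2 + u1); [lia|rewrite iterD].
Qed.

Lemma creach_refl k c : creach k c c.
Proof. by exists 0. Qed.

Lemma creach_step ofs o l c s out k c' : subcode C ofs ((o, l) :: c) ->
  creach k (if op_test w s o then l else ofs.+1, op_env o s, out ++ op_out o) c' ->
  creach k.+1 (ofs, s, out) c'.
Proof.
move=> [p [q [E Ep]]] H.
apply: (@creach_trans 1 k) H (leqnn _); exists 1 => //=; rewrite /cstep /instr E.
by rewrite nth_cat -Ep ltnn subnn /= !size_cat /= ifT //; lia.
Qed.

End Reach.

Lemma updE (s : nat -> nat) x a y : upd s x a y = if y == x then a else s y.
Proof. by []. Qed.

Ltac updt := rewrite /= ?updE; repeat (case: eqP => ?; try lia); try lia.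

(** Registers form a stack: variables live below [d], temporaries from [d] on. The middle conclusion
    says that the variables survive, which lets subexpressions be evaluated in sequence. *)
Lemma compile_ok w C e : forall m d ofs s out v, subcode C ofs (compile m d ofs e) ->
  (forall i, m i < d) -> (forall i, s (m i) = v i) ->
  exists s', [/\ s' d = eval w e v, forall x, x < d -> s' x = s x &
    creach w C (cost w e v) (ofs, s, out) (ofs + size (compile m d ofs e), s', out)].
Proof.
elim: e => [i|||e IH|b e IH|e1 IH1 e2 IH2 e3 IH3 e4 IH4|e1 IH1 e2 IH2] m d ofs s out v HC Hm Hs.
- exists (upd s d (s (m i))); split=> [|x Hx|]; [by updt|by updt|].
  apply: (creach_step HC); rewrite /= cats0 addn1; exact: creach_refl.
- exists (upd s d 0); split=> [|x Hx|]; [by updt|by updt|].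
  apply: (creach_step HC); rewrite /= cats0 addn1; exact: creach_refl.
- have HL1 := subcode_behead HC; have HL2 := subcode_behead HL1.
  have HL3 := subcode_behead HL2; have HL4 := subcode_behead HL3.
  have HL5 := subcode_behead HL4.
  (* The length is found by counting up to the first index at which neither bit test succeeds. *)
  have loop k t : t d + k = size w -> exists t', [/\ t' d = size w,
      forall x, x < d -> t' x = t x &
      creach w C (4 * k + 3) (1 + ofs, t, out) (6 + ofs, t', out)].
    elim: k t => [|k IH] t Ht.
      have E : inp w (t d) = None by rewrite /inp nth_default // size_map; lia.
      exists t; split=> //; first by lia.
      apply: (creach_step HL1); rewrite /= cats0 E.
      apply: (creach_step HL2); rewrite /= cats0 E.
      by apply: (creach_step HL3); rewrite /= cats0; exact: creach_refl.
    have [|t' [J1 J2 J3]] := IH (upd t d (t d).+1); first by updt.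
    exists t'; split=> // [x Hx|]; first by rewrite J2 //; updt.
    apply: (@creach_trans _ _ 2 (4 * k + 5) _ _ (4 + ofs, t, out)); last by lia.
      have E : inp w (t d) = Some (nth false w (t d)) by rewrite /inp (nth_map false) //; lia.
      apply: (creach_step HL1); rewrite /= cats0 E.
      case En: (nth _ _ _) in E *; first exact: creach_refl.
      by apply: (creach_step HL2); rewrite /= cats0 E; exact: creach_refl.
    rewrite addnS addnS; apply: (creach_step HL4); rewrite /= cats0.
    by apply: (creach_step HL5); rewrite /= cats0.
  have [|s1 [J1 J2 J3]] := loop (size w) (upd s d 0); first by updt.
  exists s1; split=> // [x Hx|]; first by rewrite J2 //; updt.
  rewrite (addnC ofs) /= addnS; apply: (creach_step HC); rewrite /= cats0; exact: J3.
- have [s1 [H1 H2 H3]] := IH m d ofs s out v (subcode_catl HC) Hm Hs.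
  exists (upd s1 d (s1 d).+1); split=> [|x Hx|]; [by updt|by updt; rewrite H2|].
  apply: creach_trans H3 _ _; last by rewrite /= -addn1.
  apply: (creach_step (subcode_catr HC)); rewrite /= cats0 size_cat /= addn1 addnS.
  exact: creach_refl.
- have [s1 [H1 H2 H3]] := IH m d ofs s out v (subcode_catl HC) Hm Hs.
  have HC2 := subcode_catr HC.
  set a := ofs + size _ in HC2 H3.
  rewrite /= size_cat addnA -/a (addnC a) /=.
  have HC3 := subcode_behead HC2; have HC5 := subcode_behead (subcode_behead HC3).
  case Et : (inp w (eval w e v) == Some b).
  + exists (upd (upd s1 d 0) d (upd s1 d 0 d).+1); split=> [|x Hx|].
    * by updt.
    * by updt; rewrite H2.
    apply: creach_trans H3 _ (leqnn _).
    apply: (creach_step HC2); rewrite /= cats0 H1 Et.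
    apply: (creach_step HC5); rewrite /= cats0.
    apply: (creach_step (subcode_behead HC5)); rewrite /= cats0.
    exact: creach_refl.
  + exists (upd s1 d 0); split=> [|x Hx|].
    * by updt.
    * by updt; rewrite H2.
    apply: creach_trans H3 _ (leqnn _).
    apply: (creach_step HC2); rewrite /= cats0 H1 Et.
    apply: (creach_step HC3); rewrite /= cats0.
    apply: (creach_step (subcode_behead HC3)); rewrite /= cats0.
    exact: creach_refl.
- have HC1 := subcode_catl HC; have HC2 := subcode_catl (subcode_catr HC).
  have HC3 := subcode_catr (subcode_catr HC).
  have HC4 := subcode_catl (subcode_behead HC3).
  have HC5 := subcode_catr (subcode_behead HC3).
  have HC6 := subcode_behead HC5.
  rewrite /= !size_cat /= size_cat /=.
  set c1 := compile m d ofs e1 in HC2 HC3 HC4 HC5 HC6 *.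
  set c2 := compile m d.+1 _ e2 in HC2 HC3 HC4 HC5 HC6 *.
  set a := ofs + size c1 + size c2 in HC3 HC4 HC5 HC6 *.
  set c3 := compile m d a.+1 e3 in HC3 HC4 HC5 HC6 *.
  set b := a.+1 + size c3 in HC3 HC4 HC5 HC6 *.
  set c4 := compile m d b.+1 e4 in HC3 HC4 HC5 HC6 *.
  have -> : ofs + (size c1 + (size c2 + (size c3 + (size c4).+1).+1)) = b.+1 + size c4.
    by rewrite /b /a; lia.
  have [s1 [V1 K1 R1]] := IH1 m d ofs s out v HC1 Hm Hs.
  have [|i|s2 [V2 K2 R2]] := IH2 m d.+1 (ofs + size c1) s1 out v HC2.
  + by move=> i; rewrite ltnS ltnW.
  + by rewrite K1.
  have R12 := creach_trans R1 R2 (leqnn _).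
  rewrite -/a in R12.
  have Hs2 i : s2 (m i) = v i by rewrite K2 ?K1 // ltnS ltnW.
  case: ltnP => Hlt.
  + have [s3 [V3 K3 R3]] := IH3 m d a.+1 s2 out v HC4 Hm Hs2.
    exists s3; split=> // [x Hx|]; first by rewrite K3 // K2 ?K1 // ltnS ltnW.
    apply: (creach_trans R12 (k2 := cost w e3 v + 2)); last by lia.
    rewrite addnS addn1; apply: (creach_step HC3).
    rewrite /= cats0 V2 K2 // V1 leqNgt Hlt /=.
    apply: (creach_trans R3 (k2 := 1)); last by rewrite addn1.
    apply: (creach_step HC5); rewrite /= cats0; exact: creach_refl.
  + have [s3 [V3 K3 R3]] := IH4 m d b.+1 s2 out v HC6 Hm Hs2.
    exists s3; split=> // [x Hx|]; first by rewrite K3 // K2 ?K1 // ltnS ltnW.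
    apply: (creach_trans R12 (k2 := cost w e4 v + 1)); last by lia.
    rewrite addn1; apply: (creach_step HC3).
    by rewrite /= cats0 V2 K2 // V1 Hlt.
- have HC1 := subcode_catl HC; have HC2 := subcode_catr HC.
  have HC5 := subcode_behead (subcode_behead (subcode_behead HC2)).
  have HC6 := subcode_catr HC5; have {}HC5 := subcode_catl HC5.
  rewrite /= size_cat /= size_cat /=.
  set c1 := compile m d ofs e1 in HC2 HC5 HC6 *.
  set a := ofs + size c1 in HC2 HC5 HC6 *.
  rewrite -[a.+3]/(3 + a) in HC5 HC6.
  set c2 := compile _ _ _ e2 in HC5 HC6 *.
  set b := 3 + a + size c2 in HC2 HC6 *.
  have -> : ofs + (size c1 + (size c2 + 8).+3) = 8 + b by rewrite /b /a; lia.
  have [s1 [V1 K1 R1]] := IH1 m d ofs s out v HC1 Hm Hs.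
  set N := eval w e1 v in V1 *.
  have HL1 := subcode_behead HC6; have HL2 := subcode_behead HL1.
  have HL3 := subcode_behead HL2; have HL4 := subcode_behead HL3.
  have HL5 := subcode_behead HL4; have HL6 := subcode_behead HL5.
  have HL7 := subcode_behead HL6.
  (* The value of the body, in [d + 3], is added to the accumulator [d + 1] one unit at a time with
     counter [d + 4]; hence the multiple 4 of that value in [cost]. *)
  have inner k t : t (d + 4) + k = t (d + 3) -> exists t',
    [/\ t' (d + 1) = t (d + 1) + k, t' (d + 2) = t (d + 2), forall x, x <= d -> t' x = t x &
        creach w C (4 * k + 1) (1 + b, t, out) (5 + b, t', out)].
    elim: k t => [|k IHk] t Ht.
      exists t; split=> //; rewrite ?addn0 //.
      apply: (creach_step HL1); rewrite /= cats0 ifT ?addn0; last by lia.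
      exact: creach_refl.
    pose t1 := upd (upd t (d + 1) (t (d + 1)).+1) (d + 4) (upd t (d + 1) (t (d + 1)).+1 (d + 4)).+1.
    have [|t' [J1 J2 J3 J4]] := IHk t1; first by rewrite /t1; updt.
    exists t'; split.
    - by rewrite J1 /t1; updt.
    - by rewrite J2 /t1; updt.
    - by move=> x Hx; rewrite J3 // /t1; updt.
    - have -> : 4 * k.+1 + 1 = (4 * k + 1).+4 by lia.
      apply: (creach_step HL1); rewrite /= cats0 ifF; last by lia.
      apply: (creach_step HL2); rewrite /= cats0.
      apply: (creach_step HL3); rewrite /= cats0.
      by apply: (creach_step HL4); rewrite /= cats0.
  (* Invariant of the summation loop, by induction on the number [k] of rounds left; [d + 2] holds
     the index, which is variable 0 of the body. *)
  have outer k i t : t d = N -> i + k = N -> t (d + 2) = i -> (forall x, x < d -> t x = s x) ->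
    exists t', [/\ t' (d + 1) = t (d + 1) + \sum_(i <= j < N) eval w e2 (scons j v),
      forall x, x < d -> t' x = s x &
      creach w C (\sum_(i <= j < N) (cost w e2 (scons j v) + 4 * eval w e2 (scons j v) + 5) + 1)
        (2 + a, t, out) (7 + b, t', out)].
    elim: k i t => [|k IHk] i t Ht Hk Hi Hx.
      exists t; split=> //; rewrite big_geq ?addn0 //; try lia.
      apply: (creach_step (subcode_behead (subcode_behead HC2))).
      by rewrite /= cats0 ifT; [exact: creach_refl|lia].
    have [|j|t1 [V2 K2 R2]] := IH2 (scons (d + 2) m) (d + 3) (3 + a) t out (scons i v) HC5.
    - by case=> [|j] /=; [lia|have := Hm j; lia].
    - by case: j => [|j] /=; rewrite // Hx.
    have [|t2 [V3 K3 K3' R3]] := inner (eval w e2 (scons i v)) (upd t1 (d + 4) 0).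
    - by updt.
    have [|||x Hxd|t3 [V4 K4 R4]] := IHk i.+1 (upd t2 (d + 2) (t2 (d + 2)).+1).
    - by updt; rewrite K3' // ; updt; rewrite K2 //; lia.
    - by lia.
    - by updt; rewrite K3; updt; rewrite K2 ?Hi //; lia.
    - by updt; rewrite K3' ?(ltnW Hxd) //; updt; rewrite K2 ?Hx //; lia.
    exists t3; split=> //.
    - rewrite V4 [in RHS]big_ltn; last by lia.
      by updt; rewrite V3; updt; rewrite K2; lia.
    - rewrite big_ltn; last by lia.
      set S := \sum_(_ <= _ < _) _ in R4 *.
      apply: (@creach_trans _ _ 1 (cost w e2 (scons i v) + 4 * eval w e2 (scons i v) + 5 + S)
                _ _ (3 + a, t, out)); last by lia.
        apply: (creach_step (subcode_behead (subcode_behead HC2))).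
        by rewrite /= cats0 ifF; [exact: creach_refl|lia].
      apply: (creach_trans R2 (k2 := 4 * eval w e2 (scons i v) + 5 + S)); last by lia.
      rewrite -/b.
      apply: (@creach_trans _ _ 1 (4 * eval w e2 (scons i v) + 4 + S)
                _ _ (1 + b, upd t1 (d + 4) 0, out)); last by lia.
        by apply: (creach_step HC6); rewrite /= cats0; exact: creach_refl.
      apply: (creach_trans R3 (k2 := (S + 1).+2)); last by lia.
      apply: (creach_step HL5); rewrite /= cats0.
      by apply: (creach_step HL6); rewrite /= cats0.
  pose s2 := upd (upd s1 (d + 1) 0) (d + 2) 0.
  have [|||x Hx|s3 [V3 K3 R3]] := outer N 0 s2.
  + by rewrite /s2; updt.
  + by [].
  + by rewrite /s2; updt.
  + by rewrite /s2; updt; rewrite K1.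
  exists (upd s3 d (s3 (d + 1))); split=> [|x Hx|].
  + by updt; rewrite V3 /s2; updt.
  + by updt; rewrite K3.
  set S := \sum_(_ <= _ < _) _ in R3 *.
  apply: (creach_trans R1 (k2 := (S + 2).+2)); last by lia.
  rewrite -/a; apply: (creach_step HC2); rewrite /= cats0.
  apply: (creach_step (subcode_behead HC2)); rewrite /= cats0.
  apply: (creach_trans R3 (k2 := 1)); last by lia.
  apply: (creach_step HL7); rewrite /= cats0; exact: creach_refl.
Qed.

(** * Polynomial bounds on values and running times *)

(** A one-parameter family that is monotone in both arguments, exceeds 1, and absorbs sums, products
    and compositions by raising [d]. *)
Definition pol d n := (n + d.+2) ^ d.+1.

Lemma pol_mono d d' n n' : d <= d' -> n <= n' -> pol d n <= pol d' n'.
Proof.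
move=> Hd Hn; apply: (@leq_trans ((n' + d'.+2) ^ d.+1)).
  by rewrite leq_exp2r //; lia.
by rewrite leq_exp2l //; lia.
Qed.

Lemma pol_gt1 d n : 1 < pol d n.
Proof. by rewrite -[1](exp1n d.+1) ltn_exp2r //; lia. Qed.

Definition pbd (f : nat -> nat) := exists d, forall n, f n <= pol d n.

Lemma pbd_le f g : (forall n, f n <= g n) -> pbd g -> pbd f.
Proof. by move=> H [d Hd]; exists d => n; apply: leq_trans (H n) (Hd n). Qed.

Lemma pbd_pol d : pbd (pol d).
Proof. by exists d. Qed.

Lemma pbd_id : pbd id.
Proof. by exists 0 => n; rewrite /pol expn1 leq_addr. Qed.

Lemma pbd_const c : pbd (fun=> c).
Proof.
exists c => n; apply: (@leq_trans (n + c.+2)); first by lia.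
by rewrite /pol -{1}[n + _]expn1 leq_exp2l //; lia.
Qed.

Lemma pbd_mul f g : pbd f -> pbd g -> pbd (fun n => f n * g n).
Proof.
move=> [a Ha] [b Hb]; exists (a + b + 1) => n.
apply: (@leq_trans (pol a n * pol b n)); first exact: leq_mul.
have -> : pol (a + b + 1) n = (n + (a + b + 1).+2) ^ a.+1 * (n + (a + b + 1).+2) ^ b.+1.
  by rewrite -expnD /pol; congr (_ ^ _); lia.
by apply: leq_mul; rewrite leq_exp2r //; lia.
Qed.

(** The sum of two numbers that are at least 2 is at most their product; this is why [pol] is kept
    above 1. *)
Lemma pbd_add f g : pbd f -> pbd g -> pbd (fun n => f n + g n).
Proof.
move=> [a Ha] [b Hb].
apply: (@pbd_le _ (fun n => pol a n * pol b n)); last by apply: pbd_mul; apply: pbd_pol.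
move=> n; have := pol_gt1 a n; have := pol_gt1 b n; move: (Ha n) (Hb n); nia.
Qed.

Lemma leq_exp_add x c k : x ^ k.+1 + c <= (x + c) ^ k.+1.
Proof.
elim: k => [|k IH]; first by rewrite !expn1.
rewrite expnS [(x + c) ^ _]expnS mulnDl.
have := IH; have: 0 < x ^ k.+1 \/ x = 0.
  by case: x {IH} => [|x]; [right|left; rewrite expn_gt0].
case=> H; first by nia.
move=> _; rewrite H mul0n !add0n.
case: c {IH} => // c; rewrite leq_pmulr // expn_gt0 //.
Qed.

Lemma pol_comp a b : pbd (fun n => pol b (pol a n)).
Proof.
exists (a.+1 * b.+1 + a + b + 2) => n; rewrite {1}/pol.
apply: (@leq_trans (((n + a.+2 + b.+2) ^ a.+1) ^ b.+1)).
  by rewrite leq_exp2r // leq_exp_add.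
rewrite -expnM /pol; apply: (@leq_trans ((n + (a.+1 * b.+1 + a + b + 2).+2) ^ (a.+1 * b.+1))).
  by rewrite leq_exp2r //; lia.
by rewrite leq_exp2l //; lia.
Qed.

Lemma pbd_comp f g b : (forall n, f n <= pol b (g n)) -> pbd g -> pbd f.
Proof.
move=> H [a Ha]; apply: pbd_le (pol_comp a b) => n.
by apply: leq_trans (H n) _; apply: pol_mono.
Qed.

(** One [V] bounds the word length and all variables. The body of a sum sees a new variable, smaller
    than the range, so its bound is taken at [V + f1 V]; composition of polynomials closes the
    induction. *)
Lemma eval_cost_bound e : exists d, forall V w v, size w <= V -> (forall i, v i <= V) ->
  eval w e v <= pol d V /\ cost w e v <= pol d V.
Proof.
suff: exists f, pbd f /\ forall V w v, size w <= V -> (forall i, v i <= V) ->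
    eval w e v <= f V /\ cost w e v <= f V.
  move=> [f [[d Hd] H]]; exists d => V w v H1 H2; have [H3 H4] := H V w v H1 H2.
  by split; [apply: leq_trans H3 _|apply: leq_trans H4 _].
elim: e => [i|||e [f [Pf IH]]|b e [f [Pf IH]]|e1 [f1 [P1 IH1]] e2 [f2 [P2 IH2]] e3 [f3 [P3 IH3]]
    e4 [f4 [P4 IH4]]|e1 [f1 [P1 IH1]] e2 [f2 [[d2 P2] IH2]]] /=.
- exists (fun n => n + 1); split; first by apply: pbd_add pbd_id (pbd_const 1).
  by move=> V w v _ H; have := H i; split; lia.
- by exists (fun=> 1); split; first exact: pbd_const.
- exists (fun n => 4 * n + 4); split.
    by apply: pbd_add (pbd_const 4); apply: pbd_mul (pbd_const 4) pbd_id.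
  by move=> V w v H _; split; lia.
- exists (fun n => f n + 1); split; first by apply: pbd_add (pbd_const 1).
  by move=> V w v H1 H2; have := IH V w v H1 H2; lia.
- exists (fun n => f n + 3); split; first by apply: pbd_add (pbd_const 3).
  by move=> V w v H1 H2; have := IH V w v H1 H2; case: (_ == _) => /=; lia.
- exists (fun n => f1 n + f2 n + f3 n + f4 n + 2); split.
    by do !apply: pbd_add => //; exact: pbd_const.
  move=> V w v H1 H2; have := IH1 V w v H1 H2; have := IH2 V w v H1 H2.
  by have := IH3 V w v H1 H2; have := IH4 V w v H1 H2; case: ifP => _; lia.
- have P3 : pbd (fun n => pol d2 (n + f1 n)).
    by apply: (@pbd_comp _ (fun n => n + f1 n) d2) => //; apply: pbd_add pbd_id _.
  exists (fun n => f1 n + 4 + f1 n * (5 * pol d2 (n + f1 n) + 5)); split.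
    apply: pbd_add; first by apply: pbd_add (pbd_const 4).
    by apply: pbd_mul => //; apply: pbd_add (pbd_const 5); apply: pbd_mul (pbd_const 5) _.
  move=> V w v H1 H2; have [E1 C1] := IH1 V w v H1 H2.
  set N := eval w e1 v in E1 *.
  have B i : i < N -> eval w e2 (scons i v) <= pol d2 (V + f1 V) /\
                      cost w e2 (scons i v) <= pol d2 (V + f1 V).
    move=> Hi; have [||J1 J2] := IH2 (V + f1 V) w (scons i v); first by lia.
      by case=> [|j] /=; [lia|have := H2 j; lia].
    by split; [apply: leq_trans J1 _|apply: leq_trans J2 _]; exact: P2.
  have S (F : nat -> nat) c : (forall i, i < N -> F i <= c) -> \sum_(0 <= i < N) F i <= N * c.
    move=> HF; rewrite -[N in N * c]subn0 -sum_nat_const_nat !big_nat.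
    by apply: leq_sum => i; apply: HF.
  have S1 := S _ _ (fun i Hi => proj1 (B i Hi)).
  split; first by apply: leq_trans S1 _; nia.
  apply: (@leq_trans (f1 V + 4 + N * (5 * pol d2 (V + f1 V) + 5))); last by nia.
  apply: leq_add; first by lia.
  by apply: S => i Hi; have := B i Hi; lia.
Qed.

(** Register 0 is never written and serves as the constant 0 and as every free variable; register 1
    is the output index, 2 the length, 3 the value deciding the bit. *)
Definition emit_code el eb : code :=
  let c1 := compile (fun=> 0) 2 0 el in
  let a := size c1 in
  let c2 := compile (scons 1 (fun=> 0)) 3 a.+1 eb in
  let b := a.+1 + size c2 in
  c1 ++ (TLe 2 1, 6 + b) :: c2 ++
  [:: (TLe 3 0, 3 + b); (Emit true, 0); (Jmp, 4 + b); (Emit false, 0); (Inc 1, 0); (Jmp, a)].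

(** The 6 counts the exit test, at most three instructions to select and emit a bit, the increment
    and the jump back; the last 1 is the successful exit test. *)
Lemma emit_code_run el eb w : let C := emit_code el eb in
  let N := eval w el (fun=> 0) in
  exists s, creach w C (cost w el (fun=> 0) +
      \sum_(0 <= i < N) (cost w eb (scons i (fun=> 0)) + 6) + 1) (0, fun=> 0, [::])
    (size C, s, mkseq (fun i => 0 < eval w eb (scons i (fun=> 0))) N).
Proof.
move=> C N; have HC : subcode C 0 (emit_code el eb) by exists [::], [::]; rewrite cats0.
have HC1 := subcode_catl HC; have HC2 := subcode_catr HC.
have HC3 := subcode_catl (subcode_behead HC2).
have HC4 := subcode_catr (subcode_behead HC2).
rewrite {2}/C /emit_code !size_cat /= size_cat /=.
set c1 := compile _ 2 0 el in HC2 HC3 HC4 *; rewrite !add0n in HC2 HC3 HC4.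
set a := size c1 in HC2 HC3 HC4 *.
set c2 := compile _ 3 a.+1 eb in HC2 HC3 HC4 *.
set b := a.+1 + size c2 in HC2 HC4 *.
have -> : a + (size c2 + 6).+1 = 6 + b by rewrite /b; lia.
have [||s1 [V1 K1 R1]] := @compile_ok w C el _ _ _ (fun=> 0) [::] (fun=> 0) HC1; [by []|by []|].
rewrite add0n -/a -/N in V1 R1.
have HL1 := subcode_behead HC4; have HL2 := subcode_behead HL1.
have HL3 := subcode_behead HL2; have HL4 := subcode_behead HL3.
have HL5 := subcode_behead HL4.
pose bit i := 0 < eval w eb (scons i (fun=> 0)).
have loop k i t : i + k = N -> t 0 = 0 -> t 1 = i -> t 2 = N -> exists t',
    creach w C (\sum_(i <= j < N) (cost w eb (scons j (fun=> 0)) + 6) + 1)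
      (a, t, mkseq bit i) (6 + b, t', mkseq bit N).
  elim: k i t => [|k IH] i t Hi T0 T1 T2.
    exists t; rewrite big_geq; last by lia.
    apply: (creach_step HC2); rewrite /= cats0 T1 T2 ifT; last by lia.
    have -> : i = N by lia.
    exact: creach_refl.
  have [||t1 [V2 K2 R2]] := @compile_ok w C eb _ _ _ t (mkseq bit i) (scons i (fun=> 0)) HC3.
  - by case.
  - by case.
  have [||||t2 R3] := IH i.+1 (upd t1 1 (t1 1).+1); rewrite ?updE //=; try lia.
  - by rewrite K2.
  - by rewrite K2 ?T1.
  - by rewrite K2.
  exists t2; rewrite big_ltn; last by lia.
  set S := \sum_(_ <= _ < _) _ in R3 *.
  apply: (@creach_trans _ _ 1 (cost w eb (scons i (fun=> 0)) + 6 + S) _ _ (a.+1, t, mkseq bit i));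
    last by lia.
    apply: (creach_step HC2); rewrite /= cats0 T1 T2 ifF; last by lia.
    exact: creach_refl.
  apply: (creach_trans R2 (k2 := 6 + S)); last by lia.
  rewrite -/b; apply: (@creach_trans _ _ 3 (S + 3) _ _ (4 + b, t1, mkseq bit i.+1)); last by lia.
    apply: (creach_step HC4); rewrite /= cats0 V2 K2 // T0 leqn0.
    rewrite mkseqS -cats1 /bit lt0n; case: eqP => E /=.
      by apply: (creach_step HL3); exact: creach_refl.
    apply: (creach_step HL1) => /=.
    by apply: (creach_step HL2); rewrite /= cats0; exact: creach_refl.
  rewrite addn3; apply: (creach_step HL4); rewrite /= cats0.
  by apply: (creach_step HL5); rewrite /= cats0 -addn1.
have [||||s2 R2] := loop N 0 s1; [by []|by rewrite K1|by rewrite K1|by []|].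
exists s2; apply: creach_trans R1 R2 _; by rewrite addnA.
Qed.

Lemma sim_time_mono g n t t' : t <= t' -> sim_time g n t <= sim_time g n t'.
Proof.
move=> H; have Hb : sim_bits g n t <= sim_bits g n t'.
  by apply: leq_mul; rewrite ?ltnS // leq_mul2r; apply/orP; right; lia.
rewrite /sim_time; apply: leq_mul; first by rewrite leq_add2l.
by rewrite leq_add2r leq_mul2l; apply/orP; right; nia.
Qed.

Lemma pbd_succ f : pbd f -> pbd (fun n => (f n).+1).
Proof.
by move=> Hf; apply: pbd_le (pbd_add Hf (pbd_const 1)) => n; rewrite addn1.
Qed.

Ltac pbd_tac := repeat first [exact: pbd_id | exact: pbd_const | assumption
  | apply: pbd_add | apply: pbd_mul | apply: pbd_succ].

Lemma pbd_sim_time g f : pbd f -> pbd (fun n => sim_time g n (f n)).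
Proof.
move=> Hf; have Hb : pbd (fun n => sim_bits g n (f n)) by rewrite /sim_bits; pbd_tac.
by rewrite /sim_time; pbd_tac.
Qed.

(** For positive [n] one has [n + d.+2 <= d.+3 * n]; the additive constant of [poly] covers
    [n = 0]. *)
Lemma pol_poly d n : pol d n <= poly (d.+3 ^ d.+1) d.+1 n.
Proof.
rewrite /poly /pol; case: n => [|n].
  by rewrite add0n; apply: leq_trans (leq_addl _ _); rewrite leq_exp2r.
apply: leq_trans (leq_addr _ _); rewrite -expnMn leq_exp2r //; nia.
Qed.

Theorem emit_TM el eb : exists (M : TM) c k, forall w,
  let out := mkseq (fun i => 0 < eval w eb (scons i (fun=> 0))) (eval w el (fun=> 0)) in
  let cf := tm_run M (poly c k (size w)) w in
  [/\ tm_halt cf.1, tape_output cf.2 = out & tm_accept cf.1 = head false out].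
Proof.
have [M [g HM]] := code_TM (emit_code el eb).
have [d1 B1] := eval_cost_bound el; have [d2 B2] := eval_cost_bound eb.
have [d3 B3] : pbd (fun n => sim_time g n (pol d1 n + pol d1 n * (pol d2 (n + pol d1 n) + 6) + 1)).
  apply: pbd_sim_time; have H1 := pbd_pol d1.
  have H2 : pbd (fun n => pol d2 (n + pol d1 n)).
    by apply: (@pbd_comp _ (fun n => n + pol d1 n) d2) => //; pbd_tac.
  by pbd_tac.
exists M, (d3.+3 ^ d3.+1), d3.+1 => w out.
have [s [u Hu Eu]] := emit_code_run el eb w.
apply: (HM w u _ _ _ Eu (leqnn _)).
apply: leq_trans (pol_poly d3 (size w)); apply: leq_trans (B3 (size w)).
apply: sim_time_mono; apply: leq_trans Hu _; rewrite leq_add2r.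
have [E1 C1] := B1 (size w) w (fun=> 0) (leqnn _) (fun=> leq0n _).
apply: leq_add => //; set N := eval w el _ in E1 *.
apply: (@leq_trans (N * (pol d2 (size w + pol d1 (size w)) + 6))); last by rewrite leq_mul2r E1 orbT.
rewrite -[N in N * _]subn0 -sum_nat_const_nat !big_nat; apply: leq_sum => i Hi.
rewrite leq_add2r; have [||//] := B2 (size w + pol d1 (size w)) w (scons i (fun=> 0)).
  exact: leq_addr.
by case=> [|j] /=; lia.
Qed.

(** * Computable functions and strings *)

Definition nfun := seq bool -> (nat -> nat) -> nat.
Definition bfun := seq bool -> (nat -> nat) -> bool.
Definition computable (f : nfun) := exists e, forall w v, eval w e v = f w v.
Definition cb (P : bfun) := computable (fun w v => nat_of_bool (P w v)).

Lemma eval_ext w e v v' : v =1 v' -> eval w e v = eval w e v'.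
Proof.
elim: e v v' => [i|||e IH|b e IH|a IHa b IHb c IHc d IHd|n IHn s IHs] v v' H //=.
- by rewrite (IH _ _ H).
- by rewrite (IH _ _ H).
- by rewrite (IHa _ _ H) (IHb _ _ H) (IHc _ _ H) (IHd _ _ H).
- by rewrite (IHn _ _ H); apply: eq_bigr => i _; apply: IHs; case.
Qed.

Lemma comp_ext (g f : nfun) : (forall w v, f w v = g w v) -> computable g -> computable f.
Proof. by move=> H [e He]; exists e => w v; rewrite He H. Qed.

Lemma cb_ext (g f : bfun) : (forall w v, f w v = g w v) -> cb g -> cb f.
Proof. by move=> H; apply: comp_ext => w v; rewrite H. Qed.

Lemma comp_var i : computable (fun _ v => v i).
Proof. by exists (EVar i). Qed.

Lemma comp_const c : computable (fun _ _ => c).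
Proof. by elim: c => [|c [e He]]; [exists EZero|exists (ESucc e) => w v /=; rewrite He]. Qed.

Lemma comp_size : computable (fun w _ => size w).
Proof. by exists ESize. Qed.

Lemma comp_succ f : computable f -> computable (fun w v => (f w v).+1).
Proof. by move=> [e He]; exists (ESucc e) => w v /=; rewrite He. Qed.

Lemma comp_iflt f g x y : computable f -> computable g -> computable x -> computable y ->
  computable (fun w v => if f w v < g w v then x w v else y w v).
Proof.
move=> [a Ha] [b Hb] [c Hc] [d Hd]; exists (EIfLt a b c d) => w v /=.
by rewrite Ha Hb Hc Hd.
Qed.

Lemma comp_sum n (s : seq bool -> (nat -> nat) -> nat -> nat) : computable n ->
  computable (fun w v => s w (fun j => v j.+1) (v 0)) ->
  computable (fun w v => \sum_(0 <= i < n w v) s w v i).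
Proof.
move=> [a Ha] [b Hb]; exists (ESum a b) => w v /=.
by rewrite Ha; apply: eq_bigr => i _; rewrite Hb.
Qed.

Lemma cb_inp b f : computable f -> cb (fun w v => inp w (f w v) == Some b).
Proof. by move=> [e He]; exists (EInp b e) => w v /=; rewrite He. Qed.

Lemma comp_ren r f : computable f -> computable (fun w v => f w (fun i => v (r i))).
Proof.
suff H e : forall r, computable (fun w v => eval w e (fun i => v (r i))).
  by move=> [e He]; apply: comp_ext (H e r) => w v; rewrite He.
elim: e => [i|||e IH|b e IH|a IHa b IHb c IHc d IHd|n IHn s IHs] {}r /=.
- exact: comp_var.
- exact: comp_const.
- exact: comp_size.
- exact: comp_succ.
- exact: cb_inp.
- exact: comp_iflt.
- apply: (@comp_sum _ (fun w v i => eval w s (scons i (fun i => v (r i))))) => //.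
  apply: comp_ext (IHs (fun i => if i is j.+1 then (r j).+1 else 0)) => w v.
  by apply: eval_ext; case.
Qed.

(** Under a sum the substitution is lifted: the new index is kept and the substituted functions are
    weakened, which is why renaming is established beforehand. *)
Lemma comp_subst f (th : nat -> nfun) : computable f -> (forall i, computable (th i)) ->
  computable (fun w v => f w (fun i => th i w v)).
Proof.
suff H e : forall th : nat -> nfun, (forall i, computable (th i)) ->
    computable (fun w v => eval w e (fun i => th i w v)).
  by move=> [e He] Ht; apply: comp_ext (H e th Ht) => w v; rewrite He.
elim: e => [i|||e IH|b e IH|a IHa b IHb c IHc d IHd|n IHn s IHs] {}th Ht /=.
- exact: Ht.
- exact: comp_const.
- exact: comp_size.
- by apply: comp_succ; apply: IH.
- by apply: cb_inp; apply: IH.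
- by apply: comp_iflt; [apply: IHa|apply: IHb|apply: IHc|apply: IHd].
- apply: (@comp_sum _ (fun w v i => eval w s (scons i (fun i => th i w v)))); first exact: IHn.
  pose th' i : nfun := if i is j.+1 then (fun w v => th j w (fun i => v i.+1)) else (fun _ v => v 0).
  apply: comp_ext (IHs th' _) => [w v|[|i]].
  + by apply: eval_ext; case.
  + exact: comp_var.
  + exact: comp_ren (Ht i).
Qed.

Lemma comp_weak f : computable f -> computable (fun w v => f w (fun i => v i.+1)).
Proof. exact: (comp_ren succn). Qed.

Lemma comp_app1 (F : seq bool -> nat -> nat) a : computable (fun w v => F w (v 0)) ->
  computable a -> computable (fun w v => F w (a w v)).
Proof. by move=> H Ha; apply: (comp_subst (th := fun=> a)) H _. Qed.

Lemma comp_app2 (F : seq bool -> nat -> nat -> nat) a b :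
  computable (fun w v => F w (v 0) (v 1)) ->
  computable a -> computable b -> computable (fun w v => F w (a w v) (b w v)).
Proof.
move=> H Ha Hb; apply: (comp_subst (th := fun i => if i is 0 then a else b)) H _.
by case.
Qed.

Lemma comp_scons f a r : computable f -> computable a ->
  computable (fun w v => f w (scons (a w v) (fun i => v (r i)))).
Proof.
move=> Hf Ha.
pose th i : nfun := if i is j.+1 then (fun _ v => v (r j)) else a.
have [e He] := Hf; apply: (@comp_ext (fun w v => f w (fun i => th i w v))) => [w v|].
  by rewrite -!He; apply: eval_ext; case.
by apply: comp_subst => //; case=> // i; exact: comp_var.
Qed.

Lemma comp_if c x y : cb c -> computable x -> computable y ->
  computable (fun w v => if c w v then x w v else y w v).
Proof.
move=> Hc Hx Hy; apply: comp_ext (comp_iflt (comp_const 0) Hc Hx Hy) => w v.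
by case: (c w v).
Qed.

Lemma cb_of_if (P : bfun) f g : computable f -> computable g ->
  (forall w v, P w v = (f w v < g w v)) -> cb P.
Proof.
move=> Hf Hg E; apply: comp_ext (comp_iflt Hf Hg (comp_const 1) (comp_const 0)) => w v.
by rewrite E; case: ltnP.
Qed.

Lemma cb_lt f g : computable f -> computable g -> cb (fun w v => f w v < g w v).
Proof. by move=> Hf Hg; apply: cb_of_if Hf Hg _. Qed.

Lemma cb_le f g : computable f -> computable g -> cb (fun w v => f w v <= g w v).
Proof. by move=> Hf Hg; apply: cb_lt Hf (comp_succ Hg). Qed.

Lemma cb_const b : cb (fun _ _ => b).
Proof. exact: comp_const. Qed.

Lemma cb_if c x y : cb c -> cb x -> cb y -> cb (fun w v => if c w v then x w v else y w v).
Proof.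
by move=> Hc Hx Hy; apply: comp_ext (comp_if Hc Hx Hy) => w v; case: (c w v).
Qed.

Lemma cb_not a : cb a -> cb (fun w v => ~~ a w v).
Proof. by move=> Ha; apply: cb_ext (cb_if Ha (cb_const false) (cb_const true)) => w v. Qed.

Lemma cb_and a b : cb a -> cb b -> cb (fun w v => a w v && b w v).
Proof. by move=> Ha Hb; apply: cb_ext (cb_if Ha Hb (cb_const false)) => w v. Qed.

Lemma cb_or a b : cb a -> cb b -> cb (fun w v => a w v || b w v).
Proof. by move=> Ha Hb; apply: cb_ext (cb_if Ha (cb_const true) Hb) => w v. Qed.

Lemma cb_impl a b : cb a -> cb b -> cb (fun w v => a w v ==> b w v).
Proof. by move=> Ha Hb; apply: cb_ext (cb_if Ha Hb (cb_const true)) => w v. Qed.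

Lemma cb_eq f g : computable f -> computable g -> cb (fun w v => f w v == g w v).
Proof.
move=> Hf Hg; apply: (@cb_ext (fun w v => (f w v <= g w v) && (g w v <= f w v))) => [w v|].
  by rewrite eqn_leq.
by apply: cb_and; apply: cb_le.
Qed.

Lemma cb_eqb a b : cb a -> cb b -> cb (fun w v => a w v == b w v).
Proof.
move=> Ha Hb; apply: cb_ext (cb_eq Ha Hb) => w v.
by case: (a w v); case: (b w v).
Qed.

Lemma cb_has n (P : seq bool -> (nat -> nat) -> nat -> bool) : computable n ->
  cb (fun w v => P w (fun j => v j.+1) (v 0)) ->
  cb (fun w v => has (P w v) (iota 0 (n w v))).
Proof.
move=> Hn HP; apply: (@cb_ext (fun w v => 0 < \sum_(0 <= i < n w v) P w v i)) => [w v|].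
  rewrite lt0n sum_nat_seq_eq0 -has_predC /index_iota subn0.
  by apply: eq_has => i /=; case: (P w v i).
by apply: cb_lt (comp_const 0) _; apply: (@comp_sum n (fun w v i => P w v i)).
Qed.

Lemma cb_all n (P : seq bool -> (nat -> nat) -> nat -> bool) : computable n ->
  cb (fun w v => P w (fun j => v j.+1) (v 0)) ->
  cb (fun w v => all (P w v) (iota 0 (n w v))).
Proof.
move=> Hn HP; apply: (@cb_ext (fun w v => ~~ has (fun i => ~~ P w v i) (iota 0 (n w v)))) => [w v|].
  by rewrite -all_predC; apply: eq_all => i /=; rewrite negbK.
by apply/cb_not/(@cb_has n (fun w v i => ~~ P w v i)) => //; apply: cb_not.
Qed.

Lemma comp_add f g : computable f -> computable g -> computable (fun w v => f w v + g w v).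
Proof.
move=> Hf Hg.
apply: (@comp_ext (fun w v => \sum_(0 <= i < 2) if i < 1 then f w v else g w v)) => [w v|].
  by rewrite !big_nat_recl // big_geq // addn0.
apply: (@comp_sum (fun _ _ => 2) (fun w v i => if i < 1 then f w v else g w v)).
  exact: comp_const.
by apply: comp_iflt; [exact: comp_var|exact: comp_const|exact: comp_weak|exact: comp_weak].
Qed.

Lemma comp_mul f g : computable f -> computable g -> computable (fun w v => f w v * g w v).
Proof.
move=> Hf Hg; apply: (@comp_ext (fun w v => \sum_(0 <= i < f w v) g w v)) => [w v|].
  by rewrite sum_nat_const_nat subn0.
by apply: (@comp_sum f (fun w v i => g w v)) => //; apply: comp_weak.
Qed.

Lemma comp_sub f g : computable f -> computable g -> computable (fun w v => f w v - g w v).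
Proof.
move=> Hf Hg; apply: (@comp_ext (fun w v => \sum_(0 <= i < f w v) (g w v <= i))) => [w v|].
  elim: (f w v) => [|n IH]; first by rewrite big_geq.
  by rewrite big_nat_recr //= -IH; case: leqP; lia.
apply: (@comp_sum f (fun w v i => g w v <= i)) => //.
by apply: cb_le; [exact: comp_weak|exact: comp_var].
Qed.

(** The quotient counts the positive multiples of the divisor that do not exceed the dividend; the
    test [0 < g w v] reproduces the convention for division by 0. *)
Lemma comp_div f g : computable f -> computable g -> computable (fun w v => f w v %/ g w v).
Proof.
move=> Hf Hg.
apply: (@comp_ext (fun w v => \sum_(0 <= i < f w v) ((0 < g w v) && (i.+1 * g w v <= f w v)))) => [w v|].
  move: (f w v) (g w v) => n d; case: d => [|d]; first by rewrite big1.
  have H k : \sum_(0 <= i < k) ((0 < d.+1) && (i.+1 * d.+1 <= n)) = minn k (n %/ d.+1).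
    elim: k => [|k IH]; first by rewrite big_geq ?min0n.
    rewrite big_nat_recr //= IH -leq_divRL //.
    by case: (leqP k.+1 (n %/ d.+1)) => /=; lia.
  by rewrite H; apply/esym/minn_idPr/leq_div.
apply: (@comp_sum f (fun w v i => (0 < g w v) && (i.+1 * g w v <= f w v))) => //.
apply: cb_and; first by apply: cb_lt (comp_const 0) _; apply: comp_weak.
by apply: cb_le; [apply: comp_mul; [exact/comp_succ/comp_var|exact: comp_weak]|exact: comp_weak].
Qed.

Lemma comp_mod f g : computable f -> computable g -> computable (fun w v => f w v %% g w v).
Proof.
move=> Hf Hg; apply: (@comp_ext (fun w v => f w v - f w v %/ g w v * g w v)) => [w v|].
  by rewrite {2}(divn_eq (f w v) (g w v)) addKn.
by apply/comp_sub/comp_mul => //; exact: comp_div.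
Qed.

Lemma cb_odd f : computable f -> cb (fun w v => odd (f w v)).
Proof.
by move=> Hf; apply: comp_ext (comp_mod Hf (comp_const 2)) => w v; rewrite modn2.
Qed.

Lemma comp_exp f k : computable f -> computable (fun w v => f w v ^ k).
Proof.
move=> Hf; elim: k => [|k IH]; first exact: comp_const.
by apply: comp_ext (comp_mul Hf IH) => w v; rewrite expnS.
Qed.

(** Nested conditionals over finitely many values: this is how the transition table of a fixed
    machine enters an expression. *)
Lemma comp_table (F : nat -> nat) g f : computable f ->
  computable (fun w v => if f w v < g then F (f w v) else 0).
Proof.
move=> Hf; elim: g => [|g IH]; first exact: comp_const.
apply: comp_ext (comp_if (cb_eq Hf (comp_const g)) (comp_const (F g)) IH) => w v.
by case: (eqVneq (f w v) g) => [->|N]; rewrite ?ltnSn // ltnS leq_eqVlt (negbTE N).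
Qed.

Lemma cb_table (F : nat -> bool) g f : computable f ->
  cb (fun w v => (f w v < g) && F (f w v)).
Proof.
by move=> Hf; apply: comp_ext (comp_table F g Hf) => w v; case: ltnP.
Qed.

(** The decider emits a string of length 1, whose head is the verdict. [comp_weak] makes room for
    the output index as variable 0. *)
Theorem cb_in_P (P : bfun) (V : language) : cb P ->
  (forall w, V w <-> P w (fun=> 0)) -> in_P V.
Proof.
move=> /comp_weak [eb Hb] HV.
have [M [c [k H]]] := emit_TM (ESucc EZero) eb.
exists M, c, k => w; have [H1 _ H2] := H w; split=> //.
by rewrite H2 /= Hb HV; case: (P _ _).
Qed.

(** * Binary digits of small numbers *)

(** The powers of two, recognised without exponentiation: no divisor above 1 is odd. *)
Definition ispow y := (0 < y) && all (fun d => (1 < d) && (d %| y) ==> (2 %| d)) (iota 0 y.+1).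

Lemma ispowP y : reflect (exists i, y = 2 ^ i) (ispow y).
Proof.
apply: (iffP andP) => [[y0 /allP H]|[i ->]].
  have: 2.-nat y.
    apply/pnatP=> // p pr_p Hp; rewrite inE /=.
    have := H p; rewrite mem_iota /= add0n ltnS dvdn_leq // Hp prime_gt1 //= => /(_ isT).
    by rewrite dvdn_prime2 // eq_sym.
  by case/p_natP => k ->; exists k.
split; first by rewrite expn_gt0.
apply/allP => d _; apply/implyP => /andP[d1 /(dvdn_pfactor _ _ (isT : prime 2))[j _ E]].
by rewrite E dvdn_exp //; case: j E d1 => [->|].
Qed.

(** The powers of two below [m] are those with exponent below [up_log 2 m], so counting them
    computes the logarithm. *)
Lemma sum_ispow m : \sum_(0 <= z < m) ispow z = up_log 2 m.
Proof.
elim: m => [|m IH]; first by rewrite big_geq.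
rewrite big_nat_recr //= IH; case: m {IH} => [//|m].
case: (ispowP m.+1) => [[i ->]|H].
  rewrite up_expnK // addn1; apply/esym/up_log_eq => //.
  by rewrite ltnSn expnS mul2n -addnn -addn1 leq_add2l expn_gt0.
rewrite addn0; case: m H => [|m] H; first by case: H; exists 0.
have /andP[H1 H2] := up_log_bounds (isT : 1 < 2) (isT : 1 < m.+2).
set e := up_log 2 m.+2 in H1 H2 *.
have He : 0 < e by rewrite up_log_gt0.
rewrite -(prednK He); apply/esym/up_log_eq => //; rewrite prednK // ltnW ?ltnS //=.
by rewrite ltn_neqAle H2 andbT; apply/eqP => E; apply: H; exists e.
Qed.

Definition tbit n i := odd (n %/ 2 ^ i).

Lemma nat_bits_rec n : 0 < n -> nat_bits n = odd n :: nat_bits n./2.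
Proof.
move=> Hn; rewrite /nat_bits.
have -> : N.of_nat n = N.of_nat (odd n + n./2.*2) by rewrite odd_double_half.
have: 0 < odd n + n./2.*2 by rewrite odd_double_half.
move: (odd n) (n./2) => b h.
case: b; last first.
  case: h => // h _; rewrite add0n -mul2n.
  have -> : N.of_nat (2 * h.+1) = N.double (N.of_nat h.+1) by lia.
  by case E: (N.of_nat h.+1) => [|p] //; lia.
move=> _; rewrite -mul2n.
have -> : N.of_nat (true + 2 * h) = N.succ_double (N.of_nat h) by lia.
by case: (N.of_nat h).
Qed.

Lemma nat_bitsE n : nat_bits n = mkseq (tbit n) (up_log 2 n.+1).
Proof.
elim/ltn_ind: n => -[|n] IH; first by [].
rewrite nat_bits_rec // up_log2S // mkseq_cons IH; last by rewrite -divn2 ltn_Pdiv.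
congr cons; first by rewrite /tbit divn1.
by apply: eq_mkseq => i; rewrite /tbit expnS divnMA divn2.
Qed.

Lemma cb_ispow f : computable f -> cb (fun w v => ispow (f w v)).
Proof.
move=> Hf; apply: (comp_app1 (F := fun _ y => ispow y)) Hf.
apply: cb_and; first exact: cb_lt (comp_const 0) (comp_var 0).
apply: (@cb_all (fun _ v => (v 0).+1)
  (fun _ v d => (1 < d) && (v 0 %% d == 0) ==> (d %% 2 == 0))).
  exact/comp_succ/comp_var.
apply: cb_impl.
  apply: cb_and; first exact: cb_lt (comp_const 1) (comp_var 0).
  exact: cb_eq (comp_mod (comp_var 1) (comp_var 0)) (comp_const 0).
exact: cb_eq (comp_mod (comp_var 0) (comp_const 2)) (comp_const 0).
Qed.

Lemma comp_up_log f : computable f -> computable (fun w v => up_log 2 (f w v)).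
Proof.
move=> Hf; apply: (@comp_ext (fun w v => \sum_(0 <= z < f w v) ispow z)) => [w v|].
  by rewrite sum_ispow.
by apply: (@comp_sum f (fun _ _ z => ispow z)) => //; apply: cb_ispow; apply: comp_var.
Qed.

(** [2 ^ i] may be too large to be a value, so it is searched for among the numbers up to [n]; when
    it is not there the digit is 0. *)
Lemma cb_tbit f g : computable f -> computable g -> cb (fun w v => tbit (f w v) (g w v)).
Proof.
move=> Hf Hg; apply: (comp_app2 (F := fun _ n i => tbit n i)) Hf Hg.
apply: (@cb_ext (fun _ v => has (fun y => ispow y && ((up_log 2 y == v 1) && odd (v 0 %/ y)))
  (iota 0 (v 0).+1))) => [w v|].
  move: (v 0) (v 1) => n i; rewrite /tbit; apply/idP/hasP.
    move=> H; exists (2 ^ i).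
      by rewrite mem_iota add0n /= ltnS leqNgt; apply/negP => /divn_small E; rewrite E in H.
    by rewrite up_expnK // eqxx H !andbT; apply/ispowP; exists i.
  by case=> y _ /and3P[/ispowP[j ->]]; rewrite up_expnK // => /eqP ->.
apply: (@cb_has _ (fun _ v y => ispow y && ((up_log 2 y == v 1) && odd (v 0 %/ y)))).
  exact/comp_succ/comp_var.
apply: cb_and; first exact/cb_ispow/comp_var.
apply: cb_and; first exact: cb_eq (comp_up_log (comp_var 0)) (comp_var 2).
exact: cb_odd (comp_div (comp_var 1) (comp_var 0)).
Qed.

(** * Computable bit strings *)

Definition sfun := seq bool -> (nat -> nat) -> seq bool.
Definition bseqfun := seq bool -> (nat -> nat) -> nat -> bool.

Definition sc (s : sfun) := exists (l : nfun) (b : bseqfun),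
  [/\ computable l, cb (fun w v => b w (fun j => v j.+1) (v 0)) &
      forall w v, s w v = mkseq (b w v) (l w v)].

Lemma cb_scons (b : bseqfun) a r : cb (fun w v => b w (fun j => v j.+1) (v 0)) ->
  computable a -> cb (fun w v => b w (fun j => v (r j)) (a w v)).
Proof. by move=> Hb Ha; have := comp_scons r Hb Ha. Qed.

Lemma sc_ext (t s : sfun) : (forall w v, s w v = t w v) -> sc t -> sc s.
Proof. by move=> E [l [b [H1 H2 H3]]]; exists l, b; split=> // w v; rewrite E. Qed.

Lemma sc_mkseq l (b : bseqfun) : computable l -> cb (fun w v => b w (fun j => v j.+1) (v 0)) ->
  sc (fun w v => mkseq (b w v) (l w v)).
Proof. by move=> Hl Hb; exists l, b. Qed.

Lemma sc_bit P : cb P -> sc (fun w v => [:: P w v]).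
Proof.
move=> HP; exists (fun _ _ => 1), (fun w v _ => P w v); split=> //.
  exact: comp_const.
exact: comp_weak HP.
Qed.

Lemma mkseqD T (f : nat -> T) a b : mkseq f (a + b) = mkseq f a ++ mkseq (fun i => f (a + i)) b.
Proof. by rewrite /mkseq iotaD map_cat add0n -[a in iota a b]addn0 iotaDl -map_comp. Qed.

Lemma eq_mkseq_in T (f g : nat -> T) n : (forall i, i < n -> f i = g i) -> mkseq f n = mkseq g n.
Proof.
by move=> H; elim: n H => // n IH H; rewrite !mkseqS IH => [|i Hi]; rewrite H //; lia.
Qed.

Lemma sc_cat s t : sc s -> sc t -> sc (fun w v => s w v ++ t w v).
Proof.
move=> [l1 [b1 [H1 H2 H3]]] [l2 [b2 [H4 H5 H6]]].
exists (fun w v => l1 w v + l2 w v), (fun w v i => if i < l1 w v then b1 w v i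
  else b2 w v (i - l1 w v)); split.
- exact: comp_add.
- apply: cb_if => //; first exact: cb_lt (comp_var 0) (comp_weak H1).
  exact: (cb_scons succn H5 (comp_sub (comp_var 0) (comp_weak H1))).
- move=> w v; rewrite H3 H6 mkseqD; congr cat; apply: eq_mkseq_in => i Hi.
    by rewrite Hi.
  by rewrite ifF ?addKn //; lia.
Qed.

Lemma sc_if c s t : cb c -> sc s -> sc t -> sc (fun w v => if c w v then s w v else t w v).
Proof.
move=> Hc [l1 [b1 [H1 H2 H3]]] [l2 [b2 [H4 H5 H6]]].
exists (fun w v => if c w v then l1 w v else l2 w v),
  (fun w v i => if c w v then b1 w v i else b2 w v i); split.
- exact: comp_if.
- by apply: cb_if => //; apply: comp_weak Hc.
- by move=> w v; case: ifP => _; rewrite ?H3 ?H6.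
Qed.

(** A position [i] belongs to the block [k] with [S k <= i < S k.+1], at offset [i - S k]. Finding
    the block by bounded search keeps the bit computable. *)
Lemma flatten_mkseq (b : nat -> nat -> bool) (l : nat -> nat) n :
  let S k := \sum_(0 <= j < k) l j in
  flatten (mkseq (fun k => mkseq (b k) (l k)) n) =
  mkseq (fun i => has (fun k => (S k <= i) && ((i < S k.+1) && b k (i - S k))) (iota 0 n)) (S n).
Proof.
move=> S; elim: n => [|n IH]; first by rewrite /S big_geq.
have HS k : S k.+1 = S k + l k by rewrite /S big_nat_recr.
have Sm i j : i <= j -> S i <= S j.
  by move=> H; rewrite -(subnK H) addnC; elim: (j - i) => [|k]; rewrite ?addn0 // addnS HS; lia.
rewrite mkseqS flatten_rcons IH HS mkseqD; congr cat; apply: eq_mkseq_in => i Hi.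
  by rewrite -[n.+1]addn1 iotaD has_cat /= add0n leqNgt Hi /= !orbF.
rewrite -[n.+1]addn1 iotaD has_cat /= add0n leq_addr HS ltn_add2l Hi addKn orbF /=.
rewrite (_ : has _ _ = false) //; apply/hasP => -[k]; rewrite mem_iota /= add0n => Hk.
by case/and3P=> _ H _; have := Sm _ _ Hk; lia.
Qed.

Lemma sc_flatten n (B : seq bool -> (nat -> nat) -> nat -> seq bool) : computable n ->
  sc (fun w v => B w (fun j => v j.+1) (v 0)) -> sc (fun w v => flatten (mkseq (B w v) (n w v))).
Proof.
move=> Hn [l [b [Hl Hb E]]].
have EB w v k : B w v k = mkseq (b w (scons k v)) (l w (scons k v)) by rewrite -(E w (scons k v)).
have HS f r : computable f ->
    computable (fun w v => \sum_(0 <= j < f w v) l w (scons j (fun i => v (r i)))).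
  move=> Hf; apply: (@comp_sum f (fun w v j => l w (scons j (fun i => v (r i))))) => //.
  exact: (comp_scons (fun i => (r i).+1) Hl (comp_var 0)).
pose P w v i k := let S k := \sum_(0 <= j < k) l w (scons j v) in
  (S k <= i) && ((i < S k.+1) && b w (scons k v) (i - S k)).
exists (fun w v => \sum_(0 <= j < n w v) l w (scons j v)),
  (fun w v i => has (P w v i) (iota 0 (n w v))); split.
- exact: (HS n id).
- apply: (@cb_has (fun w v => n w (fun j => v j.+1))
    (fun w v k => P w (fun j => v j.+1) (v 0) k)); first exact: comp_weak.
  have H0 := HS _ (fun i => i.+2) (comp_var 0).
  apply: cb_and; first exact: cb_le H0 (comp_var 1).
  apply: cb_and; first exact: cb_lt (comp_var 1) (HS _ (fun i => i.+2) (comp_succ (comp_var 0))).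
  have H1 := comp_sub (comp_var 1) H0.
  pose g : nfun := fun w v => b w (fun j => v j.+1) (v 0).
  pose th i : nfun := match i with
    | 0 => fun w v => v 1 - \sum_(0 <= j < v 0) l w (scons j (fun i => v i.+2))
    | 1 => fun _ v => v 0 | i.+2 => fun _ v => v i.+2 end.
  have [e He] : computable g := Hb.
  apply: (@comp_ext (fun w v => g w (fun i => th i w v))) => [w v|].
    transitivity (g w (scons (v 1 - \sum_(0 <= j < v 0) l w (scons j (fun i => v i.+2)))
      (scons (v 0) (fun j => v j.+2)))); first by [].
    by rewrite -!He; apply: eval_ext => -[|[|i]].
  by apply: comp_subst => // -[|[|i]] //; exact: comp_var.
- move=> w v; transitivity (flatten (mkseq (fun k => mkseq (b w (scons k v)) (l w (scons k v)))
    (n w v))); last exact: flatten_mkseq.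
  by congr flatten; apply: eq_mkseq => k; exact: EB.
Qed.

Lemma sc_self_delim s : sc s -> sc (fun w v => self_delim (s w v)).
Proof.
move=> [l [b [Hl Hb E]]]; rewrite /self_delim.
apply: sc_cat; last first.
  apply: (@sc_cat (fun _ _ => [:: false]) (fun _ _ => [:: false]));
  exact/sc_bit/cb_const.
apply: (@sc_ext (fun w v => flatten (mkseq (fun i => [:: true] ++ [:: b w v i]) (l w v)))) => [w v|].
  by rewrite E /mkseq -map_comp.
apply: (@sc_flatten l (fun w v i => [:: true] ++ [:: b w v i])) => //.
apply: (@sc_cat (fun _ _ => [:: true])); first exact/sc_bit/cb_const.
exact: sc_bit.
Qed.

Lemma sc_enc_nat f : computable f -> sc (fun w v => enc_nat (f w v)).
Proof.
move=> Hf; apply: sc_self_delim.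
apply: (@sc_ext (fun w v => mkseq (tbit (f w v)) (up_log 2 (f w v).+1))) => [w v|].
  by rewrite nat_bitsE.
apply: (@sc_mkseq _ (fun w v => tbit (f w v))); first exact/comp_up_log/comp_succ.
exact: cb_tbit (comp_weak Hf) (comp_var 0).
Qed.

Lemma cb_eqseq s t : sc s -> sc t -> cb (fun w v => s w v == t w v).
Proof.
move=> [l1 [b1 [H1 H2 H3]]] [l2 [b2 [H4 H5 H6]]].
apply: (@cb_ext (fun w v => (l1 w v == l2 w v) &&
  all (fun i => b1 w v i == b2 w v i) (iota 0 (l1 w v)))) => [w v|].
  rewrite H3 H6; apply/eqP/andP => [E|[/eqP E /allP H]].
    have El : l1 w v = l2 w v by rewrite -(size_mkseq (b1 w v) (l1 w v)) E size_mkseq.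
    split; first exact/eqP.
    apply/allP => i; rewrite mem_iota add0n /= => Hi; apply/eqP.
    by rewrite -(nth_mkseq false (b1 w v) Hi) E nth_mkseq // -El.
  rewrite -E; apply: eq_mkseq_in => i Hi; apply/eqP/H; rewrite mem_iota add0n //.
apply: cb_and; first exact: cb_eq.
by apply: (@cb_all l1 (fun w v i => b1 w v i == b2 w v i)) => //; apply: cb_eqb.
Qed.

Theorem sc_poly_time f : sc (fun w _ => f w) -> poly_time_computable f.
Proof.
move=> [l [b [[el Hl] [eb Hb] E]]].
have [M [c [k H]]] := emit_TM el eb; exists M, c, k => w.
have [H1 H2 _] := H w; split=> //; rewrite H2 (E w (fun=> 0)) Hl.
by apply: eq_mkseq => i; rewrite Hb lt0b.
Qed.

Definition mkinst K R (D : nat -> nat -> bool) (d : nat -> nat) t : urllc_instance :=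
  {| nK := K; nR := R; delta := fun k r => D k r; dem := fun k => d k; thr := t |}.

Lemma map_enum_ord T (f : nat -> T) n : [seq f k | k : 'I_n <- enum 'I_n] = mkseq f n.
Proof. by rewrite (map_comp f val) val_enum_ord. Qed.

Lemma enc_instanceE K R D d t : enc_instance (mkinst K R D d t) =
  enc_nat K ++ enc_nat R ++ flatten (mkseq (fun k => mkseq (D k) R) K) ++
  flatten (mkseq (fun k => enc_nat (d k)) K) ++ enc_int t.
Proof.
rewrite /enc_instance /=; congr (_ ++ _ ++ _ ++ _ ++ _).
  rewrite -map_enum_ord; congr flatten; apply: eq_map => k; exact: map_enum_ord.
by rewrite -map_enum_ord.
Qed.

(** * Membership in NP *)

Definition bval (f : nat -> bool) n := \sum_(0 <= i < n) f i * 2 ^ i.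
(** The position after the highest set bit, or 0: the length of the binary notation of [bval f n],
    obtained without that possibly exponential value. *)
Definition blen (f : nat -> bool) n :=
  \sum_(0 <= i < n) has (fun j => (i <= j) && f j) (iota 0 n).

Lemma bvalS f n : bval f n.+1 = f 0 + 2 * bval (fun i => f i.+1) n.
Proof.
rewrite /bval big_nat_recl // expn0 muln1 big_distrr /=; congr addn.
by apply: eq_bigr => i _; rewrite expnS mulnCA.
Qed.

Lemma blenS f n : blen f n.+1 =
  has f (iota 0 n.+1) + blen (fun i => f i.+1) n.
Proof.
rewrite /blen big_nat_recl //; congr addn.
by apply: eq_bigr => i _; rewrite /= (iotaDl 1 0) has_map.
Qed.

Lemma blen_gt0 f n : (0 < blen f n) = has f (iota 0 n).
Proof.
case: n => [|n]; first by rewrite /blen big_geq.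
rewrite blenS; case Hh: (has f _) => //=; rewrite add0n.
rewrite lt0n sum_nat_seq_eq0; apply/negbTE; rewrite negbK.
apply/allP => i _ /=; rewrite eqb0; apply: contraFN Hh => /hasP[j].
rewrite mem_iota add0n /= => Hj /andP[_ fj]; apply/orP; right.
by apply/hasP; exists j.+1 => //; rewrite mem_iota; lia.
Qed.

Lemma has_iotaS (f : nat -> bool) n :
  has f (iota 0 n.+1) = f 0 || has (fun i => f i.+1) (iota 0 n).
Proof. by rewrite /= (iotaDl 1 0) has_map. Qed.

Lemma bval_gt0 f n : (0 < bval f n) = has f (iota 0 n).
Proof.
elim: n f => [|n IH] f; first by rewrite /bval big_geq.
by rewrite bvalS has_iotaS -IH addn_gt0 lt0b muln_gt0.
Qed.

Lemma nat_bits_bval f n : nat_bits (bval f n) = mkseq f (blen f n).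
Proof.
elim: n f => [|n IH] f; first by rewrite /bval /blen !big_geq.
case: (posnP (bval f n.+1)) => [E|H].
  have := bval_gt0 f n.+1; have := blen_gt0 f n.+1; rewrite E /= => <-.
  by case: (blen _ _).
rewrite nat_bits_rec // blenS -bval_gt0 H add1n mkseq_cons -IH bvalS.
rewrite mul2n half_bit_double; congr cons.
by rewrite oddD odd_double addbF; case: (f 0).
Qed.

Lemma tbit_bval f n i : i < n -> tbit (bval f n) i = f i.
Proof.
elim: n f i => // n IH f [|i] Hi; rewrite bvalS /tbit mul2n.
  by rewrite divn1 oddD odd_double addbF; case: (f 0).
by rewrite expnS divnMA divn2 half_bit_double; apply: (IH (fun i => f i.+1)).
Qed.

Lemma tbitS t i : tbit t i.+1 = tbit t./2 i.
Proof. by rewrite /tbit expnS divnMA divn2. Qed.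

Lemma bval_tbit_le t n : bval (tbit t) n <= t.
Proof.
elim: n t => [|n IH] t; first by rewrite /bval big_geq.
rewrite bvalS (_ : bval _ _ = bval (tbit t./2) n); last first.
  by apply: eq_bigr => i _; rewrite tbitS.
have := IH t./2; have := odd_double_half t; rewrite /tbit divn1; lia.
Qed.

Lemma bval_tbit t n : t < 2 ^ n -> bval (tbit t) n = t.
Proof.
elim: n t => [|n IH] t Ht.
  by rewrite /bval big_geq //; move: Ht; rewrite expn0; lia.
rewrite bvalS (_ : bval _ _ = bval (tbit t./2) n); last first.
  by apply: eq_bigr => i _; rewrite tbitS.
rewrite IH; first by have := odd_double_half t; rewrite /tbit divn1; lia.
by move: Ht; rewrite expnS; have := odd_double_half t; lia.
Qed.

Lemma eq_bval f g n : (forall i, i < n -> f i = g i) -> bval f n = bval g n.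
Proof.
by move=> H; rewrite /bval !big_nat; apply: eq_bigr => i Hi; rewrite H.
Qed.

(** Compares a possibly exponential number with a small [s], by looking for a [t] up to [s] with the
    same digits. *)
Definition leqbig n (f : nat -> bool) s :=
  has (fun t => all (fun i => f i == tbit t i) (iota 0 n)) (iota 0 s.+1).

Lemma leqbigE n f s : leqbig n f s = (bval f n <= s).
Proof.
apply/hasP/idP => [[t] Ht /allP H|H].
  have -> : bval f n = bval (tbit t) n.
    by apply: eq_bval => i Hi; apply/eqP/H; rewrite mem_iota add0n.
  by apply: leq_trans (bval_tbit_le t n) _; move: Ht; rewrite mem_iota add0n ltnS.
exists (bval f n); first by rewrite mem_iota add0n ltnS.
by apply/allP => i; rewrite mem_iota add0n => /= Hi; rewrite tbit_bval.
Qed.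

(* The certificate of a word of length [n] is read as seven n x n arrays: 0 and 1
   hold the numbers of users and blocks in unary (the latter in binary when there are
   no users), 2 and 3 the absolute value and the sign of the threshold, 4 the matrix
   delta, 5 the schedule, and 6 the demands in binary. *)
Section Check.
Variables (n : nat) (A : nat -> nat -> nat -> bool).

Definition cK := \sum_(0 <= j < n) A 0 0 j.
Definition cR1 := \sum_(0 <= j < n) A 1 0 j.
Definition cR := if cK == 0 then bval (A 1 0) n else cR1.
Definition cthr : int :=
  if A 3 0 0 then (bval (A 2 0) n)%:Z%R else (- (bval (A 2 0) n)%:Z)%R.
Definition cinst := mkinst cK cR (A 4) (fun k => bval (A 6 k) n) cthr.

(** The encoding of [cinst] written from bit arrays and small counts only. With no users the matrix
    is empty, so the number of blocks can be exponential and its digits are copied. *)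
Definition cenc : seq bool :=
  enc_nat cK ++
  (if cK == 0 then self_delim (mkseq (A 1 0) (blen (A 1 0) n)) else enc_nat cR1) ++
  flatten (mkseq (fun k => mkseq (A 4 k) cR1) cK) ++
  flatten (mkseq (fun k => self_delim (mkseq (A 6 k) (blen (A 6 k) n))) cK) ++
  A 3 0 0 :: self_delim (mkseq (A 2 0) (blen (A 2 0) n)).

Definition csum k := \sum_(0 <= r < cR1) A 5 k r.
Definition ccount := \sum_(0 <= k < cK) leqbig n (A 6 k) (csum k).

(** In order: the encoding is [w], demands are positive, a negative threshold is not zero, no block
    is shared, only active blocks are used, and a nonnegative threshold is reached. *)
Definition check (w : seq bool) : bool :=
  (w == cenc) &&
  (all (fun k => has (A 6 k) (iota 0 n)) (iota 0 cK) &&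
  ((A 3 0 0 || has (A 2 0) (iota 0 n)) &&
  (all (fun r => all (fun k => all (fun l => A 5 k r && A 5 l r ==> (k == l))
     (iota 0 cK)) (iota 0 cK)) (iota 0 cR1) &&
  (all (fun k => all (fun r => A 5 k r ==> A 4 k r) (iota 0 cR1)) (iota 0 cK) &&
  (A 3 0 0 ==> leqbig n (A 2 0) ccount))))).

Lemma cencE : A 3 0 0 || has (A 2 0) (iota 0 n) -> cenc = enc_instance cinst.
Proof.
move=> Hs; rewrite enc_instanceE /cenc; congr (_ ++ _).
rewrite -nat_bits_bval -/(enc_nat _) /cR.
have E : A 3 0 0 :: enc_nat (bval (A 2 0) n) = enc_int cthr.
  rewrite /cthr; case: (A 3 0 0) Hs => //=; rewrite -bval_gt0.
  by case: (bval _ _) => // m _; rewrite -NegzE.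
rewrite -nat_bits_bval -/(enc_nat _) E.
have -> : mkseq (fun k => self_delim (mkseq (A 6 k) (blen (A 6 k) n))) cK =
          mkseq (fun k => enc_nat (bval (A 6 k) n)) cK.
  by apply: eq_mkseq => k; rewrite -nat_bits_bval.
by case: (cK =P 0) => [->|_].
Qed.

Lemma sum_bool_le1 m (x : nat -> bool) :
  (forall k l, k < m -> l < m -> x k -> x l -> k = l) -> \sum_(0 <= k < m) x k <= 1.
Proof.
elim: m => [|m IH] H; first by rewrite big_geq.
rewrite big_nat_recr //=; case Hx: (x m) => /=; last first.
  by rewrite addn0; apply: IH => k l Hk Hl; apply: H; lia.
rewrite big_nat big1 // => k /andP[_ Hk]; case Hk': (x k) => //.
by have := H k m (ltnW Hk) (ltnSn m) Hk' Hx; lia.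
Qed.

Lemma check_sound w : check w -> Q2_language w.
Proof.
case/and5P => /eqP -> H1 H2 H3 /andP[H4 H5].
rewrite cencE //; exists cinst; split=> //.
  move=> k /=; rewrite bval_gt0; apply: (allP H1); by rewrite mem_iota add0n /=.
have ER : 0 < cK -> cR = cR1 by rewrite /cR; case: eqP => //; lia.
exists [set k : 'I_cK | leqbig n (A 6 k) (csum k)], (fun k r => A 5 k r); split=> /=.
- rewrite -sum1dep_card; set S := \sum_(_ | _) _.
  have -> : S = ccount by rewrite /ccount big_mkord /S big_mkcond.
  move: H5; rewrite /cthr; case: (A 3 0 0) => /=; first by rewrite leqbigE.
  by move=> _; lia.
- move=> r; rewrite -(big_mkord xpredT (fun k => A 5 k r : nat)); apply: sum_bool_le1 => k l Hk Hl Xk Xl.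
  have Hr : r < cR1 by rewrite -ER ?(leq_ltn_trans _ Hk) //.
  have := allP H3 r; rewrite mem_iota add0n => /(_ Hr) /allP /(_ k).
  rewrite mem_iota add0n => /(_ Hk) /allP /(_ l).
  by rewrite mem_iota add0n Xk Xl => /(_ Hl) /eqP.
- move=> k r; have := allP H4 k; rewrite mem_iota add0n => /(_ (ltn_ord k)) /allP /(_ r).
  rewrite mem_iota add0n -ER ?(leq_ltn_trans _ (ltn_ord k)) // => /(_ (ltn_ord r)).
  by case: (A 5 k r) => // /= ->.
- move=> k; rewrite inE leqbigE => H; apply: leq_trans H _.
  by rewrite /csum -ER ?(leq_ltn_trans _ (ltn_ord k)) // big_mkord.
Qed.

End Check.

(** * Existence of certificates *)

Lemma size_self_delim s : size (self_delim s) = 2 * size s + 2.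
Proof.
by rewrite /self_delim size_cat; elim: s => //= b s IH; lia.
Qed.

Lemma size_enc_nat m : size (enc_nat m) = 2 * up_log 2 m.+1 + 2.
Proof. by rewrite size_self_delim nat_bitsE size_mkseq. Qed.

Lemma enc_nat_lt m n : size (enc_nat m) <= n -> m < 2 ^ n.
Proof.
rewrite size_enc_nat => H; apply: leq_trans (up_logP m.+1 (isT : 1 < 2)) _.
by rewrite leq_exp2l //; lia.
Qed.

(** Extending functions on ordinals to all naturals turns every instance into a [mkinst]. *)
Lemma ord_fun1 T (x0 : T) n (f : 'I_n -> T) : exists g : nat -> T, f = fun k => g k.
Proof.
exists (fun k => if insub k is Some k' then f k' else x0).
by apply: functional_extensionality => k; rewrite valK.
Qed.

Lemma ord_fun2 T (x0 : T) m n (f : 'I_m -> 'I_n -> T) :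
  exists g : nat -> nat -> T, f = fun k r => g k r.
Proof.
have [g Hg] := ord_fun1 (fun=> x0) f.
have [h Hh] := ord_fun1 (fun=> x0) (fun (r : 'I_n) (k : nat) => g k r).
exists (fun k r => h r k); rewrite Hg; apply: functional_extensionality => k.
apply: functional_extensionality => r.
by have := congr1 (fun F => F r (val k)) Hh.
Qed.

Lemma sum_ltn n m : m <= n -> \sum_(0 <= j < n) (j < m) = m.
Proof.
move=> H; have E k : \sum_(0 <= j < k) (j < m) = minn k m.
  elim: k => [|k IH]; first by rewrite big_geq ?min0n.
  by rewrite big_nat_recr //= IH; case: ltnP => /=; lia.
by rewrite E; apply/minn_idPr.
Qed.

Definition arr n (y : nat -> bool) a i j := y ((a * n + i) * n + j).

Lemma check_complete w : Q2_language w -> exists y : seq bool,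
  size y = 7 * size w * size w /\ check (size w) (arr (size w) (nth false y)) w.
Proof.
case=> -[K R del dm t] [Hv Ew [Ms [x /= [Hm Hc Hd Hs]]]].
have [D ED] := ord_fun2 false del; have [d Ed] := ord_fun1 0 dm; have [X EX] := ord_fun2 false x.
subst del dm x; move: Ew; rewrite -/(mkinst K R D d t) enc_instanceE => Ew.
set n := size w.
have Hsz : size (enc_nat K) + (size (enc_nat R) +
    (size (flatten (mkseq (fun k => mkseq (D k) R) K)) +
    (size (flatten (mkseq (fun k => enc_nat (d k)) K)) + size (enc_int t)))) = n.
  by rewrite /n -Ew !size_cat.
(* Each demand occupies at least its two delimiter bits and the matrix occupies [K * R] bits, so
   [K], and [R] as soon as there is a user, fit in unary in an array of width [n]. The remaining
   numbers are below [2 ^ n] because their codes lie within the word. *)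
have HK2 : size (flatten (mkseq (fun k => enc_nat (d k)) K)) >= 2 * K.
  elim: (K) => // k IH; rewrite mkseqS flatten_rcons size_cat.
  by have := size_enc_nat (d k); lia.
have HKR : size (flatten (mkseq (fun k => mkseq (D k) R) K)) = K * R.
  elim: (K) => // k IH; rewrite mkseqS flatten_rcons size_cat IH size_mkseq mulSn addnC //.
have HKn : K <= n by lia.
have HRn : 0 < K -> R <= n.
  by move=> H; have: K * R <= n by [lia]; nia.
have HRlt : R < 2 ^ n by apply: enc_nat_lt; lia.
have Hdlt k : k < K -> d k < 2 ^ n.
  move=> Hk; apply: enc_nat_lt; apply: (@leq_trans (size (flatten (mkseq (fun k => enc_nat (d k)) K)))); last by lia.
  elim: (K) Hk => // k' IH; rewrite ltnS leq_eqVlt mkseqS flatten_rcons size_cat.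
  by case/orP => [/eqP ->|/IH]; lia.
have Htlt : `|t| < 2 ^ n.
  have: size (enc_nat `|t|) <= n by case: (t) Hsz => m /=; lia.
  exact: enc_nat_lt.
have Hn0 : 0 < n by have := size_enc_nat K; lia.
pose cont a i j : bool := match a with
  | 0 => j < K | 1 => if K == 0 then tbit R j else j < R | 2 => tbit `|t| j
  | 3 => (0 <= t)%R | 4 => D i j | 5 => X i j | _ => tbit (d i) j end.
pose y := mkseq (fun p => cont (p %/ n %/ n) (p %/ n %% n) (p %% n)) (7 * n * n).
exists y; rewrite size_mkseq; split=> //.
have EA a i j : a < 7 -> i < n -> j < n -> arr n (nth false y) a i j = cont a i j.
  move=> Ha Hi Hj; rewrite /arr nth_mkseq; last by nia.
  rewrite divnMDl // (divn_small Hj) addn0 divnMDl // (divn_small Hi) addn0.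
  by rewrite !modnMDl (modn_small Hi) (modn_small Hj).
set A := arr n (nth false y) in EA *.
have EK : cK n A = K.
  rewrite -[RHS](sum_ltn HKn) /cK !big_nat; apply: eq_bigr => j Hj.
  by rewrite EA //; lia.
have EB f g : (forall j, j < n -> A f g j = cont f g j) -> bval (A f g) n = bval (cont f g) n.
  exact: eq_bval.
have ER1 : 0 < K -> cR1 n A = R.
  move=> H; rewrite -[RHS](sum_ltn (HRn H)) /cR1 !big_nat; apply: eq_bigr => j Hj.
  have Hj' : j < n by lia.
  by rewrite EA //=; case: eqP H => // ->.
have ER : cR n A = R.
  rewrite /cR EK; case: eqP => [E|N]; last by rewrite ER1 //; lia.
  rewrite (eq_bval (g := tbit R)) ?bval_tbit // => j Hj.
  by rewrite EA //= E.
have ET2 : bval (A 2 0) n = `|t|.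
  by rewrite (eq_bval (g := tbit `|t|)) ?bval_tbit // => j Hj; rewrite EA.
have E3 : A 3 0 0 = (0 <= t)%R by rewrite EA.
have ET : cthr n A = t.
  by rewrite /cthr E3 ET2; case: ifP; lia.
have E6 k : k < K -> bval (A 6 k) n = d k.
  move=> Hk; rewrite (eq_bval (g := tbit (d k))) ?bval_tbit ?Hdlt // => j Hj.
  by rewrite EA //; lia.
have E4 k r : k < K -> r < R -> A 4 k r = D k r.
  move=> Hk Hr; have := HRn (leq_ltn_trans (leq0n _) Hk) => H; rewrite EA //; lia.
have E5 k r : k < K -> r < R -> A 5 k r = X k r.
  move=> Hk Hr; have := HRn (leq_ltn_trans (leq0n _) Hk) => H; rewrite EA //; lia.
have Hsgn : A 3 0 0 || has (A 2 0) (iota 0 n).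
  by rewrite E3 -bval_gt0 ET2; lia.
apply/and5P; split.
- rewrite cencE // enc_instanceE EK ER ET -Ew; apply/eqP.
  congr (_ ++ _ ++ flatten _ ++ flatten _ ++ _).
    by apply: eq_mkseq_in => k Hk; apply: eq_mkseq_in => r Hr; rewrite E4.
  by apply: eq_mkseq_in => k Hk; rewrite E6.
- apply/allP => k; rewrite mem_iota add0n EK => /= Hk.
  by rewrite -bval_gt0 E6 //; have := Hv (Ordinal Hk).
- exact: Hsgn.
- apply/allP => r; rewrite mem_iota add0n => /= Hr.
  apply/allP => k; rewrite mem_iota add0n EK => /= Hk.
  apply/allP => l; rewrite mem_iota add0n => /= Hl.
  rewrite ER1 in Hr; last by lia.
  rewrite !E5 //; apply/implyP => /andP[Xk Xl]; apply/negPn/negP => N.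
  have := Hc (Ordinal Hr); rewrite (bigD1 (Ordinal Hk)) //= (bigD1 (Ordinal Hl)) /=; last first.
    by rewrite -val_eqE /= eq_sym.
  by rewrite Xk Xl.
apply/andP; split.
- apply/allP => k; rewrite mem_iota add0n EK => /= Hk.
  apply/allP => r; rewrite mem_iota add0n => /= Hr; rewrite ER1 in Hr; last by lia.
  by rewrite E4 // E5 //; have := Hd (Ordinal Hk) (Ordinal Hr); case: (X k r) => //=; case: (D k r).
- apply/implyP => Ht; rewrite E3 in Ht; rewrite leqbigE ET2.
  have H : #|Ms| <= ccount n A.
    rewrite /ccount EK big_mkord -sum1_card big_mkcond /=; apply: leq_sum => k _.
    case: ifP => // Hk; rewrite leqbigE E6 //.
    have H := Hs k Hk; have HK0 : 0 < K by apply: leq_ltn_trans (ltn_ord k).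
    rewrite lt0b /csum ER1 // big_mkord; apply: leq_trans H _.
    by apply: leq_sum => r _; rewrite E5.
  by apply: leq_trans H; move: Hm Ht; move: #|Ms| => m; lia.
Qed.

(** * The verifier: decoding the pair and computability of the check *)

(** The number of leading pairs whose marker bit is true, which on a paired input is the length of
    the word. *)
Definition wlen (z : seq bool) :=
  \sum_(0 <= j < size z) all (fun i => inp z (2 * i) == Some true) (iota 0 j.+1).
Definition wpart z := mkseq (fun j => inp z (2 * j + 1) == Some true) (wlen z).
Definition ypart z i := inp z (2 * wlen z + 2 + i) == Some true.

Lemma inp_self_delim w t i : i < size w ->
  inp (self_delim w ++ t) (2 * i) = Some true /\
  inp (self_delim w ++ t) (2 * i + 1) = Some (nth false w i).
Proof.
elim: w i => // b w IH [|i] Hi; first by [].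
have -> : 2 * i.+1 = (2 * i).+2 by lia.
exact: (IH i Hi).
Qed.

Lemma inp_pair w y i : inp (pair_enc w y) (2 * size w + 2 + i) = inp y i.
Proof.
by rewrite /inp /pair_enc map_cat nth_cat size_map size_self_delim ltnNge leq_addr addKn.
Qed.

Lemma inp_pair_end w y : inp (pair_enc w y) (2 * size w) = Some false.
Proof.
elim: w => // b w IH; have -> : 2 * size (b :: w) = (2 * size w).+2 by move=> /=; lia.
exact: IH.
Qed.

Lemma wlen_pair w y : wlen (pair_enc w y) = size w.
Proof.
have Hs : size w <= size (pair_enc w y).
  by rewrite size_cat size_self_delim; lia.
rewrite -[RHS](sum_ltn Hs) /wlen; apply: eq_bigr => j _; congr nat_of_bool.
apply/allP/idP => [H|Hj i].
  rewrite ltnNge; apply/negP => Hw; have := H (size w).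
  by rewrite mem_iota add0n ltnS Hw inp_pair_end => /(_ isT).
rewrite mem_iota add0n ltnS => Hi; apply/eqP.
by have [] := @inp_self_delim w y i (leq_ltn_trans Hi Hj).
Qed.

Lemma wpart_pair w y : wpart (pair_enc w y) = w.
Proof.
rewrite /wpart wlen_pair -[RHS](mkseq_nth false); apply: eq_mkseq_in => i Hi.
by have [_ ->] := inp_self_delim y Hi; case: (nth _ _ _).
Qed.

Lemma ypart_pair w y : ypart (pair_enc w y) =1 nth false y.
Proof.
move=> i; rewrite /ypart wlen_pair inp_pair /inp.
case: (ltnP i (size y)) => Hi; first by rewrite (nth_map false) //; case: nth.
by rewrite !nth_default ?size_map.
Qed.

Definition verify z := check (wlen z) (arr (wlen z) (ypart z)) (wpart z).

Lemma comp_wlen : computable (fun z _ => wlen z).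
Proof.
apply: (@comp_sum (fun z _ => size z)
  (fun z _ j => all (fun i => inp z (2 * i) == Some true) (iota 0 j.+1))); first exact: comp_size.
apply: (@cb_all (fun _ v => (v 0).+1) (fun z _ i => inp z (2 * i) == Some true)).
  exact/comp_succ/comp_var.
exact: cb_inp (comp_mul (comp_const 2) (comp_var 0)).
Qed.

Definition vA z := arr (wlen z) (ypart z).

Lemma cb_vA a i j : computable a -> computable i -> computable j ->
  cb (fun z v => vA z (a z v) (i z v) (j z v)).
Proof.
move=> Ha Hi Hj; have Hn := comp_wlen; apply: cb_inp; apply: comp_add.
  by apply: comp_add (comp_const 2); apply: comp_mul (comp_const 2) _.
by apply: comp_add => //; apply: comp_mul => //; apply: comp_add => //; apply: comp_mul.
Qed.

Lemma comp_cK : computable (fun z _ => cK (wlen z) (vA z)).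
Proof.
apply: (@comp_sum (fun z _ => wlen z) (fun z _ j => vA z 0 0 j)); first exact: comp_wlen.
exact: cb_vA (comp_const 0) (comp_const 0) (comp_var 0).
Qed.

Lemma comp_cR1 : computable (fun z _ => cR1 (wlen z) (vA z)).
Proof.
apply: (@comp_sum (fun z _ => wlen z) (fun z _ j => vA z 1 0 j)); first exact: comp_wlen.
exact: cb_vA (comp_const 1) (comp_const 0) (comp_var 0).
Qed.

Lemma comp_blen a i : computable a -> computable i ->
  computable (fun z v => blen (vA z (a z v) (i z v)) (wlen z)).
Proof.
move=> Ha Hi; apply: (@comp_sum (fun z _ => wlen z) (fun z v k =>
  has (fun j => (k <= j) && vA z (a z v) (i z v) j) (iota 0 (wlen z)))); first exact: comp_wlen.
apply: (@cb_has (fun z _ => wlen z) (fun z v j => (v 0 <= j) &&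
   vA z (a z (fun x => v x.+1)) (i z (fun x => v x.+1)) j)); first exact: comp_wlen.
apply: cb_and; first exact: cb_le (comp_var 1) (comp_var 0).
exact: cb_vA (comp_ren (fun x => x.+2) Ha) (comp_ren (fun x => x.+2) Hi) (comp_var 0).
Qed.

Lemma sc_big a i : computable a -> computable i ->
  sc (fun z v => self_delim (mkseq (vA z (a z v) (i z v)) (blen (vA z (a z v) (i z v)) (wlen z)))).
Proof.
move=> Ha Hi; apply: sc_self_delim.
apply: (@sc_mkseq _ (fun z v => vA z (a z v) (i z v))); first exact: comp_blen.
exact: cb_vA (comp_weak Ha) (comp_weak Hi) (comp_var 0).
Qed.

Lemma sc_cenc : sc (fun z _ => cenc (wlen z) (vA z)).
Proof.
have HK := comp_cK; have HR := comp_cR1.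
apply: sc_cat; first exact: sc_enc_nat.
apply: sc_cat.
  apply: sc_if; first exact: cb_eq HK (comp_const 0).
    exact: sc_big (comp_const 1) (comp_const 0).
  exact: sc_enc_nat.
apply: sc_cat.
  apply: (@sc_flatten _ (fun z v k => mkseq (vA z 4 k) (cR1 (wlen z) (vA z)))) => //.
  apply: (@sc_mkseq _ (fun z v => vA z 4 (v 0))) => //.
  exact: cb_vA (comp_const 4) (comp_var 1) (comp_var 0).
apply: sc_cat.
  apply: (@sc_flatten _ (fun z v k => self_delim (mkseq (vA z 6 k) (blen (vA z 6 k) (wlen z))))) => //.
  exact: sc_big (comp_const 6) (comp_var 0).
apply: (@sc_cat (fun z _ => [:: vA z 3 0 0])); last exact: sc_big (comp_const 2) (comp_const 0).
by apply/sc_bit/cb_vA; exact: comp_const.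
Qed.

Lemma cb_leqbig a i s : computable a -> computable i -> computable s ->
  cb (fun z v => leqbig (wlen z) (vA z (a z v) (i z v)) (s z v)).
Proof.
move=> Ha Hi Hs; apply: (@cb_has (fun z v => (s z v).+1) (fun z v t =>
  all (fun j => vA z (a z v) (i z v) j == tbit t j) (iota 0 (wlen z)))); first exact: comp_succ.
apply: (@cb_all (fun z _ => wlen z) (fun z v j =>
  vA z (a z (fun x => v x.+1)) (i z (fun x => v x.+1)) j == tbit (v 0) j)); first exact: comp_wlen.
apply: cb_eqb; last exact: cb_tbit (comp_var 1) (comp_var 0).
exact: cb_vA (comp_ren (fun x => x.+2) Ha) (comp_ren (fun x => x.+2) Hi) (comp_var 0).
Qed.

Lemma comp_ccount : computable (fun z _ => ccount (wlen z) (vA z)).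
Proof.
apply: (@comp_sum _ (fun z _ k => leqbig (wlen z) (vA z 6 k) (csum (wlen z) (vA z) k))).
  exact: comp_cK.
apply: cb_leqbig (comp_const 6) (comp_var 0) _.
apply: (@comp_sum _ (fun z v r => vA z 5 (v 0) r)); first exact: comp_cR1.
exact: cb_vA (comp_const 5) (comp_var 1) (comp_var 0).
Qed.

Lemma cb_verify : cb (fun z _ => verify z).
Proof.
have HK := comp_cK; have HR := comp_cR1; have Hn := comp_wlen.
have H300 : cb (fun z _ => vA z 3 0 0) by apply: cb_vA; exact: comp_const.
apply: cb_and.
  apply: cb_eqseq; last exact: sc_cenc.
  apply: (@sc_mkseq _ (fun z _ j => inp z (2 * j + 1) == Some true)) => //.
  exact: cb_inp (comp_add (comp_mul (comp_const 2) (comp_var 0)) (comp_const 1)).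
apply: cb_and.
  apply: (@cb_all _ (fun z v k => has (vA z 6 k) (iota 0 (wlen z)))) => //.
  apply: (@cb_has _ (fun z v j => vA z 6 (v 0) j)) => //.
  exact: cb_vA (comp_const 6) (comp_var 1) (comp_var 0).
apply: cb_and.
  apply: cb_or => //; apply: (@cb_has _ (fun z v j => vA z 2 0 j)) => //.
  exact: cb_vA (comp_const 2) (comp_const 0) (comp_var 0).
apply: cb_and.
  apply: (@cb_all _ (fun z v r => all (fun k => all (fun l => vA z 5 k r && vA z 5 l r ==> (k == l))
     (iota 0 (cK (wlen z) (vA z)))) (iota 0 (cK (wlen z) (vA z))))) => //.
  apply: (@cb_all _ (fun z v k => all (fun l => vA z 5 k (v 0) && vA z 5 l (v 0) ==> (k == l))
     (iota 0 (cK (wlen z) (vA z))))) => //.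
  apply: (@cb_all _ (fun z v l => vA z 5 (v 0) (v 1) && vA z 5 l (v 1) ==> (v 0 == l))) => //.
  apply: cb_impl; last exact: cb_eq (comp_var 1) (comp_var 0).
  by apply: cb_and; apply: cb_vA (comp_const 5) (comp_var _) (comp_var 2).
apply: cb_and.
  apply: (@cb_all _ (fun z v k => all (fun r => vA z 5 k r ==> vA z 4 k r)
     (iota 0 (cR1 (wlen z) (vA z))))) => //.
  apply: (@cb_all _ (fun z v r => vA z 5 (v 0) r ==> vA z 4 (v 0) r)) => //.
  by apply: cb_impl; apply: cb_vA (comp_const _) (comp_var 1) (comp_var 0).
apply: cb_impl => //.
exact: cb_leqbig (comp_const 2) (comp_const 0) comp_ccount.
Qed.

Theorem Q2_in_NP : in_NP Q2_language.
Proof.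
exists (fun z => verify z), 7, 2; split; first exact: cb_in_P cb_verify _.
move=> w; split.
  move=> /check_complete[y [Hs Hy]]; exists y; split.
    by rewrite Hs /poly; nia.
  rewrite /verify wlen_pair wpart_pair.
  by have -> : ypart (pair_enc w y) = nth false y by apply: functional_extensionality; exact: ypart_pair.
by case=> y [_ /check_sound]; rewrite wpart_pair.
Qed.

(** * Conflict graphs as instances *)

Lemma nat_bits_inj : injective nat_bits.
Proof.
suff H n : n = bval (nth false (nat_bits n)) (size (nat_bits n)).
  by move=> m n E; rewrite (H m) (H n) E.
rewrite nat_bitsE size_mkseq -[LHS](bval_tbit (up_logP n.+1 (isT : 1 < 2))).
by apply: eq_bval => i Hi; rewrite nth_mkseq.
Qed.

Lemma self_delim_inj a b x y : self_delim a ++ x = self_delim b ++ y -> a = b /\ x = y.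
Proof.
elim: a b => [|c a IH] [|d b] //=; first by case.
by case=> -> /IH[-> ->].
Qed.

Lemma enc_nat_inj m n x y : enc_nat m ++ x = enc_nat n ++ y -> m = n /\ x = y.
Proof. by case/self_delim_inj => /nat_bits_inj. Qed.

Lemma enc_int_inj s t : enc_int s = enc_int t -> s = t.
Proof.
case: s t => m [n|n] //= [E]; have := @enc_nat_inj _ _ [::] [::] (congr1 (cat^~ [::]) E).
  by case=> ->.
by case=> -[->].
Qed.

Lemma flatten_mkseq_inj T K R (D D' : nat -> nat -> T) x y :
  flatten (mkseq (fun k => mkseq (D k) R) K) ++ x =
  flatten (mkseq (fun k => mkseq (D' k) R) K) ++ y ->
  (forall k r, k < K -> r < R -> D k r = D' k r) /\ x = y.
Proof.
elim: K D D' => [|K IH] D D' //; rewrite !mkseq_cons /= -!catA => H.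
have E : mkseq (D 0) R = mkseq (D' 0) R.
  by have := congr1 (take R) H; rewrite !take_size_cat ?size_mkseq.
have := congr1 (drop R) H; rewrite !drop_size_cat ?size_mkseq //.
case/(IH (fun k => D k.+1) (fun k => D' k.+1)) => H1 ->; split=> // -[|k] r Hk Hr.
  by have := congr1 (fun s => nth (D 0 0) s r) E; rewrite !nth_mkseq.
exact: H1.
Qed.

Lemma flatten_enc_nat_inj K (d d' : nat -> nat) x y :
  flatten (mkseq (fun k => enc_nat (d k)) K) ++ x =
  flatten (mkseq (fun k => enc_nat (d' k)) K) ++ y ->
  (forall k, k < K -> d k = d' k) /\ x = y.
Proof.
elim: K d d' => [|K IH] d d' //; rewrite !mkseq_cons /= -[LHS]catA -[RHS]catA => /enc_nat_inj[E].
by case/(IH (fun k => d k.+1) (fun k => d' k.+1)) => H1 ->; split=> // -[|k] Hk //; apply: H1.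
Qed.

(** Makes a word of the form [enc_instance I] belong to the language on account of [I] itself. Sizes
    come first, so the undelimited matrix can be cut at the right places. *)
Lemma enc_instance_inj : injective enc_instance.
Proof.
case=> K R del dm t [K' R' del' dm' t'].
have [D ->] := ord_fun2 false del; have [d ->] := ord_fun1 0 dm.
have [D' ->] := ord_fun2 false del'; have [d' ->] := ord_fun1 0 dm'.
rewrite -/(mkinst K R D d t) -/(mkinst K' R' D' d' t') !enc_instanceE.
case/enc_nat_inj => EK /enc_nat_inj[ER]; subst K' R'.
case/flatten_mkseq_inj => ED /flatten_enc_nat_inj[Ed /enc_int_inj <-].
rewrite /mkinst; congr Build_urllc_instance; apply: functional_extensionality => k.
  by apply: functional_extensionality => r; apply: ED.
exact: Ed.
Qed.

(* Blocks are pairs [(a, b)] of users. When [a] and [b] conflict they share one of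
   [(a, b)] and [(b, a)], otherwise each owns one of them; so every user has exactly
   [K] active blocks, but only [K - 1] when it is bad (loss of the diagonal). *)
Definition conf_delta K (conf : nat -> nat -> bool) (bad : nat -> bool) k r :=
  let a := r %/ K in let b := r %% K in
  if a == b then (k == a) && ~~ bad a else
  if a < b then (k == a) || (conf a b && (k == b)) else (k == a) && ~~ conf a b.

Lemma sum_nat_mul m K (F : nat -> nat) :
  \sum_(0 <= r < m * K) F r = \sum_(a < m) \sum_(b < K) F (a * K + b).
Proof.
elim: m => [|m IH]; first by rewrite big_geq ?big_ord0.
rewrite big_ord_recr /= -IH mulSnr (big_cat_nat (n := m * K)) ?leq_addr //=; congr addn.
by rewrite -{1}[m * K]add0n big_addn addKn big_mkord; apply: eq_bigr => i _; rewrite addnC.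
Qed.

Section Conflict.
Variables (K : nat) (conf : nat -> nat -> bool) (bad : nat -> bool).
Hypothesis conf_sym : forall a b, conf a b = conf b a.

Local Notation cd := (conf_delta K conf bad).

Lemma conf_deltaE k a b : b < K -> cd k (a * K + b) =
  if a == b then (k == a) && ~~ bad a else
  if a < b then (k == a) || (conf a b && (k == b)) else (k == a) && ~~ conf a b.
Proof.
move=> Hb; have K0 : 0 < K by lia.
by rewrite /conf_delta divnMDl // (divn_small Hb) addn0 modnMDl (modn_small Hb).
Qed.

(** For each [b] other than [k], exactly one of the blocks [(k, b)] and [(b, k)] is active for [k],
    in conflict or not; the diagonal block adds one unless [k] is bad. *)
Lemma conf_delta_sum (k : 'I_K) : \sum_(r < K * K) cd k r + bad k = K.
Proof.
rewrite -(big_mkord xpredT (fun r => cd k r : nat)) sum_nat_mul.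
(* Only blocks with a coordinate equal to [k] can be active for [k]. *)
rewrite (eq_bigr (fun a : 'I_K => (a == k) * \sum_(b < K) cd k (k * K + b) +
   (a != k) * cd k (a * K + k))); last first.
  move=> a _; case: (eqVneq a k) => [->|N]; first by rewrite mul1n mul0n addn0.
  rewrite mul0n mul1n add0n (bigD1 k) //= big1 ?addn0 // => b Nb.
  rewrite conf_deltaE //; move: N Nb; rewrite -!val_eqE /= => N Nb.
  by rewrite [k == a :> nat]eq_sym [k == b :> nat]eq_sym (negbTE N) (negbTE Nb) !andbF; case: ifP => // _; case: ifP.
set S := \sum_(b < K) _; rewrite big_split /= (bigD1 k) //= eqxx mul1n big1 ?addn0; last first.
  by move=> a /negbTE ->.
rewrite -big_split /= (bigD1 k) //= eqxx mul0n addn0 conf_deltaE // !eqxx /=.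
rewrite (eq_bigr (fun=> 1)); last first.
  move=> b N; rewrite N mul1n !conf_deltaE // eqxx /=.
  move: N; rewrite -val_eqE /= => N; rewrite [k == b :> nat]eq_sym (negbTE N) /=.
  by case: (ltngtP k b) N => // H _; rewrite ?(negbTE N) // conf_sym; case: (conf _ _).
have -> : \sum_(i < K | i != k) 1 = K.-1.
  by rewrite sum1_card cardC1 card_ord.
by have := ltn_ord k; case: (bad k) => /=; lia.
Qed.

Lemma Q2_conflict m :
  Q2_yes (mkinst K (K * K) cd (fun=> K) (Posz m)) <->
  exists S : {set 'I_K}, [/\ m <= #|S|, {in S, forall a : 'I_K, ~~ bad a} &
    {in S &, forall a b : 'I_K, a != b -> ~~ conf a b}].
Proof.
split=> [[Ms [x /= [Hm Hc Hd Hs]]]|[S [Hm Hb Hcf]]].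
  exists Ms.
  have Hx k : k \in Ms -> ~~ bad k /\ forall r, x k r = cd k r.
    move=> Hk; have H1 : K <= \sum_(r < K * K) x k r := Hs k Hk.
    have H2 := conf_delta_sum k.
    have H3 : \sum_(r < K * K) x k r <= \sum_(r < K * K) cd k r by apply: leq_sum.
    have E : \sum_(r < K * K) x k r = \sum_(r < K * K) cd k r.
      by apply/eqP; rewrite eqn_leq H3 (leq_trans _ H1) // -[leqRHS]H2 leq_addr.
    split.
      move: H1; rewrite E -{1}H2 -[leqRHS]addn0 leq_add2l; by case: (bad k).
    move=> r; have := leqif_sum (fun r (_ : true) => leqif_eq (Hd k r)).
    rewrite /leqif E eqxx => -[_ /esym /forallP /(_ r)] /=.
    by case: (x k r); case: (cd k r).
  split=> [|a Ha|a b Ha Hb N].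
  - by move: Hm; move: #|Ms| => c; lia.
  - by case: (Hx a Ha).
  - wlog lt_ab : a b Ha Hb N / a < b.
      move=> H; case: (ltngtP a b) => [|lt|/val_inj E]; first exact: H.
        by rewrite conf_sym; apply: H => //; rewrite eq_sym.
      by rewrite E eqxx in N.
    apply/negP => Hcf.
    have Hr : a * K + b < K * K by have := ltn_ord a; have := ltn_ord b; nia.
    have := Hc (Ordinal Hr); rewrite (bigD1 a) //= (bigD1 b) /=; last by rewrite eq_sym.
    have [_ ->] := Hx a Ha; have [_ ->] := Hx b Hb.
    rewrite /= !conf_deltaE // (ltn_eqF lt_ab) lt_ab !eqxx Hcf orbT /= //.
(* Conversely each member of [S] takes all of its active blocks, and a block active for two distinct
   users reveals a conflict. *)
exists S, (fun k r => (k \in S) && cd k r); split=> /= [|r|k r|k Hk].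
- by move: Hm; move: #|S| => c; lia.
- rewrite -big_mkcond sum1_card; apply/card_le1_eqP => l k Hl Hk.
  have /andP[Sk Dk] : (k \in S) && cd k r := Hk.
  have /andP[Sl Dl] : (l \in S) && cd l r := Hl.
  apply/eqP/negPn/negP => N.
  have := Hcf k l Sk Sl N; have := N; move: Dk Dl; rewrite -val_eqE /conf_delta /=.
  case: ifP => _; first by case/andP=> /eqP-> _ /andP[/eqP-> _]; rewrite eqxx.
  case: ifP => _; last by case/andP=> /eqP-> _ /andP[/eqP-> _]; rewrite eqxx.
  case/orP => [/eqP->|/andP[H1 /eqP->]] /orP[/eqP->|/andP[H2 /eqP->]]; rewrite ?eqxx //.
    by rewrite H2.
  by rewrite conf_sym H1.
- by case: (k \in S).
- rewrite Hk /=; have := conf_delta_sum k; rewrite (negbTE (Hb k Hk)) addn0 => E.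
  by rewrite -{1}E.
Qed.

End Conflict.

(** Users with the same quotient by [G] form a clique, so the quotient map is injective on an
    independent set; with at least [N] members it is onto, leaving exactly one user per quotient. *)
Lemma indep_choice N G (conf : nat -> nat -> bool) (bad : nat -> bool) :
  (forall a b, a != b -> a %/ G = b %/ G -> conf a b) ->
  (exists S : {set 'I_(N * G)}, [/\ N <= #|S|, {in S, forall a : 'I_(N * G), ~~ bad a} &
    {in S &, forall a b : 'I_(N * G), a != b -> ~~ conf a b}]) <->
  exists u : nat -> nat, (forall p, p < N -> u p < G /\ ~~ bad (p * G + u p)) /\
    forall p q, p < N -> q < N -> p != q -> ~~ conf (p * G + u p) (q * G + u q).
Proof.
move=> Hsame; split=> [[S [HN Hb Hc]]|[u [Hu Hc]]].
  have G0 (a : 'I_(N * G)) : 0 < G.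
    by have := leq_ltn_trans (leq0n _) (ltn_ord a); rewrite muln_gt0 => /andP[].
  have Hlt (a : 'I_(N * G)) : a %/ G < N by rewrite ltn_divLR ?(G0 a).
  pose f (a : 'I_(N * G)) := Ordinal (Hlt a).
  have inj : {in S &, injective f}.
    move=> a b Sa Sb /(congr1 val) /= E; apply/eqP/negPn/negP => Nab.
    by have := Hc a b Sa Sb Nab; rewrite Hsame.
  have HS : f @: S = [set: 'I_N].
    by apply/eqP; rewrite eqEcard subsetT cardsT card_ord (card_in_imset inj).
  have Hex p : p < N -> exists2 a : 'I_(N * G), a \in S & a %/ G = p.
    move=> Hp; have: Ordinal Hp \in f @: S by rewrite HS inE.
    by case/imsetP => a Sa /(congr1 val) /= ->; exists a.
  pose u p := if [pick a in S | a %/ G == p] is Some a then a %% G else 0.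
  have Hu p : p < N -> exists2 a : 'I_(N * G), a \in S & a = p * G + u p :> nat.
    move=> Hp; rewrite /u; case: pickP => [a /andP[Sa /eqP E]|H].
      by exists a => //; rewrite -E -divn_eq.
    by case: (Hex p Hp) => a Sa E; have := H a; rewrite Sa E eqxx.
  have Gu p : p < N -> u p < G.
    move=> Hp; have [a _ _] := Hu p Hp; rewrite /u; case: pickP => [b _|_]; last exact: G0 a.
    by rewrite ltn_mod (G0 a).
  exists u; split=> [p Hp|p q Hp Hq Npq].
    by have [a Sa E] := Hu p Hp; split; [exact: Gu|rewrite -E; apply: Hb].
  have [a Sa Ea] := Hu p Hp; have [b Sb Eb] := Hu q Hq; rewrite -Ea -Eb; apply: Hc => //.
  apply: contraNneq Npq => Eab.
  have : p * G + u p = q * G + u q by rewrite -Ea -Eb Eab.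
  move/(congr1 (divn^~ G)); rewrite /= !divnMDl ?(G0 a) // !divn_small ?addn0; [|exact: Gu|exact: Gu].
  by move=> ->.
have Hlt (p : 'I_N) : p * G + u p < N * G.
  by have [H _] := Hu p (ltn_ord p); have := ltn_ord p; nia.
pose f (p : 'I_N) := Ordinal (Hlt p).
have dv (p : 'I_N) : (p * G + u p) %/ G = p.
  have [H _] := Hu p (ltn_ord p).
  by rewrite divnMDl ?divn_small ?addn0 //; lia.
have inj : injective f.
  by move=> p q /(congr1 val) /= E; apply: val_inj; rewrite /= -dv E dv.
exists [set f p | p : 'I_N]; split.
- by rewrite card_imset // card_ord.
- by move=> a /imsetP[p _ ->]; case: (Hu p (ltn_ord p)).
- move=> a b /imsetP[p _ ->] /imsetP[q _ ->] Nab; apply: Hc => //.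
  by apply: contraNneq Nab => /val_inj ->.
Qed.

(** * Tableaux of computations *)

Lemma inp_pair_end1 w y : inp (pair_enc w y) (2 * size w + 1) = Some false.
Proof.
elim: w => // b w IH; have -> : 2 * size (b :: w) + 1 = (2 * size w + 1).+2 by move=> /=; lia.
exact: IH.
Qed.

Section Tableau.
Variable M : TM.

Definition cell := (sym * option (tm_state M))%type.
(** Carrying both neighbours makes the passage to the next row a condition on two positions only, as
    a conflict graph requires. *)
Definition tri := (cell * cell * cell)%type.
Definition aconf := (tm_state M * (nat -> sym) * nat)%type.

Definition astep (c : aconf) : aconf :=
  let: (q, F, h) := c in
  if tm_halt q then c else
  let: (q', s, mv) := tm_delta q (F h) in (q', upd F h s, hmove mv h).

Definition cellat (c : aconf) i : cell := (c.1.2 i, if i == c.2 then Some c.1.1 else None).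

Definition from_left (x : cell) : option (tm_state M) :=
  if x.2 is Some q then
    if tm_halt q then None else
    if tm_delta q x.1 is (q', _, MoveR) then Some q' else None
  else None.
Definition from_right (x : cell) : option (tm_state M) :=
  if x.2 is Some q then
    if tm_halt q then None else
    if tm_delta q x.1 is (q', _, MoveL) then Some q' else None
  else None.

Definition rule (x : tri) : cell :=
  let: (l, c, r) := x in
  if c.2 is Some q then
    if tm_halt q then c else
    let: (q', s, mv) := tm_delta q c.1 in (s, if mv is Stay then Some q' else None)
  else (c.1, if from_left l is Some q then Some q else from_right r).

(** A neighbour matters only through the head it may send over. Beyond the end of a row any headless
    cell will do. *)
Lemma rule_headless l l' r c : l.2 = None -> l'.2 = None -> rule (l, c, r) = rule (l', c, r).
Proof. by rewrite /rule /from_left => -> ->. Qed.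

Lemma rule_headless_r l r r' c : r.2 = None -> r'.2 = None -> rule (l, c, r) = rule (l, c, r').
Proof. by rewrite /rule /from_right => -> ->. Qed.

Lemma rule_cellat (c : aconf) i l : 0 < c.2 ->
  (if i is j.+1 then l = cellat c j else l.2 = None) ->
  cellat (astep c) i = rule (l, cellat c i, cellat c i.+1).
Proof.
case: c => [[q F] h] /= Hh Hl; rewrite /astep /rule /cellat /=.
case: (eqVneq i h) => [E|N] /=.
  subst i; case Hq: (tm_halt q) => /=; first by rewrite eqxx.
  case: (tm_delta q (F h)) => [[q' s] mv] /=; rewrite /upd eqxx; congr pair.
  by case: mv => /=; case: eqP => //; lia.
have El : from_left l = if i == h.+1 then from_left (F h, Some q) else None.
  case: i N Hl => [|j] N Hl; first by rewrite /from_left Hl.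
  rewrite Hl /cellat /from_left /= eqSS; case: eqP => [->|] //.
have Er : from_right (F i.+1, if i.+1 == h then Some q else None) =
    if i.+1 == h then from_right (F h, Some q) else None.
  by rewrite /from_right; case: eqP => [->|].
rewrite El Er /from_left /from_right /=.
case Hq: (tm_halt q) => /=; first by rewrite (negbTE N); do 2 case: eqP.
case: (tm_delta q (F h)) => [[q' s] mv] /=; rewrite /upd (negbTE N); congr pair.
case: mv => /=.
- have -> : (i == h.-1) = (i.+1 == h) by lia.
  by rewrite if_same.
- by case: eqP => // _; rewrite if_same.
- by rewrite (negbTE N) !if_same.
Qed.

Variable T : nat.
(** Starting in column [T.+1], the head stays within columns 1 to [2 * T + 1] during [T] steps, so
    columns 0 and [2 * T + 2] never hold it. *)
Let W := 2 * T + 3.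
Let N := T.+1 * W.
Let h0 := T.+1.

Definition F0 z i : sym := if i < h0 then None else inp z (i - h0).
Definition ac z t : aconf := iter t astep (tm_start M, F0 z, h0).

Lemma ac_head z t : t <= T -> T.+1 - t <= (ac z t).2 <= T.+1 + t.
Proof.
elim: t => [|t IH] Ht; first by rewrite /= subn0 addn0 leqnn.
have := IH (ltnW Ht); rewrite /ac iterS -/(ac z t).
case: (ac z t) => [[q F] h] /= H.
case: ifP => _ /=; first by lia.
by case: (tm_delta q (F h)) => [[q' s] mv]; case: mv => /=; lia.
Qed.

Lemma ac_run z t : t <= T ->
  crep (tm_run M t z) (ac z t).1.1 (ac z t).1.2 (ac z t).2.
Proof.
elim: t => [_|t IH Ht].
  split=> //=; rewrite /F0; case: z => [|b z].
    split=> /= [|j|j]; rewrite ?nth_nil ?if_same // /inp ?nth_nil ?if_same //.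
  split=> /= [|j|j]; rewrite /inp.
  - by rewrite ltnn subnn.
  - rewrite ifF; last by lia.
    by have -> : (h0 + j).+1 - h0 = j.+1 by lia.
  - by rewrite nth_nil; case: ifP => // ?; rewrite ifT //; lia.
have := IH (ltnW Ht); have := ac_head z (ltnW Ht).
rewrite /ac /tm_run !iterS -/(ac z t) -/(tm_run M t z).
case: (ac z t) => [[q F] h] /= Hh Hc.
case Hq: (tm_halt q).
  by case: Hc => H1 H2; rewrite /tm_step; case: (tm_run M t z) H1 H2 => q1 t1 /= -> H2; rewrite Hq.
case E: (tm_delta q (F h)) => [[q' s] mv] /=.
by apply: crep_step Hc _ E _; [rewrite Hq|lia].
Qed.

Definition tab z p : cell := cellat (ac z (p %/ W)) (p %% W).
Definition prev z p : cell := if p is p'.+1 then tab z p' else (None, None).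

Lemma W_gt0 : 0 < W. Proof. by rewrite /W addn3. Qed.

Lemma tab_rule z p : p + W < N -> tab z (p + W) = rule (prev z p, tab z p, tab z p.+1).
Proof.
have W0 := W_gt0; move=> Hp; rewrite {1}/tab divnDr // divnn W0 modnDr addn1.
rewrite /ac iterS -/(ac z (p %/ W)); set t := p %/ W; set i := p %% W.
have Ht : t < T.
  by rewrite ltn_divLR // -(ltn_add2r W) -mulSnr.
have Hi : i < W by rewrite ltn_mod.
have Ep : p = t * W + i by exact: divn_eq.
have Hh := ac_head z (ltnW Ht).
(* To the left of column 0 stands the last cell of the preceding row, which the head cannot
   reach. *)
have Hl : if i is j.+1 then (prev z p) = cellat (ac z t) j else (prev z p).2 = None.
  case: i Hi Ep => [|j] Hj Ep.
    case: p Hp @t Ht Hh Ep => // p Hp t Ht Hh Ep /=; rewrite /tab /cellat /=.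
    case E: t Ep Ht Hh => [|s] Ep Ht Hh; first by lia.
    have Ep' : p = s * W + W.-1 by move: Ep; rewrite mulSnr; lia.
    have -> : p %% W = W.-1 by rewrite Ep' modnMDl modn_small //; lia.
    have -> : p %/ W = s by rewrite Ep' divnMDl // divn_small ?addn0 //; lia.
    have Hs : s <= T by lia.
    by have := ac_head z Hs; case: eqP => // <-; rewrite /W; lia.
  rewrite Ep addnS /= /tab divnMDl // divn_small ?addn0; last by lia.
  by rewrite modnMDl modn_small //; lia.
rewrite (rule_cellat (l := prev z p)); [|lia|by move: Hl; case: (i)].
rewrite -/(tab z p).
have Ep1 : p.+1 = t * W + i.+1 by rewrite Ep addnS.
case: (ltnP i.+1 W) => Hi1.
  by rewrite Ep1 [in RHS]/tab divnMDl // (divn_small Hi1) addn0 modnMDl (modn_small Hi1).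
have Ei : i.+1 = W by lia.
(* To the right of the last column stands column 0 of the next row instead of column [W] of this
   one; both are headless. *)
apply: rule_headless_r; rewrite /cellat /=.
  by case: eqP => // E; move: Hh; rewrite -E Ei /W; lia.
rewrite Ep1 Ei -mulSnr /tab mulnK // modnMl /cellat /=.
by have := @ac_head z t.+1 Ht; case: eqP => // <-; lia.
Qed.

Lemma tab_row0 z p : p < W -> tab z p = (F0 z p, if p == h0 then Some (tm_start M) else None).
Proof. by move=> Hp; rewrite /tab divn_small // modn_small. Qed.

Lemma ac_halt z t : tm_halt (ac z t).1.1 -> forall s, ac z (s + t) = ac z t.
Proof.
move=> H; elim=> // s IH; rewrite -[LHS]/(astep (ac z (s + t))) IH.
by case: (ac z t) H => [[q F] h] /= ->.
Qed.

Variables (w : seq bool) (Y : nat).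
Let n := size w.
Let Z := 2 * n + 2 + Y.

(** Bit [j] of [self_delim w]: markers at even places, data at odd ones. Reading past the end of [w]
    gives the final pair of zeros. *)
Definition sdbit j := if odd j then inp w j./2 == Some true else j./2 < n.

(** Only rejecting halts are excluded; that the run has halted by the last row comes from the time
    bound of the verifier. *)
Definition okv (x : tri) := if x.1.2.2 is Some q then tm_halt q ==> tm_accept q else true.
Definition hcomp (x x' : tri) := (x'.1.1 == x.1.2) && (x'.1.2 == x.2).
Definition vcomp (x x' : tri) := x'.1.2 == rule x.

(* Conditions on the first row; the cells available for the certificate may hold any
   word, followed by blanks. *)
Definition init_ok (p : nat) (x : tri) : bool :=
  (x.1.2.2 == if p == h0 then Some (tm_start M) else None) &&
  ((if p < h0 then x.1.2.1 == None else
    if p - h0 < 2 * n + 2 then x.1.2.1 == Some (sdbit (p - h0)) else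
    if p - h0 < Z then (x.1.2.1 == None) ==> (x.2.1 == None)
    else x.1.2.1 == None) &&
  ((p == 0) ==> (x.1.1.2 == None))).

Definition solution (u : nat -> tri) :=
  [/\ forall p, p < N -> okv (u p), forall p, p < W -> init_ok p (u p),
      forall p, p.+1 < N -> hcomp (u p) (u p.+1) &
      forall p, p + W < N -> vcomp (u p) (u (p + W))].

Lemma inp_pair_sd y j : j < 2 * n + 2 -> inp (pair_enc w y) j = Some (sdbit j).
Proof.
move=> Hj; rewrite /sdbit; have Ej := odd_double_half j.
case: (ltnP j./2 n) => H.
  have [H1 H2] := @inp_self_delim w y _ H.
  case: (odd j) Ej => Ej.
    have -> : j = 2 * j./2 + 1 by lia.
    rewrite H2; congr Some; rewrite (_ : (2 * j./2 + 1)./2 = j./2); last by lia.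
    by rewrite /inp (nth_map false) //; case: nth.
  by have {1}-> : j = 2 * j./2 by lia.
case: (odd j) Ej => Ej; last first.
  have -> : j = 2 * n by lia.
  by rewrite inp_pair_end.
have -> : j = 2 * n + 1 by lia.
rewrite (_ : (2 * n + 1)./2 = n); last by lia.
by rewrite inp_pair_end1 /inp nth_default ?size_map.
Qed.

Hypothesis HT : Z <= T.

Lemma run_solution y : size y <= Y -> tm_halt (ac (pair_enc w y) T).1.1 ->
  tm_accept (ac (pair_enc w y) T).1.1 -> exists u, solution u.
Proof.
set z := pair_enc w y => Hy Hh Ha; have W0 := W_gt0.
have HW : h0 + Z < W by rewrite /h0 /W; lia.
exists (fun p => (prev z p, tab z p, tab z p.+1)); split=> p Hp.
- rewrite /okv /= /tab /cellat /=; case: eqP => // _; apply/implyP => Hq.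
  have Ht : p %/ W <= T by rewrite -ltnS ltn_divLR.
  by rewrite -(ac_halt Hq (T - p %/ W)) subnK.
- have Ex := tab_row0 z Hp; have Ex1 := @tab_row0 z p.+1.
  move: (tab z p) (tab z p.+1) Ex Ex1 => x x1 -> Ex1.
  rewrite /init_ok /= eqxx /=; apply/andP; split; last by case: (p).
  rewrite /F0; case: ltnP => // H1.
  case: ltnP => H2; first by rewrite inp_pair_sd.
  case: ltnP => H3.
    rewrite Ex1 /=; last by lia.
    rewrite /F0 ifF; last by lia.
    have -> : p - h0 = 2 * n + 2 + (p - h0 - (2 * n + 2)) by lia.
    have -> : p.+1 - h0 = 2 * n + 2 + (p - h0 - (2 * n + 2)).+1 by lia.
    rewrite /n !inp_pair; move: (_ - _) => i; apply/implyP; rewrite /inp.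
    case: (ltnP i (size y)) => Hi; first by rewrite (nth_map false).
    by rewrite !nth_default ?size_map // ltnW.
  by rewrite /inp nth_default // size_map size_cat size_self_delim; move: H3; rewrite /Z; lia.
- by rewrite /hcomp /= !eqxx.
- by rewrite /vcomp /= tab_rule.
Qed.

Lemma read_bits_inp (s : nat -> sym) m : (forall i, i.+1 < m -> s i = None -> s i.+1 = None) ->
  forall i, i < m -> s i = inp (read_bits (mkseq s m)) i.
Proof.
elim: m s => // m IH s Hs i Hi; rewrite mkseq_cons /=.
case E: (s 0) => [b|].
  case: i Hi => [|i] Hi; first by rewrite E.
  by rewrite (IH (fun i => s i.+1)) // => j Hj; apply: Hs.
rewrite /inp nth_nil; elim: i Hi => // i IHi Hi; apply: Hs => //; exact/IHi/ltnW.
Qed.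

Lemma size_read_bits (s : seq sym) : size (read_bits s) <= size s.
Proof. by elim: s => //= -[b|] s IH. Qed.

(** The certificate is read off the first row, and determinism then forces the rest of the
    tableau. *)
Lemma solution_run u : solution u -> exists y, size y <= Y /\
  (tm_halt (ac (pair_enc w y) T).1.1 -> tm_accept (ac (pair_enc w y) T).1.1).
Proof.
case=> Hok Hin Hh Hv; have W0 := W_gt0.
have HW : h0 + Z < W by rewrite /h0 /W; lia.
have HWN : W <= N by rewrite /N mulSn leq_addr.
pose c p := (u p).1.2.
pose s i := (c (h0 + (2 * n + 2) + i)).1.
pose y := read_bits (mkseq s Y).
have Hy : size y <= Y by apply: leq_trans (size_read_bits _) _; rewrite size_mkseq.
exists y; split=> //; set z := pair_enc w y.
have Er p : p.+1 < N -> (u p).2 = c p.+1.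
  by move=> Hp; have /andP[_ /eqP <-] := Hh p Hp.
have El p : p.+1 < N -> (u p.+1).1.1 = c p.
  by move=> Hp; have /andP[/eqP -> _] := Hh p Hp.
have Hs i : i.+1 < Y -> s i = None -> s i.+1 = None.
  move=> Hi; rewrite /s; have := Hin (h0 + (2 * n + 2) + i).
  case/(_ _)/and3P; first by move: HW; rewrite /Z; lia.
  move=> _ H _ E; move: H; rewrite ifF; last by lia.
  rewrite ifF; last by lia.
  rewrite ifT; last by rewrite /Z; lia.
  rewrite -/(c _) E eqxx /= Er ?addnS; last by move: HW; rewrite /Z; lia.
  by move/eqP.
have row0 p : p < W -> c p = tab z p.
  move=> Hp; rewrite tab_row0 // /F0; have /and3P[/eqP H1 H2 _] := Hin p Hp.
  rewrite -/(c p) in H1 H2; rewrite [LHS]surjective_pairing H1; congr pair; move: H2.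
  case: ltnP => Ha; first by move/eqP.
  case: ltnP => Hb; first by move/eqP ->; rewrite inp_pair_sd.
  set i := p - h0 - (2 * n + 2); have Ep : p - h0 = 2 * n + 2 + i by rewrite /i; lia.
  rewrite [in RHS]Ep /z /n inp_pair; case: ltnP => Hc.
    move=> _; rewrite -(read_bits_inp Hs); last by move: Hc; rewrite Ep /Z; lia.
    by rewrite /s; congr (c _).1; lia.
  by move/eqP ->; rewrite /inp nth_default // size_map; move: Hc; rewrite Ep /Z; lia.
(* Strong induction on the position: a cell outside the first row is determined by the tile [W]
   places earlier, whose three cells all come before [p] since [1 < W]. *)
have all_tab p : p < N -> c p = tab z p.
  elim/ltn_ind: p => p IH Hp; case: (ltnP p W) => HpW; first exact: row0.
  set p0 := p - W; have Ep : p = p0 + W by rewrite /p0 subnK.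
  have W2 : 1 < W by rewrite /W; lia.
  rewrite {2}Ep tab_rule -?Ep //.
  have := Hv p0; rewrite -Ep => /(_ Hp) /eqP; rewrite -/(c p) => ->.
  have Ec : (u p0).1.2 = tab z p0 by apply: IH; lia.
  have Ern : (u p0).2 = tab z p0.+1 by rewrite Er ?IH //; lia.
  have -> : u p0 = ((u p0).1.1, tab z p0, tab z p0.+1).
    by rewrite -Ec -Ern; case: (u p0) => [[]].
  (* Nothing precedes position 0; [init_ok] only makes the left part of its tile headless, which is
     all that [rule] looks at. *)
  case E0: p0 => [|p1].
    apply: rule_headless => //.
    by have /and3P[_ _ /eqP] := Hin 0 W0.
  by congr (rule (_, _, _)); rewrite El ?IH //; lia.
move=> HT'; have Hhd := ac_head z (leqnn T).
(* The position of the head in the last row, where [okv] turns halting into acceptance. *)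
set p := T * W + (ac z T).2.
have HpW : (ac z T).2 < W by rewrite /W; lia.
have Hp : p < N by rewrite /p /N mulSnr ltn_add2l.
have := Hok p Hp; rewrite /okv -/(c p) all_tab // /tab /p divnMDl // divn_small // addn0.
by rewrite modnMDl modn_small // /cellat /= eqxx => /implyP /(_ HT').
Qed.

End Tableau.

(** * NP-hardness *)

Lemma poly_mono c k m n : m <= n -> poly c k m <= poly c k n.
Proof.
move=> H; rewrite leq_add2r leq_mul2l; apply/orP; right.
by case: k => // k; rewrite leq_exp2r.
Qed.

Lemma comp_poly c k f : computable f -> computable (fun w v => poly c k (f w v)).
Proof.
by move=> Hf; apply: comp_add (comp_const c); apply: comp_mul (comp_const c) (comp_exp k Hf).
Qed.

Section Hardness.
Variables (M : TM) (c1 k1 c2 k2 : nat).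

Definition cert_bound n := poly c1 k1 n.
Definition word_bound n := 2 * n + 2 + cert_bound n.
(** The second summand makes the rows wide enough for the whole input of the verifier. *)
Definition time_bound n := poly c2 k2 (word_bound n) + word_bound n.
Definition width n := 2 * time_bound n + 3.
Definition num_cells n := (time_bound n).+1 * width n.
Definition num_tri := #|{: tri M}|.
Definition tri0 : tri M := ((None, None), (None, None), (None, None)).
Definition dec v : tri M := nth tri0 (enum {: tri M}) v.

Definition bad (w : seq bool) a :=
  let x := dec (a %% num_tri) in
  ~~ okv x || ((a %/ num_tri < width (size w)) &&
               ~~ init_ok (time_bound (size w)) w (cert_bound (size w)) (a %/ num_tri) x).
(** The first disjunct turns the tiles of one position into a clique, as [indep_choice] requires. *)
Definition viol (w : seq bool) a b :=
  ((a %/ num_tri == b %/ num_tri) && (a %% num_tri != b %% num_tri)) ||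
  (((b %/ num_tri == (a %/ num_tri).+1) && ~~ hcomp (dec (a %% num_tri)) (dec (b %% num_tri))) ||
   ((b %/ num_tri == a %/ num_tri + width (size w)) && ~~ vcomp (dec (a %% num_tri)) (dec (b %% num_tri)))).
Definition conflict w a b := viol w a b || viol w b a.

Definition num_users (w : seq bool) := num_cells (size w) * num_tri.
Definition red_inst w := mkinst (num_users w) (num_users w * num_users w)
  (conf_delta (num_users w) (conflict w) (bad w)) (fun=> num_users w) (num_cells (size w)).

Lemma num_tri_gt0 : 0 < num_tri.
Proof. by apply/card_gt0P; exists tri0. Qed.

Lemma dec_rank x : dec (enum_rank x) = x.
Proof. by rewrite /dec -[nth _ _ _](enum_val_nth tri0 (enum_rank x)) enum_rankK. Qed.

Lemma choice_solution w :
  (exists u : nat -> nat,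
    (forall p, p < num_cells (size w) -> u p < num_tri /\ ~~ bad w (p * num_tri + u p)) /\
    forall p q, p < num_cells (size w) -> q < num_cells (size w) -> p != q ->
      ~~ conflict w (p * num_tri + u p) (q * num_tri + u q)) <->
  exists u : nat -> tri M, solution (time_bound (size w)) w (cert_bound (size w)) u.
Proof.
have G0 := num_tri_gt0.
have dE p v : v < num_tri -> ((p * num_tri + v) %/ num_tri = p) * ((p * num_tri + v) %% num_tri = v).
  by move=> Hv; rewrite divnMDl // divn_small // addn0 modnMDl modn_small.
split=> [[u [Hu Hc]]|[u [H1 H2 H3 H4]]].
  exists (fun p => dec (u p)); split=> p; rewrite -/(width _) -/(num_cells _) => Hp.
  - by have [Hg] := Hu p Hp; rewrite /bad !dE // negb_or negbK => /andP[].
  - have [|Hg] := Hu p.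
      by apply: leq_trans Hp _; rewrite /num_cells mulSn leq_addr.
    by rewrite /bad !dE // Hp negb_or !negbK => /andP[].
  - have [Hg _] := Hu p (ltnW Hp); have [Hg' _] := Hu p.+1 Hp.
    have Npq : p != p.+1 by lia.
    have /norP[+ _] := Hc p p.+1 (ltnW Hp) Hp Npq.
    by rewrite /viol !dE // eqxx => /norP[_ /norP[]]; rewrite negbK.
  - have HpN : p < num_cells (size w) by apply: leq_ltn_trans (leq_addr _ _) Hp.
    have [Hg _] := Hu p HpN; have [Hg' _] := Hu _ Hp.
    have Npq : p != p + width (size w) by rewrite /width; lia.
    have /norP[+ _] := Hc p _ HpN Hp Npq.
    by rewrite /viol !dE // eqxx => /norP[_ /norP[_]]; rewrite negbK.
exists (fun p => nat_of_ord (enum_rank (u p))).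
have rG (x : tri M) : enum_rank x < num_tri := ltn_ord _.
have nviol p q : p < num_cells (size w) -> q < num_cells (size w) -> p != q ->
    ~~ viol w (p * num_tri + enum_rank (u p)) (q * num_tri + enum_rank (u q)).
  move=> Hp Hq Npq; rewrite /viol !dE // !dec_rank (negbTE Npq) /=.
  apply/norP; split; apply/nandP; rewrite negbK.
    by case: eqP => [E|]; [right; move: Hq; rewrite E; apply: H3|left].
  by case: eqP => [E|]; [right; move: Hq; rewrite E; apply: H4|left].
split=> [p Hp|p q Hp Hq Npq].
  split=> //; rewrite /bad !dE // dec_rank H1 //=; apply/nandP.
  by case: ltnP => [Hw|]; [right; rewrite negbK; apply: H2|left].
by apply/norP; split; apply: nviol => //; rewrite eq_sym.
Qed.

Lemma conflict_sym w a b : conflict w a b = conflict w b a.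
Proof. by rewrite /conflict orbC. Qed.

Lemma Q2_red_inst w : Q2_yes (red_inst w) <->
  exists u : nat -> tri M, solution (time_bound (size w)) w (cert_bound (size w)) u.
Proof.
apply: iff_trans (Q2_conflict _ _ (conflict_sym w) _) _.
apply: iff_trans (choice_solution w); apply: indep_choice => a b Nab E.
apply/orP; left; apply/orP; left; rewrite E eqxx /=; apply: contraNneq Nab => Em.
by rewrite (divn_eq a num_tri) (divn_eq b num_tri) E Em.
Qed.

Lemma num_users_gt0 w : 0 < num_users w.
Proof. by rewrite muln_gt0 num_tri_gt0 andbT muln_gt0 /width addn3. Qed.

(** * Computability of the reduction *)

Lemma comp_cert_bound : computable (fun w _ => cert_bound (size w)).
Proof. exact/comp_poly/comp_size. Qed.

Lemma comp_word_bound : computable (fun w _ => word_bound (size w)).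
Proof.
apply: comp_add comp_cert_bound; apply: comp_add (comp_const 2).
exact: comp_mul (comp_const 2) comp_size.
Qed.

Lemma comp_time_bound : computable (fun w _ => time_bound (size w)).
Proof. exact: comp_add (comp_poly _ _ comp_word_bound) comp_word_bound. Qed.

Lemma comp_width : computable (fun w _ => width (size w)).
Proof. exact: comp_add (comp_mul (comp_const 2) comp_time_bound) (comp_const 3). Qed.

Lemma comp_num_users : computable (fun w _ => num_users w).
Proof.
exact: comp_mul (comp_mul (comp_succ comp_time_bound) comp_width) (comp_const num_tri).
Qed.

Lemma cb_dec (F : tri M -> bool) a : computable a -> cb (fun w v => F (dec (a w v %% num_tri))).
Proof.
move=> Ha; apply: cb_ext (cb_table (fun v => F (dec v)) num_tri (comp_mod Ha (comp_const num_tri))) => w v.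
by rewrite ltn_mod num_tri_gt0.
Qed.

(** A relation between tiles is a finite table indexed by the pair, coded in base [num_tri]. *)
Lemma cb_dec2 (F : tri M -> tri M -> bool) a b : computable a -> computable b ->
  cb (fun w v => F (dec (a w v %% num_tri)) (dec (b w v %% num_tri))).
Proof.
move=> Ha Hb; have G0 := num_tri_gt0; have HG := comp_const num_tri.
apply: cb_ext (cb_table (fun x => F (dec (x %/ num_tri)) (dec (x %% num_tri))) (num_tri * num_tri)
  (comp_add (comp_mul (comp_mod Ha HG) HG) (comp_mod Hb HG))) => w v.
have Hva : a w v %% num_tri < num_tri by rewrite ltn_mod.
have Hvb : b w v %% num_tri < num_tri by rewrite ltn_mod.
rewrite divnMDl // (divn_small Hvb) addn0 modnMDl (modn_small Hvb) (_ : _ < _) //.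
by nia.
Qed.

Lemma cb_sdbit f : computable f -> cb (fun w v => sdbit w (f w v)).
Proof.
move=> Hf; have Hh := comp_div Hf (comp_const 2).
apply: (@cb_ext (fun w v => if odd (f w v) then inp w (f w v %/ 2) == Some true
  else f w v %/ 2 < size w)) => [w v|]; first by rewrite divn2.
apply: cb_if; [exact: cb_odd|exact: cb_inp|exact: cb_lt Hh comp_size].
Qed.

Lemma cb_bad a : computable a -> cb (fun w v => bad w (a w v)).
Proof.
move=> Ha; have Hp := comp_div Ha (comp_const num_tri).
have H0 := comp_succ comp_time_bound; have Hj := comp_sub Hp H0.
apply: cb_or; first by apply: cb_not; exact: (cb_dec _ Ha).
apply: cb_and; first exact: cb_lt Hp comp_width.
apply: cb_not.
(* The first-row condition is split into properties of the tile alone, each a finite table, selected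
   by tests on the position and on the word. *)
pose t1 (x : tri M) := x.1.2.2 == Some (tm_start M).
pose t2 (x : tri M) := x.1.2.2 == None.
pose t3 b (x : tri M) := x.1.2.1 == b.
pose t4 (x : tri M) := (x.1.2.1 == None) ==> (x.2.1 == None).
pose t5 (x : tri M) := x.1.1.2 == None.
apply: (@cb_ext (fun w v => let p := a w v %/ num_tri in let x := dec (a w v %% num_tri) in
  (if p == (time_bound (size w)).+1 then t1 x else t2 x) &&
  ((if p < (time_bound (size w)).+1 then t3 None x else
    if p - (time_bound (size w)).+1 < 2 * size w + 2 then
      if sdbit w (p - (time_bound (size w)).+1) then t3 (Some true) x else t3 (Some false) x else
    if p - (time_bound (size w)).+1 < word_bound (size w) then t4 x else t3 None x) &&
   ((p == 0) ==> t5 x)))) => [w v|].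
  rewrite /init_ok; congr (_ && _); first by case: (_ == (time_bound _).+1).
  by case: (sdbit w _).
apply: cb_and.
  by apply: cb_if; [exact: cb_eq Hp H0|exact: (cb_dec t1 Ha)|exact: (cb_dec t2 Ha)].
apply: cb_and; last first.
  by apply: cb_impl; [exact: cb_eq Hp (comp_const 0)|exact: (cb_dec t5 Ha)].
apply: cb_if; [exact: cb_lt Hp H0|exact: (cb_dec (t3 None) Ha)|].
apply: cb_if.
- apply: cb_lt Hj _; apply: comp_add (comp_const 2); exact: comp_mul (comp_const 2) comp_size.
- apply: cb_if; [exact: cb_sdbit|exact: (cb_dec (t3 (Some true)) Ha)|
                 exact: (cb_dec (t3 (Some false)) Ha)].
- apply: cb_if; [exact: cb_lt Hj comp_word_bound|exact: (cb_dec t4 Ha)|exact: (cb_dec (t3 None) Ha)].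
Qed.

Lemma cb_viol a b : computable a -> computable b -> cb (fun w v => viol w (a w v) (b w v)).
Proof.
move=> Ha Hb; have HG := comp_const num_tri.
have Hpa := comp_div Ha HG; have Hpb := comp_div Hb HG.
apply: cb_or.
  by apply: cb_and; [exact: cb_eq|apply/cb_not/cb_eq; exact: comp_mod].
apply: cb_or; apply: cb_and.
- exact: cb_eq Hpb (comp_succ Hpa).
- by apply: cb_not; exact: (cb_dec2 _ Ha Hb).
- exact: cb_eq Hpb (comp_add Hpa comp_width).
- by apply: cb_not; exact: (cb_dec2 _ Ha Hb).
Qed.

Lemma cb_conflict a b : computable a -> computable b ->
  cb (fun w v => conflict w (a w v) (b w v)).
Proof. by move=> Ha Hb; apply: cb_or; exact: cb_viol. Qed.

Lemma cb_conf_delta k r : computable k -> computable r ->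
  cb (fun w v => conf_delta (num_users w) (conflict w) (bad w) (k w v) (r w v)).
Proof.
move=> Hk Hr; have Ha := comp_div Hr comp_num_users; have Hb := comp_mod Hr comp_num_users.
have Hka := cb_eq Hk Ha.
apply: cb_if; first exact: cb_eq.
  by apply: cb_and => //; apply/cb_not/cb_bad.
apply: cb_if; first exact: cb_lt.
  apply: cb_or => //; apply: cb_and; [exact: cb_conflict|exact: cb_eq].
by apply: cb_and => //; apply/cb_not/cb_conflict.
Qed.

Lemma sc_red_inst : sc (fun w _ => enc_instance (red_inst w)).
Proof.
have HK := comp_num_users; have HKK := comp_mul HK HK.
apply: (@sc_ext (fun w _ => enc_nat (num_users w) ++ enc_nat (num_users w * num_users w) ++
  flatten (mkseq (fun k => mkseq (conf_delta (num_users w) (conflict w) (bad w) k) (num_users w * num_users w)) (num_users w)) ++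
  flatten (mkseq (fun k => enc_nat (num_users w)) (num_users w)) ++ [:: true] ++ enc_nat (num_cells (size w)))) => [w v|].
  by rewrite enc_instanceE.
apply: sc_cat; first exact: sc_enc_nat.
apply: sc_cat; first exact: sc_enc_nat.
apply: sc_cat.
  apply: (@sc_flatten _ (fun w _ k => mkseq (conf_delta (num_users w) (conflict w) (bad w) k)
    (num_users w * num_users w))) => //.
  apply: (@sc_mkseq _ (fun w v => conf_delta (num_users w) (conflict w) (bad w) (v 0))) => //.
  exact: cb_conf_delta (comp_var 1) (comp_var 0).
apply: sc_cat.
  by apply: (@sc_flatten _ (fun w _ k => enc_nat (num_users w))) => //; exact: sc_enc_nat.
apply: (@sc_cat (fun _ _ => [:: true])); first exact/sc_bit/cb_const.
by apply: sc_enc_nat; exact: comp_mul (comp_succ comp_time_bound) comp_width.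
Qed.

(** On every certificate of admissible length the verifier has halted by row [time_bound], and its
    state there gives the answer of [V]. *)
Lemma reduction_correct (V : language) w : decides_within M V (poly c2 k2) ->
  (exists y, size y <= cert_bound (size w) /\ V (pair_enc w y)) <->
  Q2_language (enc_instance (red_inst w)).
Proof.
move=> HM; have HT : word_bound (size w) <= time_bound (size w) by exact: leq_addl.
have run y : size y <= cert_bound (size w) ->
    let q := (ac M (time_bound (size w)) (pair_enc w y) (time_bound (size w))).1.1 in
    tm_halt q /\ (tm_accept q <-> V (pair_enc w y)).
  move=> Hy q; have [Hh Ha] := HM (pair_enc w y).
  have Hle : poly c2 k2 (size (pair_enc w y)) <= time_bound (size w).
    apply: leq_trans (leq_addr _ _); apply: poly_mono.
    by rewrite size_cat size_self_delim /word_bound; lia.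
  have [Eq _] := @ac_run M (time_bound (size w)) (pair_enc w y) _ (leqnn _).
  have E : tm_run M (time_bound (size w)) (pair_enc w y) =
           tm_run M (poly c2 k2 (size (pair_enc w y))) (pair_enc w y).
    by rewrite -(subnK Hle) /tm_run iterD iter_tm_halt.
  by rewrite /q -Eq E.
(* Injectivity of the encoding identifies the instance supplied by the language with
   [red_inst w]. *)
have : Q2_language (enc_instance (red_inst w)) <-> Q2_yes (red_inst w).
  split=> [[I [_ /enc_instance_inj -> //]]|H].
  by exists (red_inst w); split=> // k; exact: num_users_gt0.
move=> E; apply: iff_trans (iff_sym E); apply: iff_trans (iff_sym (Q2_red_inst w)); split.
  case=> y [Hy HV]; have [Hh Ha] := run y Hy.
  by apply: (run_solution HT Hy Hh); apply/Ha.
case=> u /(solution_run HT)[y [Hy H]]; exists y; split=> //.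
by have [Hh Ha] := run y Hy; apply/Ha/H.
Qed.

End Hardness.

Theorem theorem1 : NP_complete Q2_language.
Proof.
split; first exact: Q2_in_NP.
move=> L [V [c1 [k1 [[M [c2 [k2 HM]]] HL]]]].
exists (fun w => enc_instance (red_inst M c1 k1 c2 k2 w)); split.
  exact: sc_poly_time (sc_red_inst M c1 k1 c2 k2).
by move=> w; rewrite HL; exact: reduction_correct HM.
Qed.
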